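(* Let $\delta>0$, $T>0$ and $s>5/2$. Let $u_1,u_2$ be real-valued solutions of the Intermediate Long Wave equation $$\partial_tu-\mathcal L_\delta\partial_x^2u+\frac1\delta\partial_xu+u\,\partial_xu=0,\qquad (x,t)\in\mathbb R\times[0,T],$$ such that $$u_1,u_2\in C([0,T]:H^s(\mathbb R))\cap C^1((0,T):H^{s-2}(\mathbb R)).$$ If there exists a nonempty open set $\Omega\subset\mathbb R\times[0,T]$ such that $u_1(x,t)=u_2(x,t)$ for all $(x,t)\in\Omega$, then $u_1(x,t)=u_2(x,t)$ for all $(x,t)\in\mathbb R\times[0,T]$. In particular, if $u_1$ vanishes in $\Omega$, then $u_1\equiv0$.
   Context: $H^s(\mathbb R)$ is the usual $L^2$-based Sobolev space, and $\widehat f(\xi)=\int_{\mathbb R}e^{-2\pi i\xi x}f(x)\,dx$. The operator $\mathcal L_\delta$ is the Fourier multiplier for which $\partial_x\mathcal L_\delta=\mathcal L_\delta\partial_x$ has symbol $$2\pi\xi\coth(2\pi\delta\xi),$$ i.e. $\widehat{\mathcal L_\delta\partial_xf}(\xi)=2\pi\xi\coth(2\pi\delta\xi)\widehat f(\xi)$ (with value $1/\delta$ of the symbol at $\xi=0$); formally $\mathcal L_\delta f(x)=\frac1{2\delta}\,\mathrm{p.v.}\int\coth\left(\frac{\pi(x-y)}{2\delta}\right)f(y)\,dy$. Thus $\mathcal L_\delta\partial_x^2u$ means $(\mathcal L_\delta\partial_x)(\partial_xu)$. $C([0,T]:X)$ and $C^1((0,T):X)$ denote continuous, respectively continuously differentiable,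 functions of $t$ with values in the Banach space $X$. Under the stated regularity the equation holds pointwise. *)

(* Defs.v *)
From HB Require Import structures.
From mathcomp Require Import all_boot all_order all_algebra.
From mathcomp Require Import complex.
From mathcomp Require Import all_classical all_reals all_analysis.

Set Implicit Arguments.
Unset Strict Implicit.
Unset Printing Implicit Defensive.

Import Order.TTheory GRing.Theory Num.Theory.
Import numFieldNormedType.Exports.

Local Open Scope classical_set_scope.
Local Open Scope ring_scope.
Local Open Scope complex_scope.

Section Fourier.
Context {R : realType}.
Local Notation mu := (@lebesgue_measure R).
Local Notation Re := complex.Re.
Local Notation Im := complex.Im.
Implicit Types (f g : R -> R) (fh : R -> R[i]).

Definition expi (a : R) : R[i] := cos a +i* sin a.

Definition normc2 (z : R[i]) : R := Re z ^+ 2 + Im z ^+ 2.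

Definition cintegral (D : set R) (h : R -> R[i]) : R[i] :=
  (\int[mu]_(x in D) Re (h x)) +i* (\int[mu]_(x in D) Im (h x)).

Definition L2 : set (R -> R) := [set f | f \in Lfun mu 2%:E].

Definition L2C : set (R -> R[i]) :=
  [set h | L2 (fun x => Re (h x)) /\ L2 (fun x => Im (h x))].

Definition fourier_trunc f (n : nat) (xi : R) : R[i] :=
  cintegral `[- n%:R, n%:R] (fun x => expi (- (2 * pi * xi * x)) * (f x)%:C).

(* The integral defining the Fourier transform need not converge absolutely
   for f in L^2, so the transform is the L^2 limit of the truncated integrals;
   [fh] is thus determined up to a null set. *)
Definition is_fourier f fh : Prop :=
  [/\ L2 f, L2C fh &
    (\int[mu]_xi (normc2 (fh xi - fourier_trunc f n xi))%:E)%E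
      @[n --> \oo] --> 0%E].

(* By Plancherel's theorem the default value is only used outside L^2. *)
Definition fourier f : R -> R[i] := xget (fun=> 0) [set fh | is_fourier f fh].

Definition weighted_norm (s : R) fh : \bar R :=
  ((\int[mu]_xi (((1 + xi ^+ 2) `^ s) * normc2 (fh xi))%:E) `^ 2^-1)%E.

Definition sobolev_norm (s : R) f : \bar R := weighted_norm s (fourier f).

(* Real-valued H^s(R) as a space of functions, for s >= 0 (where it is a
   subspace of L^2).  Elements are not identified up to null sets. *)
Definition sobolev (s : R) : set (R -> R) :=
  [set f | exists2 fh, is_fourier f fh & (weighted_norm s fh < +oo)%E].

(* C(D : H^s) *)
Definition C0_sobolev (D : set R) (s : R) (u : R -> R -> R) : Prop :=
  forall t, D t -> sobolev s (u t) /\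
    sobolev_norm s (u r - u t) @[r --> within D (nbhs t)] --> 0%E.

(* C^1(D : H^s), for D open; [v] is the H^s-valued derivative *)
Definition C1_sobolev (D : set R) (s : R) (u : R -> R -> R) : Prop :=
  (forall t, D t -> sobolev s (u t)) /\
  exists2 v, C0_sobolev D s v &
    forall t, D t ->
      sobolev_norm s (h^-1 *: (u (t + h) - u t) - v t) @[h --> 0^'] --> 0%E.

Definition coth (x : R) : R := (expR x + expR (- x)) / (expR x - expR (- x)).

Definition Ldx_symbol (delta xi : R) : R :=
  if xi == 0 then delta^-1 else 2 * pi * xi * coth (2 * pi * delta * xi).

(* g is a representative of (L_delta d_x) f *)
Definition is_Ldx (delta : R) f g : Prop :=
  exists2 fh, is_fourier f fh &
    is_fourier g (fun xi => (Ldx_symbol delta xi)%:C * fh xi).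

(* [u t] is the function x |-> u(x, t), taken to be the continuous
   representative of its class.  The nonlocal term (L_delta d_x)(d_x u) is given
   by its continuous representative [g], so that the equation makes sense
   at every point. *)
Definition ILW_equation (delta T : R) (u : R -> R -> R) : Prop :=
  (forall t, t \in `[0, T] -> continuous (u t)) /\
  forall t, t \in `]0, T[ ->
    exists g, [/\ continuous g, is_Ldx delta (derive1 (u t)) g &
      forall x,
        derive1 (u^~ x) t - g x + delta^-1 * derive1 (u t) x
          + u t x * derive1 (u t) x = 0].

Definition ILW_solution (delta T s : R) (u : R -> R -> R) : Prop :=
  [/\ C0_sobolev `[0, T] s u, C1_sobolev `]0, T[ (s - 2) u
    & ILW_equation delta T u].

(* R x [0, T], as pairs (x, t) *)
Definition strip (T : R) : set (R * R) := [set p | p.2 \in `[0, T]].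

Definition open_in_strip (T : R) (Omega : set (R * R)) : Prop :=
  exists2 O : set (R * R), open O & Omega = O `&` strip T.

End Fourier.

(* Main.v *)
(* The Fourier transform is handled in real form: for real [f] with transform
   [a + ib], the Hartley transform [a - b] has the real kernel cas = cos + sin
   and is an involution.

   Unique continuation at a fixed time: let [k] be integrable with
   [m k] integrable, [m] the symbol, and let [f], [g] be the transforms of [k]
   and [m k], so that [g = L_delta d_x f].  For 0 < th < pi the kernel
   [K0 = sin th / (cosh + cos th)] and [K1 = dK0/dth], both scaled by th / delta
   and centred at [p], satisfy int g K0 = (th / delta) int f K1.  As both [f] and [g] vanish on
   an interval, letting th tend to pi shows that
   [f(y) / (cosh (pi (y - p) / delta) - 1)] has integral zero for all [p] in the
   interval.  In the variable [z = 1 / (exp (pi (y - x0) / delta) - 1)], with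
   [x0] the centre of the interval, Taylor expansion in [p] gives the vanishing
   of all moments of a density proportional to [f] on the bounded range of [z],
   hence [f = 0].

   If [u1 = u2] on [Omega], this applied at one time [t1] to the space
   derivative of [w = u1 - u2] yields [w(t1) = 0]: the equation forces
   [L_delta d_x^2 w = 0] wherever [w] vanishes.  The energy estimate
   [|d/dt |w|^2| <= C |w|^2], where the dispersive terms drop out by parity on
   the frequency side, and Gronwall's lemma forwards and backwards in time
   propagate this to the whole of [0, T]. *)

Require Import Defs.
From HB Require Import structures.
From mathcomp Require Import all_boot all_order all_algebra.
From mathcomp Require Import complex.
From mathcomp Require Import all_classical all_reals all_analysis.
From mathcomp Require Import measurable_realfun ring lra.

Set Implicit Arguments.
Unset Strict Implicit.
Unset Printing Implicit Defensive.

Import Order.TTheory GRing.Theory Num.Theory.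
Import numFieldNormedType.Exports.

Local Open Scope classical_set_scope.
Local Open Scope ring_scope.

(** * Integration on the real line *)

(** The kernel solves a Dirichlet problem in a strip. [K0] is harmonic in (y, th) and vanishes at th
    = 0, so the cosine transform D(th) of y -> K0 th (b y) satisfies D'' = (k / b)^2 D with D(0) =
    0. It is a multiple of sinh (k th / b), and b D' / D = k coth (k th / b). The scale b = th /
    delta turns the argument into k delta for every th: one symbol is reached by a whole family of
    decaying kernels. Hence the limit. No complex analysis is used to finish: moving p acts on the
    exponential variable by a Moebius map, which makes the kernel a squared resolvent in a bounded
    real variable z, so moments and a polynomial peak suffice. The bound s > 5/2 enters as s - 2 >
    1/2: it puts (1 + xi^2) times the transform in L^1, so every linear term of the equation is an
    absolutely convergent transform and holds pointwise. *)

Section RealIntegral.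
Context {R : realType}.
Local Notation mu := (@lebesgue_measure R).
Implicit Types (f g h : R -> R) (a b c : R).

Definition L1 f : Prop := mu.-integrable setT (EFin \o f).
Definition intR f : R := \int[mu]_x f x.

Lemma aeS (P Q : R -> Prop) : (forall x, P x -> Q x) ->
  {ae mu, forall x, P x} -> {ae mu, forall x, Q x}.
Proof.
by move=> PQ; apply: filterS => //; exact: (ae_filter_ringOfSetsType mu).
Qed.

Lemma L1_measurable f : L1 f -> measurable_fun setT f.
Proof. by move=> /measurable_int/measurable_EFinP. Qed.

Lemma L1_le g f : measurable_fun setT f -> L1 g ->
  (forall x, `|f x| <= g x) -> L1 f.
Proof.
move=> mf Lg fg; apply: le_integrable Lg => //; first exact/measurable_EFinP.
by move=> x _ /=; rewrite lee_fin (le_trans (fg x))// ler_norm.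
Qed.

Lemma eq_L1 f g : f =1 g -> L1 f -> L1 g.
Proof. by move=> /funext ->. Qed.

Lemma L1D f g : L1 f -> L1 g -> L1 (fun x => f x + g x).
Proof. by move=> Lf Lg; exact: (integrableD _ Lf Lg). Qed.

Lemma L1B f g : L1 f -> L1 g -> L1 (fun x => f x - g x).
Proof. by move=> Lf Lg; exact: (integrableB _ Lf Lg). Qed.

Lemma L1Z c f : L1 f -> L1 (fun x => c * f x).
Proof. by move=> Lf; exact: (integrableZl _ c Lf). Qed.

Lemma L1N f : L1 f -> L1 (fun x => - f x).
Proof. by move=> Lf; exact: (integrableN Lf). Qed.

Lemma L1_norm f : L1 f -> L1 (fun x => `|f x|).
Proof. by move=> Lf; exact: (integrable_norm Lf). Qed.

Lemma L1_0 : L1 (fun=> 0).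
Proof. exact: integrable0. Qed.

Lemma L1_bmul M (k : R -> R) f : measurable_fun setT k -> (forall x, `|k x| <= M) ->
  L1 f -> L1 (fun x => k x * f x).
Proof.
move=> mk kM Lf; apply: (@L1_le (fun x => M * `|f x|)).
- by apply: measurable_funM => //; exact: L1_measurable.
- exact/L1Z/L1_norm.
- by move=> x; rewrite normrM ler_wpM2r.
Qed.

Lemma intRD f g : L1 f -> L1 g -> intR (fun x => f x + g x) = intR f + intR g.
Proof. by move=> Lf Lg; exact: RintegralD. Qed.

Lemma intRB f g : L1 f -> L1 g -> intR (fun x => f x - g x) = intR f - intR g.
Proof. by move=> Lf Lg; exact: RintegralB. Qed.

Lemma intRZ c f : L1 f -> intR (fun x => c * f x) = c * intR f.
Proof. by move=> Lf; exact: RintegralZl. Qed.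

Lemma intRN f : L1 f -> intR (fun x => - f x) = - intR f.
Proof.
by move=> Lf; rewrite -mulN1r -intRZ//; congr intR; apply/funext => x; rewrite mulN1r.
Qed.

Lemma intR0 : intR (fun=> 0) = 0.
Proof. by rewrite /intR Rintegral_cst// mul0r. Qed.

Lemma le_intR f g : L1 f -> L1 g -> (forall x, f x <= g x) -> intR f <= intR g.
Proof. by move=> Lf Lg fg; exact: le_Rintegral. Qed.

Lemma intR_ge0 f : (forall x, 0 <= f x) -> 0 <= intR f.
Proof. by move=> f0; exact: Rintegral_ge0. Qed.

Lemma norm_intR f : L1 f -> `|intR f| <= intR (fun x => `|f x|).
Proof. by move=> Lf; exact: le_normr_Rintegral. Qed.

Lemma norm_intR_le f g : measurable_fun setT f -> L1 g ->
  (forall x, `|f x| <= g x) -> `|intR f| <= intR g.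
Proof.
move=> mf Lg fg; have Lf := L1_le mf Lg fg.
by apply: (le_trans (norm_intR Lf)); apply: le_intR => //; exact: L1_norm.
Qed.

Lemma EFin_intR f : L1 f -> ((intR f)%:E = \int[mu]_x (f x)%:E)%E.
Proof. by move=> Lf; rewrite fineK//; exact: integrable_fin_num. Qed.

Lemma L1_ge0_lty f : measurable_fun setT f -> (forall x, 0 <= f x) ->
  (\int[mu]_x (f x)%:E < +oo)%E -> L1 f.
Proof.
move=> mf f0 fy; apply/integrableP; split; first exact/measurable_EFinP.
by under eq_integral => x _ do rewrite gee0_abs ?lee_fin//.
Qed.

Lemma dominated_intR (F : nat -> R -> R) f g :
  (forall n, measurable_fun setT (F n)) -> L1 g ->
  (forall x, F n x @[n --> \oo] --> f x) ->
  (forall n x, `|F n x| <= g x) ->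
  L1 f /\ intR (F n) @[n --> \oo] --> intR f.
Proof.
move=> mF Lg Ff Fg.
have mf : measurable_fun setT f.
  by apply: measurable_fun_cvg => //; move=> x _; exact: Ff.
have mFE n : measurable_fun setT (EFin \o F n) by exact/measurable_EFinP.
have mfE : measurable_fun setT (EFin \o f) by exact/measurable_EFinP.
have FfE : {ae mu, forall x, setT x -> (EFin \o F n) x @[n --> \oo] --> (EFin \o f) x}.
  by apply: aeW => x _; apply: cvg_EFin; [exact: nearW | exact: Ff].
have FgE : {ae mu, forall x n, setT x -> (`|(EFin \o F n) x| <= (EFin \o g) x)%E}.
  by apply: aeW => x n _; rewrite lee_fin.
have [Lf _ cf] := @dominated_convergence _ _ _ mu setT measurableT _ _ _ mFE mfE FfE Lg FgE.
split => //; apply: fine_cvg; rewrite fineK//; exact: integrable_fin_num.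
Qed.

Lemma intR_eq0_ae f : L1 f -> (forall x, 0 <= f x) -> intR f = 0 ->
  {ae mu, forall x, f x = 0}.
Proof.
move=> Lf f0 If; have mf := measurable_int _ Lf.
have : ae_eq mu setT (EFin \o f) (cst 0%E).
  apply/(ae_eq_integral_abs mu measurableT mf).
  under eq_integral => x _ do rewrite /= ger0_norm//.
  by rewrite -EFin_intR// If.
by apply: aeS => x /(_ I) [].
Qed.

Lemma ae_eq_intR f g : measurable_fun setT f -> measurable_fun setT g ->
  {ae mu, forall x, f x = g x} -> intR f = intR g.
Proof.
move=> mf mg fg; congr fine; apply: ae_eq_integral => //.
- exact/measurable_EFinP.
- exact/measurable_EFinP.
by apply: aeS fg => x /= ->.
Qed.

Lemma ae_eq_L1 f g : measurable_fun setT g ->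
  {ae mu, forall x, f x = g x} -> L1 f -> L1 g.
Proof.
move=> mg fg /integrableP[mf fy]; apply/integrableP.
split; first exact/measurable_EFinP.
rewrite -(_ : (\int[mu]_x `|(EFin \o f) x| = \int[mu]_x `|(EFin \o g) x|)%E)//.
apply: ae_eq_integral => //.
- exact: measurableT_comp.
- by apply: measurableT_comp => //; exact/measurable_EFinP.
by apply: aeS fg => x /= ->.
Qed.

(** Form of [L2] that exposes measurability and the integral of the square; [L2_SQ] and [SQ_L2]
    convert. *)
Definition SQ f : Prop := measurable_fun setT f /\ L1 (fun x => f x ^+ 2).

Lemma L2_SQ f : L2 f -> SQ f.
Proof.
rewrite /L2/= => fL; split; last exact: Lfun2_integrable_sqr.
by move: fL; rewrite inE => /andP[/[!inE]].
Qed.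

Lemma SQ_L2 f : SQ f -> L2 f.
Proof.
move=> [mf Lf]; rewrite /L2/= inE; apply/andP; split; rewrite inE//=.
rewrite /finite_norm unlock/=; apply: poweR_lty.
have /integrableP[_] := Lf; apply: le_lt_trans.
rewrite (_ : (\int[mu]_x _)%E = \int[mu]_x `|(EFin \o (fun x => (f x ^+ 2)%R)) x|)%E//.
by apply: eq_integral => x _ /=; rewrite powR_mulrn// normrX.
Qed.

Lemma SQM f g : SQ f -> SQ g -> L1 (fun x => f x * g x).
Proof.
move=> /SQ_L2 f2 /SQ_L2 g2; apply/Lfun1_integrable.
exact: Lfun2_mul_Lfun1.
Qed.

Lemma SQD f g : SQ f -> SQ g -> SQ (fun x => f x + g x).
Proof.
move=> f2 g2; have [mf Lf] := f2; have [mg Lg] := g2.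
split; first exact: measurable_funD.
have := L1D (L1D Lf Lg) (L1Z 2 (SQM f2 g2)).
by apply: eq_L1 => x; ring.
Qed.

Lemma SQZ c f : SQ f -> SQ (fun x => c * f x).
Proof.
move=> [mf Lf]; split; first exact: measurable_funM.
by have := L1Z (c ^+ 2) Lf; apply: eq_L1 => x; ring.
Qed.

Lemma SQB f g : SQ f -> SQ g -> SQ (fun x => f x - g x).
Proof.
move=> f2 g2; have := SQD f2 (SQZ (-1) g2).
by congr SQ; apply/funext => x; ring.
Qed.

Lemma SQ_bmul M (k : R -> R) f : measurable_fun setT k -> (forall x, `|k x| <= M) ->
  SQ f -> SQ (fun x => k x * f x).
Proof.
move=> mk kM [mf Lf]; split; first exact: measurable_funM.
have : L1 (fun x => (k x) ^+ 2 * f x ^+ 2).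
  apply: (@L1_bmul (M ^+ 2)) => //; first exact: measurable_funX.
  move=> x; rewrite normrX ler_sqr ?nnegrE// .
  by rewrite (le_trans _ (kM x)).
by apply: eq_L1 => x; rewrite exprMn.
Qed.

Definition n2 f : R := intR (fun x => f x ^+ 2).

Lemma n2_ge0 f : 0 <= n2 f.
Proof. by apply: intR_ge0 => x; exact: sqr_ge0. Qed.

Lemma cauchy_schwarz f g : SQ f -> SQ g ->
  (intR (fun x => f x * g x)) ^+ 2 <= n2 f * n2 g.
Proof.
move=> f2 g2; set I := intR _.
have q (t : R) : 0 <= n2 f - 2 * t * I + t ^+ 2 * n2 g.
  have Lfg := SQM f2 g2; have [_ Lf] := f2; have [_ Lg] := g2.
  rewrite -(intRZ _ Lfg) -(intRZ _ Lg) -intRB; [|by []|exact: L1Z].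
  rewrite -intRD; [|by apply: L1B => //; exact: L1Z|exact: L1Z].
  apply: intR_ge0 => x; rewrite (_ : _ + _ = (f x - t * g x) ^+ 2); last by ring.
  exact: sqr_ge0.
have := n2_ge0 g; rewrite le_eqVlt => /predU1P[g0|g0].
  rewrite -g0 mulr0 leNgt; apply/negP => I0.
  have I1 : I != 0 by apply: contraTneq I0 => ->; rewrite expr0n ltxx.
  (* With [n2 g = 0] the quadratic is affine in [t]; this [t] gives it the value -1. *)
  have := q ((n2 f + 1) / (2 * I)); rewrite -g0 mulr0 addr0.
  rewrite (_ : n2 f - _ = -1); first by rewrite lerNr oppr0 ler10.
  by field.
have := q (I / n2 g).
rewrite (_ : _ + _ = (n2 f * n2 g - I ^+ 2) / n2 g); last by field; rewrite gt_eqF.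
by rewrite pmulr_lge0 ?invr_gt0// subr_ge0.
Qed.

Lemma cauchy_schwarz_sqrt f g : SQ f -> SQ g ->
  `|intR (fun x => f x * g x)| <= Num.sqrt (n2 f) * Num.sqrt (n2 g).
Proof.
move=> f2 g2; rewrite -sqrtrM ?n2_ge0// -sqrtr_sqr ler_wsqrtr//.
exact: cauchy_schwarz.
Qed.

Lemma cvg0_le (T : Type) (F : set_system T) {FF : ProperFilter F} (u v : T -> R) :
  (\forall i \near F, `|u i| <= v i) -> v i @[i --> F] --> 0 ->
  u i @[i --> F] --> 0.
Proof.
move=> uv v0; apply/cvgr0Pnorm_le => e e0.
have := @cvgr0_norm_le _ _ _ F FF v v0 _ e0; apply: filterS2 uv => i ui vi.
by rewrite (le_trans ui)// (le_trans (ler_norm _)).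
Qed.

(** Stated for an arbitrary filter: it serves truncations, n to infinity, and difference quotients
    in time, h to 0. *)
Lemma cvg_pairing (T : Type) (F : set_system T) {FF : ProperFilter F}
    (f_ : T -> R -> R) f g :
  (\forall i \near F, SQ (f_ i)) -> SQ f -> SQ g ->
  n2 (fun x => f_ i x - f x) @[i --> F] --> 0 ->
  intR (fun x => f_ i x * g x) @[i --> F] --> intR (fun x => f x * g x).
Proof.
move=> f_2 f2 g2 cv; apply/subr_cvg0.
have cv' : Num.sqrt (n2 (fun x => f_ i x - f x)) * Num.sqrt (n2 g) @[i --> F] --> 0.
  rewrite -(mul0r (Num.sqrt (n2 g))); apply: cvgM; last exact: cvg_cst.
  by rewrite -sqrtr0; apply: continuous_cvg => //; exact: sqrt_continuous.
apply: cvg0_le cv'; apply: filterS f_2 => i fi2 /=.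
rewrite -intRB; [|exact: SQM..].
rewrite (_ : (fun _ => _) = fun x => (f_ i x - f x) * g x); last first.
  by apply/funext => x; ring.
by apply: cauchy_schwarz_sqrt => //; exact: SQB.
Qed.

End RealIntegral.

(** * Measure-preserving substitutions and Fubini for bounded kernels *)

Section MoreIntegral.
Context {R : realType}.
Local Notation mu := (@lebesgue_measure R).
Implicit Types (f g h : R -> R) (a b c : R).

(** Lebesgue measure is the only measure giving half-open intervals their length, so the pushforward
    need only be tested on those. *)
Lemma lebesgue_preserving (phi : R -> measurableTypeR R) : measurable_fun setT phi ->
  (forall a b : R, a < b -> mu (phi @^-1` `]a, b]) = (b - a)%:E) ->
  forall A, measurable A -> mu A = pushforward mu phi A.
Proof.
move=> mphi phiE A mA.
pose m : {mfun _ >-> _} := mfun_Sub (mem_set mphi).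
apply: (@lebesgue_measure_unique _ (pushforward mu m)) => //= X /ocitvP[->|[[a b] /= ab ->]].
  by rewrite !measure0.
rewrite lebesgue_measure_itv/= lte_fin ab.
by rewrite /pushforward/= phiE.
Qed.

Lemma intR_preserving (phi : R -> R) f : measurable_fun setT phi ->
  (forall a b : R, a < b -> mu (phi @^-1` `]a, b]) = (b - a)%:E) ->
  L1 f -> L1 (fun x => f (phi x)) /\ intR (fun x => f (phi x)) = intR f.
Proof.
move=> mphi phiE Lf.
have muE := lebesgue_preserving mphi phiE.
have mf := measurable_int _ Lf; have Lf' := Lf.
have mphi' : measurable_fun [set: measurableTypeR R]
  (phi : measurableTypeR R -> measurableTypeR R) := mphi.
pose m := @mfun_Sub _ _ (measurableTypeR R) (measurableTypeR R) _ (mem_set mphi').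
have E (g : measurableTypeR R -> \bar R) :
    (\int[mu]_x g x = \int[pushforward mu m]_x g x)%E.
  by apply: eq_measure_integral => A mA _; exact: muE.
have Lfp : L1 (fun x => f (phi x)).
  move/integrableP : Lf => [_ fy].
  apply/integrableP; split.
    by apply/measurable_EFinP; apply: measurableT_comp => //; exact: L1_measurable Lf'.
  move: fy; rewrite E.
  by rewrite ge0_integral_pushforward//; apply: measurableT_comp.
split => //; rewrite /intR/Rintegral [in RHS]E.
by rewrite integral_pushforward.
Qed.

Lemma intR_opp f : L1 f -> L1 (fun x => f (- x)) /\ intR (fun x => f (- x)) = intR f.
Proof.
apply: intR_preserving => // a b ab.
by rewrite opp_preimage_itvbndbnd/= lebesgue_measure_itv/= lte_fin ltrN2 ab opprK addrC.
Qed.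

Lemma intR_shift p f : L1 f ->
  L1 (fun x => f (x + p)) /\ intR (fun x => f (x + p)) = intR f.
Proof.
apply: intR_preserving => [|a b ab]; first exact: measurable_funD.
rewrite (_ : _ @^-1` _ = `]a - p, b - p]%classic).
  by rewrite lebesgue_measure_itv/= lte_fin ltrD2r ab -EFinB; congr EFin; ring.
by apply/seteqP; split => x /=; rewrite !in_itv/= ltrBlDr lerBrDr.
Qed.

Lemma SQ_opp f : SQ f -> SQ (fun x => f (- x)).
Proof.
move=> [mf Lf]; split; last by have [] := intR_opp Lf.
exact: measurableT_comp.
Qed.

(** The bound on [k] makes k(x, y) f(x) g(y) integrable on the plane by Tonelli, which Fubini
    requires. *)
Lemma intR_swap M (k : R -> R -> R) f g :
  measurable_fun setT (fun p : R * R => k p.1 p.2) ->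
  (forall x y, `|k x y| <= M) -> L1 f -> L1 g ->
  intR (fun x => f x * intR (fun y => k x y * g y)) =
  intR (fun y => g y * intR (fun x => k x y * f x)).
Proof.
move=> mk kM Lf Lg.
have mf := L1_measurable Lf; have mg := L1_measurable Lg.
have mky x : measurable_fun setT (k x).
  exact: (measurableT_comp mk (pair1_measurable x)).
have mkx y : measurable_fun setT (k ^~ y).
  exact: (measurableT_comp mk (pair2_measurable y)).
have Lk x : L1 (fun y => k x y * g y) by exact: (L1_bmul (mky x)).
have Lk' y : L1 (fun x => k x y * f x) by exact: (L1_bmul (mkx y)).
have M0 : 0 <= M := le_trans (normr_ge0 _) (kM 0 0).
pose F (p : measurableTypeR R * measurableTypeR R) := (k p.1 p.2 * f p.1 * g p.2)%:E.
have mF : measurable_fun setT F.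
  apply/measurable_EFinP; apply: measurable_funM; last first.
    by apply: measurableT_comp => //.
  by apply: measurable_funM => //; apply: measurableT_comp.
have iF : (mu \x mu)%E.-integrable setT F.
  apply/(@integrable12ltyP _ _ _ _ _ mu mu _ mF).
  apply: (@le_lt_trans _ _ (\int[mu]_x ((M * intR (fun y => `|g y|)) * `|f x|)%:E)%E); last first.
    have := L1Z (M * intR (fun y => `|g y|)) (L1_norm Lf).
    by move/EFin_intR => <-; rewrite ltry.
  apply: ge0_le_integral => //.
  - by move=> x _; exact: integral_ge0.
  - apply: (@measurable_fun_fubini_tonelli_F _ _ _ _ _ mu (abse \o F)).
      exact: measurableT_comp.
    by move=> p; exact: abse_ge0.
  - apply/measurable_EFinP; apply: measurable_funM => //.
    exact: measurableT_comp.
  - move=> x _; rewrite /F/=.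
    rewrite mulrAC -intRZ; last exact: L1_norm.
    rewrite EFin_intR; last by apply: L1Z; exact: L1_norm.
    have mkfg : measurable_fun setT (fun y => k x y * f x * g y).
      by apply: measurable_funM => //; apply: measurable_funM.
    apply: ge0_le_integral => //.
    + by apply/measurable_EFinP; exact: (measurableT_comp _ mkfg).
    + apply/measurable_EFinP; apply: (@measurable_funM _ R R); last exact: measurableT_comp.
      exact: (@measurable_cst _ _ R R).
    + by move=> y _; rewrite lee_fin !normrM -!mulrA ler_wpM2r// mulr_ge0.
have := Fubini iF; rewrite /F/= => FF.
congr fine.
rewrite (_ : (\int[mu]_x _)%E = (\int[mu]_x \int[mu]_y (k x y * f x * g y)%:E)%E).
  rewrite FF; apply: eq_integral => y _.
  rewrite -intRZ// EFin_intR; last exact: L1Z.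
  by apply: eq_integral => x _; congr EFin; ring.
apply: eq_integral => x _; rewrite -intRZ// EFin_intR; last exact: L1Z.
by apply: eq_integral => y _; congr EFin; ring.
Qed.

End MoreIntegral.

(** * Differentiation under the integral and the fundamental theorem of calculus *)

Section Calculus.
Context {R : realType}.
Local Notation mu := (@lebesgue_measure R).
Implicit Types (f g h F : R -> R) (a b c l : R).

Lemma continuous_intR (F : R -> R -> R) g :
  (forall p, measurable_fun setT (F p)) -> L1 g ->
  (forall p y, `|F p y| <= g y) -> (forall y, continuous (F ^~ y)) ->
  continuous (fun p => intR (F p)).
Proof.
move=> mF Lg Fg cF p.
have LF q : L1 (F q) by exact: L1_le (Fg q).
apply: (@continuity_under_integral R _ _ mu F setT measurableT (p - 1) (p + 1) _ _ g Lg).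
- by move=> x _; exact: LF.
- by apply: aeW => y _ x _; exact: cF.
- by move=> x _; apply: aeW => y _; exact: Fg.
by rewrite inE/= in_itv/= ltrBlDr ltrDl ltr01/=.
Qed.

Lemma is_derive_intR (F F' : R -> R -> R) (u v a : R) g :
  u < a < v -> (forall x, u < x < v -> L1 (F x)) ->
  (forall x y, u < x < v -> is_derive x 1 (F ^~ y) (F' x y)) ->
  L1 g -> (forall x y, u < x < v -> `|F' x y| <= g y) ->
  is_derive a 1 (fun x => intR (F x)) (intR (F' a)).
Proof.
move=> uav LF dF Lg F'g.
have Ia : `]u, v[%classic a by rewrite /= in_itv.
have g0 y : 0 <= g y by rewrite (le_trans _ (F'g a y uav)).
have dE x y : u < x < v -> partial1of2 F x y = F' x y.
  by move=> uxv; rewrite partial1of2E; apply: (@derive_val _ _ _ _ _ _ _ (dF x y uxv)).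
have H1 x : `]u, v[%classic x -> mu.-integrable setT (EFin \o F x) by rewrite /= in_itv; exact: LF.
have H2 x y : `]u, v[%classic x -> setT y -> derivable (F ^~ y) x 1.
  by rewrite /= in_itv/= => uxv _; have := dF x y uxv => -[].
have H3 x y : `]u, v[%classic x -> setT y -> `|partial1of2 F x y| <= g y.
  by rewrite /= in_itv/= => uxv _; rewrite dE//; exact: F'g.
apply: DeriveDef.
  exact: (@derivable_under_integral R _ _ mu F setT measurableT a u v Ia H1 H2 g g0 Lg H3).
rewrite -derive1E.
rewrite (@differentiation_under_integral R _ _ mu F setT measurableT a u v Ia H1 H2 g g0 Lg H3).
by apply: eq_Rintegral => y _; exact: dE.
Qed.

Lemma intR_patch (A : set R) f : intR (f \_ A) = \int[mu]_(x in A) f x.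
Proof. by rewrite [RHS]Rintegral_mkcond. Qed.

Lemma L1_patch (A : set R) f : measurable A -> L1 f -> L1 (f \_ A).
Proof.
move=> mA Lf; apply: (@L1_le _ (fun x => `|f x|)); last 2 first.
- exact: L1_norm.
- by move=> x; rewrite patchE; case: ifP => // _; rewrite normr0.
apply/(measurable_restrictT _ mA).
by apply: measurable_funTS; exact: L1_measurable.
Qed.

Lemma continuous_measurable f : continuous f -> measurable_fun setT f.
Proof. exact: continuous_measurable_fun. Qed.

Lemma continuous_L1_patch f a b : continuous f -> L1 (f \_ `[a, b]).
Proof.
move=> cf.
have /(integrable_mkcond _ _) : mu.-integrable `[a, b] (EFin \o f).
  apply: continuous_compact_integrable; first exact: segment_compact.
  exact: continuous_subspaceT.
by rewrite /L1 -restrict_EFin; apply.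
Qed.

Lemma FTC2_intR f F a b : a <= b -> continuous f ->
  (forall x : R, is_derive x (1 : R) F (f x)) -> intR (f \_ `[a, b]) = F b - F a.
Proof.
move=> + cf dF; rewrite le_eqVlt => /predU1P[->|ab].
  by rewrite intR_patch set_itv1 Rintegral_set1 subrr.
have cF : continuous F.
  by move=> x; apply/differentiable_continuous/derivable1_diffP; have [] := dF x.
rewrite intR_patch /Rintegral (@continuous_FTC2 _ f F)//.
- exact: continuous_subspaceT.
- split.
  + by move=> x _; have [] := dF x.
  + exact/cvg_at_right_filter/cF.
  + exact/cvg_at_left_filter/cF.
- by move=> x _; rewrite derive1E; apply: (@derive_val _ _ _ _ _ _ _ (dF x)).
Qed.

Lemma cvg_intR_trunc f : L1 f ->
  intR (f \_ `[- n%:R, n%:R]) @[n --> \oo] --> intR f.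
Proof.
move=> Lf; have mf := L1_measurable Lf.
have [|||//] := @dominated_intR R (fun n => f \_ `[- n%:R, n%:R]) f (fun x => `|f x|) _ (L1_norm Lf).
- by move=> n; apply: L1_measurable; apply: L1_patch.
- move=> x; apply: cvg_near_cst; near=> n; rewrite patchE ifT// inE/= in_itv/= -ler_norml.
  by near: n; exact: nbhs_infty_ger.
- by move=> n x; rewrite patchE; case: ifP => // _; rewrite normr0.
Unshelve. all: end_near. Qed.

(** Integrability of [f] makes its symmetric truncations converge to the full integral, and [l] is
    the limit of their boundary terms. *)
Lemma intR_derivative f F l : continuous f -> L1 f ->
  (forall x : R, is_derive x (1 : R) F (f x)) ->
  (F n%:R - F (- n%:R)) @[n --> \oo] --> l -> intR f = l.
Proof.
move=> cf Lf dF Fl; apply: (cvg_unique _ (cvg_intR_trunc Lf)) => //.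
apply: cvg_trans Fl; apply: near_eq_cvg; apply: nearW => n.
by rewrite (@FTC2_intR f F)// (le_trans _ (ler0n R n))// oppr_le0.
Qed.

End Calculus.

(** * The Hartley transform *)

Section Derivatives.
Context {R : realType}.
Implicit Types (f g : R -> R) (x a b c : R).

Lemma eq_derive f x a b : is_derive x (1 : R) f a -> a = b -> is_derive x (1 : R) f b.
Proof. by move=> ? <-. Qed.

Lemma dfun_id x : is_derive x (1 : R) (fun y => y) (1 : R).
Proof. exact: is_derive_id. Qed.

Lemma dfun_cst c x : is_derive x (1 : R) (fun=> c) (0 : R).
Proof. exact: is_derive_cst. Qed.

Lemma dfun_add f g x a b : is_derive x (1 : R) f a -> is_derive x (1 : R) g b ->
  is_derive x (1 : R) (fun y => f y + g y) (a + b : R).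
Proof. by move=> df dg; exact: is_deriveD. Qed.

Lemma dfun_sub f g x a b : is_derive x (1 : R) f a -> is_derive x (1 : R) g b ->
  is_derive x (1 : R) (fun y => f y - g y) (a - b : R).
Proof. by move=> df dg; exact: is_deriveB. Qed.

Lemma dfun_opp f x a : is_derive x (1 : R) f a ->
  is_derive x (1 : R) (fun y => - f y) (- a : R).
Proof. by move=> df; exact: is_deriveN. Qed.

Lemma dfun_mul f g x a b : is_derive x (1 : R) f a -> is_derive x (1 : R) g b ->
  is_derive x (1 : R) (fun y => f y * g y) (a * g x + f x * b : R).
Proof.
move=> df dg; apply: eq_derive (is_deriveM df dg) _.
by rewrite addrC /GRing.scale/= mulrC.
Qed.

Lemma dfun_sqr f x a : is_derive x (1 : R) f a ->
  is_derive x (1 : R) (fun y => f y ^+ 2) (2 * f x * a : R).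
Proof. by move=> df; apply: eq_derive (dfun_mul df df) _; ring. Qed.

Lemma dfun_inv f x a : f x != 0 -> is_derive x (1 : R) f a ->
  is_derive x (1 : R) (fun y => (f y)^-1) (- a / f x ^+ 2 : R).
Proof.
move=> f0 df; apply: eq_derive (is_deriveV f0 df) _.
by rewrite /GRing.scale/= mulNr mulrC mulNr.
Qed.

Lemma dfun_comp f g x a b : is_derive (g x) (1 : R) f a -> is_derive x (1 : R) g b ->
  is_derive x (1 : R) (fun y => f (g y)) (a * b : R).
Proof. exact: is_derive1_comp. Qed.

Lemma dfun_cos g x b : is_derive x (1 : R) g b ->
  is_derive x (1 : R) (fun y => cos (g y)) (- sin (g x) * b : R).
Proof. by apply: dfun_comp. Qed.

Lemma dfun_sin g x b : is_derive x (1 : R) g b ->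
  is_derive x (1 : R) (fun y => sin (g y)) (cos (g x) * b : R).
Proof. by apply: dfun_comp. Qed.

Lemma dfun_exp g x b : is_derive x (1 : R) g b ->
  is_derive x (1 : R) (fun y => expR (g y)) (expR (g x) * b : R).
Proof. by apply: dfun_comp. Qed.

Lemma derive_continuous f f' : (forall x, is_derive x (1 : R) f (f' x)) -> continuous f.
Proof.
by move=> df x; apply/differentiable_continuous/derivable1_diffP; have [] := df x.
Qed.

End Derivatives.

(** * The kernel cas *)

Section Cas.
Context {R : realType}.
Implicit Types (x y : R).

Definition cas x : R := cos x + sin x.

Lemma cas_le2 x : `|cas x| <= 2.
Proof.
rewrite /cas (le_trans (ler_normD _ _))// -[leRHS]/(1 + 1).
by rewrite lerD ?cos_max ?sin_max.
Qed.

Lemma casE_mul x y : cas x * cas y = cos (x - y) + sin (x + y).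
Proof. by rewrite /cas cosD sinD cosN sinN; ring. Qed.

Lemma casD x y : cas (x + y) = cos y * cas x + sin y * cas (- x).
Proof. by rewrite /cas cosD sinD cosN sinN; ring. Qed.

Lemma dfun_cas (g : R -> R) x b : is_derive x (1 : R) g b ->
  is_derive x (1 : R) (fun y => cas (g y)) (cas (- g x) * b : R).
Proof.
move=> dg; apply: eq_derive (dfun_add (dfun_cos dg) (dfun_sin dg)) _.
by rewrite /cas cosN sinN; ring.
Qed.

Lemma continuous_cas : continuous cas.
Proof. by apply: derive_continuous => x; apply: dfun_cas; exact: dfun_id. Qed.

Lemma measurable_cas : measurable_fun setT cas.
Proof. exact: continuous_measurable continuous_cas. Qed.

End Cas.

(** The derivative is built as an existential value and [eq_derive] leaves one algebraic equation.
    Constants are tried early, so nonvanishing goals arise only for denominators that really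
    vary. *)
Ltac derive1 :=
  first [ eassumption | apply dfun_id | apply dfun_cst
        | eapply dfun_cos | eapply dfun_sin | eapply dfun_cas | eapply dfun_exp
        | eapply dfun_sqr | eapply dfun_sub | eapply dfun_add | eapply dfun_opp
        | eapply dfun_inv | eapply dfun_mul ].
Ltac derive_tac := eapply eq_derive; [repeat derive1 | cbv beta].

(** * The Hartley transform of an integrable function *)

Section Hartley.
Context {R : realType}.
Local Notation mu := (@lebesgue_measure R).
Implicit Types (f g h : R -> R) (x y c : R).

(* For a real function with Fourier transform [a + ib] this is [a - b]; it is
   real-valued and, unlike the Fourier transform, its own inverse. *)
Definition hart f x : R := intR (fun y => cas (2 * pi * (x * y)) * f y).

Lemma measurable_ker x : measurable_fun setT (fun y => cas (2 * pi * (x * y))).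
Proof.
apply: (@measurableT_comp _ _ _ _ _ _ cas); first exact: measurable_cas.
by apply: measurable_funM => //; exact: measurable_funM.
Qed.

Lemma L1_ker f x : L1 f -> L1 (fun y => cas (2 * pi * (x * y)) * f y).
Proof.
by move=> Lf; apply: (@L1_bmul _ 2) => // [|y]; [exact: measurable_ker|exact: cas_le2].
Qed.

Lemma measurable_hart_ker f x : measurable_fun setT f ->
  measurable_fun setT (fun y => cas (2 * pi * (x * y)) * f y).
Proof. by move=> mf; apply: measurable_funM => //; exact: measurable_ker. Qed.

Lemma hart_le f x : L1 f -> `|hart f x| <= 2 * intR (fun y => `|f y|).
Proof.
move=> Lf; rewrite -intRZ; last exact: L1_norm.
apply: norm_intR_le.
- by apply: measurable_hart_ker; exact: L1_measurable.
- by apply: L1Z; exact: L1_norm.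
- by move=> y; rewrite normrM ler_wpM2r// cas_le2.
Qed.

Lemma hart_continuous f : L1 f -> continuous (hart f).
Proof.
move=> Lf; apply: (@continuous_intR _ (fun x y => cas (2 * pi * (x * y)) * f y)
  (fun y => 2 * `|f y|)).
- by move=> x; by apply: measurable_hart_ker; exact: L1_measurable.
- by apply: L1Z; exact: L1_norm.
- by move=> x y; rewrite normrM ler_wpM2r// cas_le2.
- move=> y; apply: (@derive_continuous _ _
    (fun x => cas (- (2 * pi * (x * y))) * (2 * pi * y) * f y)) => x.
  by derive_tac; ring.
Qed.

Lemma hartB f g x : L1 f -> L1 g -> hart (fun y => f y - g y) x = hart f x - hart g x.
Proof.
move=> Lf Lg; rewrite /hart -intRB; [|exact: L1_ker..].
by congr intR; apply/funext => y; rewrite mulrBr.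
Qed.

Lemma hartZ c f x : L1 f -> hart (fun y => c * f y) x = c * hart f x.
Proof.
move=> Lf; rewrite /hart -intRZ; last exact: L1_ker.
by congr intR; apply/funext => y; rewrite mulrCA.
Qed.

Lemma ae_eq_hart f g : measurable_fun setT f -> measurable_fun setT g ->
  {ae mu, forall x, f x = g x} -> hart f = hart g.
Proof.
move=> mf mg fg; apply/funext => x; apply: ae_eq_intR; [exact: measurable_hart_ker..|].
by apply: aeS fg => y ->.
Qed.

Lemma hart_swap f g : L1 f -> L1 g ->
  intR (fun x => f x * hart g x) = intR (fun x => g x * hart f x).
Proof.
move=> Lf Lg.
have mk : measurable_fun setT (fun p : R * R => cas (2 * pi * (p.1 * p.2))).
  apply: (@measurableT_comp _ _ _ _ _ _ cas); first exact: measurable_cas.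
  by apply: measurable_funM => //; apply: measurable_funM.
have kM x y : `|cas (2 * pi * (x * y))| <= 2 by exact: cas_le2.
have := @intR_swap _ 2 (fun x y => cas (2 * pi * (x * y))) f g mk kM Lf Lg.
move=> E; apply: (etrans E); congr intR; apply/funext => y; congr (_ * _).
by congr intR; apply/funext => x; rewrite (mulrC x).
Qed.

End Hartley.

(** * From the complex Fourier transform to the Hartley transform on L^2 *)

Section HartleyOfFourier.
Local Open Scope complex_scope.
Context {R : realType}.
Local Notation mu := (@lebesgue_measure R).
Local Notation Re := complex.Re.
Local Notation Im := complex.Im.
Implicit Types (f g h : R -> R) (fh gh : R -> R[i]) (x y c : R) (n : nat).

Definition tr n f : R -> R := f \_ `[- n%:R, n%:R].

Definition hof fh x : R := Re (fh x) - Im (fh x).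

(** The eventual [SQ] clause gives the limit its meaning: [n2] is real-valued and sends a divergent
    integral to 0. *)
Definition is_hartley f h : Prop :=
  [/\ SQ f, SQ h, \forall n \near \oo, SQ (fun xi => h xi - hart (tr n f) xi) &
   n2 (fun xi => h xi - hart (tr n f) xi) @[n --> \oo] --> 0].

Lemma SQ_measurable f : SQ f -> measurable_fun setT f.
Proof. by case. Qed.

Lemma SQ_indic n : SQ (fun x => \1_`[- n%:R : R, n%:R] x : R).
Proof.
split; first exact: measurable_indic.
have := @integrable_indic_itv R (- n%:R) n%:R true false.
apply: (@eq_L1 R (fun x => \1_`[- n%:R : R, n%:R] x)) => x.
by rewrite indicE; case: (_ \in _); rewrite ?expr1n ?expr0n.
Qed.

Lemma trE n f x : tr n f x = \1_`[- n%:R : R, n%:R] x * f x.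
Proof. by rewrite /tr patchE indicE; case: ifP; rewrite ?mul1r ?mul0r. Qed.

Lemma L1_tr n f : SQ f -> L1 (tr n f).
Proof.
by move=> f2; apply: eq_L1 (SQM (SQ_indic n) f2) => x; rewrite trE.
Qed.

Lemma SQ_tr n f : SQ f -> SQ (tr n f).
Proof.
move=> f2; rewrite (_ : tr n f = fun x => \1_`[- n%:R : R, n%:R] x * f x); last first.
  by apply/funext => x; rewrite trE.
apply: (@SQ_bmul _ 1) => // x.
by rewrite indicE; case: (_ \in _); rewrite ?normr1 ?normr0.
Qed.

Lemma trB n f g : tr n (f - g) = fun x => tr n f x - tr n g x.
Proof. by apply/funext => x; rewrite !trE mulrBr. Qed.

Lemma trZ n c f : tr n (c *: f) = fun x => c * tr n f x.
Proof. by apply/funext => x; rewrite !trE mulrCA. Qed.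

Lemma cas_sym x : (cas x + cas (- x)) / 2 = cos x.
Proof. by rewrite /cas cosN sinN; field. Qed.

Lemma cas_asym x : (cas x - cas (- x)) / 2 = sin x.
Proof. by rewrite /cas cosN sinN; field. Qed.

(** cos and sin are the even and odd parts of cas, so the real part is the even part of the Hartley
    transform and the imaginary part is minus the odd part. *)
Lemma fourier_truncE f n xi : SQ f -> fourier_trunc f n xi =
  ((hart (tr n f) xi + hart (tr n f) (- xi)) / 2) +i*
  (- ((hart (tr n f) xi - hart (tr n f) (- xi)) / 2)).
Proof.
move=> f2; have Lf := L1_tr n f2.
rewrite /fourier_trunc /cintegral /hart; congr (_ +i* _).
- rewrite -intR_patch -intRD; [|exact: L1_ker..].
  rewrite [RHS]mulrC -intRZ; last by apply: L1D; exact: L1_ker.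
  (* Outside the window every patch takes the default [point], which is 0 in [R]. *)
  congr intR; apply/funext => x; rewrite !patchE /tr patchE; case: ifP => _; last by rewrite -[point]/(0 : R); ring.
  have -> : 2 * pi * (- xi * x) = - (2 * pi * xi * x) by ring.
  by rewrite /expi/= mulr0 subr0 cosN -cas_sym (mulrA (2 * pi)); field.
- rewrite -intR_patch -intRB; [|exact: L1_ker..].
  rewrite -mulrN [RHS]mulrC -intRZ; last by apply: L1B; exact: L1_ker.
  congr intR; apply/funext => x; rewrite !patchE /tr patchE; case: ifP => _; last by rewrite -[point]/(0 : R); ring.
  have -> : 2 * pi * (- xi * x) = - (2 * pi * xi * x) by ring.
  by rewrite /expi/= mulr0 add0r sinN -cas_asym (mulrA (2 * pi)); field.
Qed.

Lemma normc2_ge0 (z : R[i]) : 0 <= normc2 z.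
Proof. by rewrite addr_ge0 ?sqr_ge0. Qed.

Lemma ReB (z w : R[i]) : Re (z - w) = Re z - Re w.
Proof. by case: z; case: w. Qed.

Lemma ImB (z w : R[i]) : Im (z - w) = Im z - Im w.
Proof. by case: z; case: w. Qed.

Lemma ReZ c (z : R[i]) : Re (c%:C * z) = c * Re z.
Proof. by case: z => a b /=; rewrite mul0r subr0. Qed.

Lemma ImZ c (z : R[i]) : Im (c%:C * z) = c * Im z.
Proof. by case: z => a b /=; rewrite mul0r addr0. Qed.

Lemma hof_sqr_le fh x : hof fh x ^+ 2 <= 2 * normc2 (fh x).
Proof.
rewrite /hof /normc2 -subr_ge0 (_ : _ - _ = (Re (fh x) + Im (fh x)) ^+ 2) ?sqr_ge0//.
by ring.
Qed.

Lemma normc2_sub_le (z w : R[i]) : normc2 (z - w) <= 2 * (normc2 z + normc2 w).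
Proof.
rewrite /normc2 ReB ImB -subr_ge0.
rewrite (_ : _ - _ = (Re z + Re w) ^+ 2 + (Im z + Im w) ^+ 2) ?addr_ge0 ?sqr_ge0//.
by ring.
Qed.

Lemma normc2Z c (z : R[i]) : normc2 (c%:C * z) = c ^+ 2 * normc2 z.
Proof. by rewrite /normc2 ReZ ImZ; ring. Qed.

Lemma L2C_hof fh : L2C fh -> SQ (hof fh).
Proof. by move=> [a b]; apply: SQB; exact: L2_SQ. Qed.

Lemma measurable_normc2 fh : measurable_fun setT (fun x => Re (fh x)) ->
  measurable_fun setT (fun x => Im (fh x)) ->
  measurable_fun setT (fun x => normc2 (fh x)).
Proof.
by move=> mr mi; apply: measurable_funD; apply: measurable_funX.
Qed.

Lemma measurable_normc2_trunc f fh n : SQ f -> L2C fh ->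
  measurable_fun setT (fun xi => normc2 (fh xi - fourier_trunc f n xi)).
Proof.
move=> f2 [/L2_SQ[mr _] /L2_SQ[mi _]].
have mh : measurable_fun setT (hart (tr n f)).
  by apply: continuous_measurable; apply: hart_continuous; exact: L1_tr.
have mh' : measurable_fun setT (fun xi : R => hart (tr n f) (- xi)).
  exact: measurableT_comp.
apply: measurable_normc2.
- under eq_fun do rewrite ReB fourier_truncE//=.
  apply: measurable_funB => //; apply: measurable_funM => //.
  exact: measurable_funD.
- under eq_fun do rewrite ImB fourier_truncE//= opprK.
  apply: measurable_funD => //; apply: measurable_funM => //.
  exact: measurable_funB.
Qed.

(** By linearity the Hartley truncation error is [hof] of the Fourier one, hence its square integral
    is at most twice as large. *)
Lemma fourier_hartley f fh : is_fourier f fh -> is_hartley f (hof fh).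
Proof.
move=> [/L2_SQ f2 fh2 cv]; have h2 := L2C_hof fh2.
pose D n xi := hof fh xi - hart (tr n f) xi.
have mD n : measurable_fun setT (D n).
  apply: measurable_funB; first exact: SQ_measurable.
  by apply: continuous_measurable; apply: hart_continuous; exact: L1_tr.
have DE n xi : D n xi = hof (fun xi => fh xi - fourier_trunc f n xi) xi.
  by rewrite /D /hof ReB ImB fourier_truncE//=; field.
have D_le n : (\int[mu]_xi (D n xi ^+ 2)%:E <=
    2%:E * \int[mu]_xi (normc2 (fh xi - fourier_trunc f n xi))%:E)%E.
  have mN := measurable_normc2_trunc n f2 fh2.
  rewrite -ge0_integralZl//; last 2 first.
  - exact/measurable_EFinP.
  - by move=> x _; rewrite lee_fin normc2_ge0.
  apply: ge0_le_integral => //.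
  - by move=> x _; rewrite lee_fin sqr_ge0.
  - by apply/measurable_EFinP; apply: measurable_funX; exact: mD.
  - by apply/measurable_EFinP; apply: measurable_funM => //; exact: mN.
  - by move=> x _; rewrite lee_fin DE hof_sqr_le.
have cv2 : (2%:E * \int[mu]_xi (normc2 (fh xi - fourier_trunc f n xi))%:E)%E
    @[n --> \oo] --> 0%E.
  by rewrite -(mule0 2%:E); apply: cvgeZl.
have cvD : (\int[mu]_xi (D n xi ^+ 2)%:E)%E @[n --> \oo] --> 0%E.
  apply: (squeeze_cvge _ (cvg_cst _) cv2); apply: nearW => n.
  by rewrite D_le integral_ge0// => x _; rewrite lee_fin sqr_ge0.
(* Convergence to 0 in the extended reals makes the integrals finite from some [n] on. *)
have nD : \forall n \near \oo, SQ (D n).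
  have : \forall n \near \oo, (\int[mu]_xi (D n xi ^+ 2)%:E < +oo)%E.
    by have /fine_cvgP[+ _] := cvD; apply: filterS => n /fin_numPlt/andP[].
  apply: filterS => n Dn; split=> //; apply: L1_ge0_lty => //.
    exact: measurable_funX.
  by move=> x; exact: sqr_ge0.
split => //.
exact: (fine_cvg cvD).
Qed.

Lemma is_fourierB f g fh gh : is_fourier f fh -> is_fourier g gh ->
  is_fourier (f - g) (fun x => fh x - gh x).
Proof.
move=> [/[dup] /L2_SQ f2 f2' fh2 cf] [/[dup] /L2_SQ g2 g2' gh2 cg].
have fg2 : SQ (f - g) by exact: SQB.
split; first exact: SQ_L2.
  case: fh2 gh2 => [a b] [c d].
  split; under eq_fun do rewrite ?ReB ?ImB; apply: SQ_L2; apply: SQB; exact: L2_SQ.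
have mf n := measurable_normc2_trunc n f2 fh2.
have mg n := measurable_normc2_trunc n g2 gh2.
pose u n := (2%:E * (\int[mu]_xi (normc2 (fh xi - fourier_trunc f n xi))%:E +
   \int[mu]_xi (normc2 (gh xi - fourier_trunc g n xi))%:E))%E.
have cu : u n @[n --> \oo] --> 0%E.
  rewrite -(mule0 2%:E) -[X in (_ * X)%E](adde0 0%E); apply: cvgeZl => //.
  by apply: (cvgeD _ cf cg); rewrite /adde_def.
apply: (squeeze_cvge _ (cvg_cst _) cu); apply: nearW => n.
rewrite integral_ge0/=; last by move=> x _; rewrite lee_fin normc2_ge0.
rewrite /u -ge0_integralD//; last 4 first.
- by move=> x _; rewrite lee_fin normc2_ge0.
- by apply/measurable_EFinP; exact: mf.
- by move=> x _; rewrite lee_fin normc2_ge0.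
- by apply/measurable_EFinP; exact: mg.
rewrite -ge0_integralZl//; last 2 first.
- by apply/measurable_EFinP; apply: measurable_funD; [exact: mf|exact: mg].
- by move=> x _; rewrite -EFinD lee_fin addr_ge0 ?normc2_ge0.
have E xi : fh xi - gh xi - fourier_trunc (f - g) n xi =
   (fh xi - fourier_trunc f n xi) - (gh xi - fourier_trunc g n xi).
  suff -> : fourier_trunc (f - g) n xi = fourier_trunc f n xi - fourier_trunc g n xi.
    by ring.
  rewrite !fourier_truncE// trB !hartB; [|exact: L1_tr..].
  by apply/eqP; rewrite eq_complex/=; apply/andP; split; apply/eqP; field.
apply: ge0_le_integral => //.
- by move=> x _; rewrite lee_fin normc2_ge0.
- apply/measurable_EFinP; apply: measurable_normc2_trunc => //.
  case: fh2 gh2 => [a b] [c d].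
  split; under eq_fun do rewrite ?ReB ?ImB; apply: SQ_L2; apply: SQB; exact: L2_SQ.
- apply/measurable_EFinP; apply: measurable_funM => //.
  by apply: measurable_funD; [exact: mf|exact: mg].
- by move=> x _; rewrite E -EFinD -EFinM lee_fin normc2_sub_le.
Qed.

Lemma is_fourierZ c f fh : is_fourier f fh ->
  is_fourier (c *: f) (fun x => c%:C * fh x).
Proof.
move=> [/[dup] /L2_SQ f2 f2' fh2 cf].
have cf2 : SQ (c *: f) by exact: SQZ.
split; first exact: SQ_L2.
  case: fh2 => [a b].
  split; under eq_fun do rewrite ?ReZ ?ImZ; apply: SQ_L2; apply: SQZ; exact: L2_SQ.
have mf n := measurable_normc2_trunc n f2 fh2.
rewrite (_ : (fun _ => _) = fun n => ((c ^+ 2)%:E *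
    \int[mu]_xi (normc2 (fh xi - fourier_trunc f n xi))%:E)%E).
  by rewrite -(mule0 (c ^+ 2)%:E); apply: cvgeZl.
apply/funext => n; rewrite -ge0_integralZl ?lee_fin ?sqr_ge0//; last 2 first.
- by apply/measurable_EFinP; exact: mf.
- by move=> x _; rewrite lee_fin normc2_ge0.
apply: eq_integral => xi _; rewrite -EFinM -normc2Z; congr (normc2 _)%:E.
rewrite mulrBr; congr (_ - _); rewrite !fourier_truncE// trZ !hartZ; [|exact: L1_tr..].
by apply/eqP; rewrite eq_complex/=; apply/andP; split; apply/eqP; field.
Qed.

Lemma fourierP f fh : is_fourier f fh -> is_fourier f (fourier f).
Proof. by move=> ffh; apply: (@xgetI _ _ _ fh). Qed.

Lemma n2_sub_le f g h : SQ (fun x => f x - h x) -> SQ (fun x => g x - h x) ->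
  n2 (fun x => f x - g x) <=
  2 * (n2 (fun x => f x - h x) + n2 (fun x => g x - h x)).
Proof.
move=> fh gh; have fg : SQ (fun x => f x - g x).
  have := SQB fh gh; congr SQ; apply/funext => x; ring.
rewrite /n2 -intRD; [|by case: fh|by case: gh].
rewrite -intRZ; last by apply: L1D; [case: fh|case: gh].
apply: le_intR; first by case: fg.
  by apply: L1Z; apply: L1D; [case: fh|case: gh].
move=> x; rewrite -subr_ge0.
rewrite (_ : _ - _ = (f x - h x + (g x - h x)) ^+ 2) ?sqr_ge0//; by ring.
Qed.

End HartleyOfFourier.

(** * Uniqueness, Parseval's identity and Gaussian integrals *)

Section HartleyTransform.
Context {R : realType}.
Local Notation mu := (@lebesgue_measure R).
Implicit Types (f g h : R -> R) (x y c : R) (n : nat).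

Lemma n2_eq0_ae f : SQ f -> n2 f = 0 -> {ae mu, forall x, f x = 0}.
Proof.
move=> [mf Lf] f0; have := intR_eq0_ae Lf (fun x => sqr_ge0 _) f0.
by apply: aeS => x /eqP; rewrite sqrf_eq0 => /eqP.
Qed.

Lemma le_cvg0 (T : Type) (F : set_system T) {FF : ProperFilter F} (a : R) (v : T -> R) :
  0 <= a -> (\forall i \near F, a <= v i) -> v i @[i --> F] --> 0 -> a = 0.
Proof.
move=> a0 av v0; apply: (@cvg_unique _ (@norm_hausdorff _ R) (a @[_ --> F])).
  exact: cvg_cst.
by apply: cvg0_le v0; apply: filterS av => i; rewrite ger0_norm.
Qed.

Lemma hartley_unique f h1 h2 : is_hartley f h1 -> is_hartley f h2 ->
  {ae mu, forall x, h1 x = h2 x}.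
Proof.
move=> [_ h12 n1 c1] [_ h22 m1 d1].
have E0 : n2 (fun x => h1 x - h2 x) = 0.
  have cv : 2 * (n2 (fun x => h1 x - hart (tr n f) x) +
      n2 (fun x => h2 x - hart (tr n f) x)) @[n --> \oo] --> 0.
    have -> : (0 : R) = 2 * (0 + 0) by rewrite addr0 mulr0.
    by apply: cvgM; [exact: cvg_cst|exact: cvgD].
  apply: (le_cvg0 (n2_ge0 _) _ cv).
  by apply: filterS2 n1 m1 => n; exact: n2_sub_le.
have := n2_eq0_ae (SQB h12 h22) E0.
by apply: aeS => x /eqP; rewrite subr_eq0 => /eqP.
Qed.

Lemma ae_eq_n2 f g : measurable_fun setT f -> measurable_fun setT g ->
  {ae mu, forall x, f x = g x} -> n2 f = n2 g.
Proof.
move=> mf mg fg; apply: ae_eq_intR; [exact: measurable_funX..|].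
by apply: aeS fg => x ->.
Qed.

Lemma measurable_hart f : L1 f -> measurable_fun setT (hart f).
Proof. by move=> Lf; apply: continuous_measurable; exact: hart_continuous. Qed.

(* Parseval, by Fubini on the truncations *)
Lemma hartley_pairing f h m : is_hartley f h -> L1 m -> SQ m ->
  intR (fun x => tr n f x * hart m x) @[n --> \oo] --> intR (fun x => h x * m x).
Proof.
move=> [f2 h2 nh ch] Lm m2.
have E n : intR (fun x => tr n f x * hart m x) = intR (fun x => hart (tr n f) x * m x).
  rewrite hart_swap//; last exact: L1_tr.
  by congr intR; apply/funext => x; rewrite mulrC.
under eq_fun do rewrite E.
apply: cvg_pairing => //.
  apply: filterS nh => n nh; have := SQB h2 nh.
  by congr SQ; apply/funext => x; ring.
rewrite (_ : (fun n => _) = fun n => n2 (fun xi => h xi - hart (tr n f) xi))//.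
by apply/funext => n; congr intR; apply/funext => x; ring.
Qed.

Lemma normal_pdf_expE m s x : s != 0 ->
  normal_pdf m s x = normal_peak s * expR (- ((x - m) ^+ 2 / (2 * s ^+ 2))).
Proof.
move=> s0; rewrite normal_pdfE//; congr (_ * expR _).
by rewrite -[X in _ / X]mulr_natl mulNr.
Qed.

Lemma L1_gauss c : 0 < c -> L1 (fun x : R => expR (- (c * x ^+ 2))).
Proof.
move=> c0; pose s := Num.sqrt (2 * c)^-1.
have s0 : s != 0 by rewrite gt_eqF// sqrtr_gt0 invr_gt0 mulr_gt0.
have := integrable_normal_pdf (0 : R) s.
move=> /(L1Z (normal_peak s)^-1).
apply: eq_L1 => x.
rewrite normal_pdf_expE// mulKf ?gt_eqF ?normal_peak_gt0//.
congr expR; rewrite subr0 sqr_sqrtr ?invr_ge0 ?mulr_ge0// ?ltW//.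
by field; rewrite gt_eqF.
Qed.

Lemma intR_gauss m s : 0 < s -> intR (fun x : R => expR (- ((x - m) ^+ 2 / (2 * s ^+ 2)))) =
  Num.sqrt (2 * pi * s ^+ 2).
Proof.
move=> s0; have s1 : s != 0 by rewrite gt_eqF.
have p0 := normal_peak_gt0 s1.
have := integral_normal_pdf m s; have := integrable_normal_pdf m s.
move=> Ls I1.
have {}I1 : intR (normal_pdf m s) = 1 by rewrite /intR /Rintegral I1.
rewrite (_ : (fun x => _) = fun x => (normal_peak s)^-1 * normal_pdf m s x).
  rewrite intRZ// I1 mulr1 /normal_peak invrK; congr Num.sqrt.
  by rewrite -mulr_natl; ring.
by apply/funext => x; rewrite normal_pdf_expE// mulKf ?gt_eqF.
Qed.

Lemma L1_gauss_x c : 0 < c -> L1 (fun x : R => x * expR (- (c * x ^+ 2))).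
Proof.
move=> c0; apply: (@L1_le _ (fun x => (1 + 2 / c) * expR (- ((c / 2) * x ^+ 2)))).
- apply: measurable_funM => //; apply: L1_measurable; exact: L1_gauss.
- by apply: L1Z; apply: L1_gauss; rewrite divr_gt0.
- move=> x; rewrite normrM (ger0_norm (expR_ge0 _)).
  have -> : - (c * x ^+ 2) = - (c / 2 * x ^+ 2) + - (c / 2 * x ^+ 2) by field.
  rewrite expRD mulrA ler_wpM2r ?expR_ge0// expRN.
  rewrite ler_pdivrMr ?expR_gt0//.
  have := expR_ge1Dx (c / 2 * x ^+ 2); set E := expR _ => E1.
  have c2 : 0 < 2 / c by rewrite divr_gt0.
  (* The factor 1 + 2 / c is chosen so that this product contains 1 + x^2, which dominates |x|. *)
  apply: (@le_trans _ _ ((1 + 2 / c) * (1 + c / 2 * x ^+ 2))); last first.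
    by rewrite ler_wpM2l// addr_ge0// ltW.
  rewrite (_ : _ * _ = 1 + 2 / c + (c / 2) * x ^+ 2 + x ^+ 2); last first.
    by field; rewrite gt_eqF.
  have : `|x| <= 1 + x ^+ 2.
    rewrite -(real_normK (num_real x)); have := normr_ge0 x; set z := `|x|; nra.
  have : 0 <= c / 2 * x ^+ 2 by rewrite mulr_ge0 ?sqr_ge0// ltW// divr_gt0.
  by lra.
Qed.

Lemma cvg_gauss_n c : 0 < c -> expR (- (c * n%:R ^+ 2)) @[n --> \oo] --> 0.
Proof.
move=> c0; apply: (@cvg0_le _ _ _ _ _ (fun n => (1 + c^-1) * n.+1%:R^-1)).
  apply: nearW => n; rewrite ger0_norm ?expR_ge0// expRN.
  have c1 : 0 < c^-1 by rewrite invr_gt0.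
  have n0 : 0 <= n%:R :> R by [].
  have cn : 0 <= c * n%:R ^+ 2 by rewrite mulr_ge0 ?sqr_ge0// ltW.
  rewrite ler_pdivlMr ?ltr0n// mulrC ler_pdivrMr ?expR_gt0//.
  apply: (@le_trans _ _ ((1 + c^-1) * (1 + c * n%:R ^+ 2))); last first.
    by rewrite ler_wpM2l ?expR_ge1Dx// addr_ge0// ltW.
  rewrite (_ : (1 + c^-1) * _ = 1 + c * n%:R ^+ 2 + c^-1 + n%:R ^+ 2); last first.
    by field; rewrite gt_eqF.
  have : n%:R <= n%:R ^+ 2 :> R by rewrite -natrX ler_nat -mulnn; case: (n) => // k; rewrite leq_pmulr.
  by rewrite -natr1; lra.
rewrite -(mulr0 (1 + c^-1)); apply: cvgM; first exact: cvg_cst.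
exact: cvg_harmonic.
Qed.

(** Differentiating under the integral and integrating by parts gives G' = - k / (2 c) G for the
    left side [G], so exp (k^2 / (4 c)) G is constant in k. *)
Lemma cos_gauss c k : 0 < c ->
  intR (fun x : R => cos (k * x) * expR (- (c * x ^+ 2))) =
  expR (- (k ^+ 2 / (4 * c))) * intR (fun x : R => expR (- (c * x ^+ 2))).
Proof.
move=> c0.
pose g (x : R) := expR (- (c * x ^+ 2)).
pose G k := intR (fun x : R => cos (k * x) * g x).
have Lg : L1 g by exact: L1_gauss.
have Lxg : L1 (fun x => x * g x) by exact: L1_gauss_x.
have mcos k' : measurable_fun setT (fun x : R => cos (k' * x)).
  apply: continuous_measurable; apply: derive_continuous => x; derive_tac; reflexivity.
have msin k' : measurable_fun setT (fun x : R => sin (k' * x)).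
  apply: continuous_measurable; apply: derive_continuous => x; derive_tac; reflexivity.
have LG k' : L1 (fun x => cos (k' * x) * g x).
  by apply: (@L1_bmul _ 1) => // x; exact: cos_max.
have LS k' : L1 (fun x => sin (k' * x) * (x * g x)).
  by apply: (@L1_bmul _ 1) => // x; exact: sin_max.
have dG k' : is_derive k' (1 : R) G (- intR (fun x => sin (k' * x) * (x * g x))).
  rewrite -intRN//.
  apply: (@is_derive_intR _ (fun k x => cos (k * x) * g x)
    (fun k x => - (sin (k * x) * (x * g x))) (k' - 1) (k' + 1) _ (fun x => `|x * g x|)).
  - by rewrite ltrBlDr ltrDl ltr01.
  - by move=> x _; exact: LG.
  - by move=> x y _; derive_tac; ring.
  - exact: L1_norm.
  - by move=> x y _; rewrite normrN normrM ler_piMl// sin_max.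
have SE k' : intR (fun x => sin (k' * x) * (x * g x)) = k' / (2 * c) * G k'.
  have L : L1 (fun x => k' / (2 * c) * (cos (k' * x) * g x) - sin (k' * x) * (x * g x)).
    by apply: L1B => //; exact: L1Z.
  have : intR (fun x => k' / (2 * c) * (cos (k' * x) * g x) - sin (k' * x) * (x * g x)) = 0.
    have dF (x : R) : is_derive x (1 : R) (fun x => (2 * c)^-1 * (sin (k' * x) * g x))
       (k' / (2 * c) * (cos (k' * x) * g x) - sin (k' * x) * (x * g x)).
      by rewrite /g; derive_tac; field; rewrite gt_eqF.
    apply: (intR_derivative _ L dF).
      by apply: derive_continuous => x; rewrite /g; derive_tac; reflexivity.
    apply: (@cvg0_le _ _ _ _ _ (fun n => (c^-1) * g n%:R)).
      apply: nearW => n.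
      have -> : (2 * c)^-1 * (sin (k' * n%:R) * g n%:R) -
        (2 * c)^-1 * (sin (k' * - n%:R) * g (- n%:R)) = c^-1 * (sin (k' * n%:R) * g n%:R).
        by rewrite mulrN sinN /g sqrrN; field; rewrite gt_eqF.
      rewrite normrM (gtr0_norm) ?invr_gt0// ler_wpM2l ?invr_ge0 ?(ltW c0)//.
      have gn : 0 <= g n%:R by exact: expR_ge0.
      by rewrite normrM (ger0_norm gn) ler_piMl// sin_max.
    rewrite -(mulr0 c^-1); apply: cvgM; first exact: cvg_cst.
    exact: cvg_gauss_n.
  rewrite intRB//; last exact: L1Z.
  by rewrite intRZ// => /eqP; rewrite subr_eq0 => /eqP.
pose Q (k : R) := expR (k ^+ 2 / (4 * c)) * G k.
have dQ (k' : R) : is_derive k' (1 : R) Q 0.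
  have := dG k'; rewrite SE => dGk; rewrite /Q.
  by derive_tac; field; rewrite gt_eqF.
have := is_derive_0_is_cst k 0 dQ; rewrite /Q.
rewrite expr0n/= mul0r expR0 mul1r => E.
have G0 : G 0 = intR g.
  by rewrite /G; congr intR; apply/funext => x; rewrite mul0r cos0 mul1r.
by rewrite -/g -G0 -E mulrA -expRD addNr expR0 mul1r.
Qed.

End HartleyTransform.

(** * Gaussian approximate identity and the inversion formula *)

Section Inversion.
Context {R : realType}.
Local Notation mu := (@lebesgue_measure R).
Implicit Types (f g h : R -> R) (x y c : R) (n : nat).

Lemma intR_odd f : L1 f -> (forall x, f (- x) = - f x) -> intR f = 0.
Proof.
move=> Lf fo; have [_] := intR_opp Lf.
rewrite (_ : (fun x => f (- x)) = fun x => - f x); last exact/funext.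
by rewrite intRN// => E; apply/eqP; move: E; lra.
Qed.

Lemma SQ_gauss c : 0 < c -> SQ (fun x : R => expR (- (c * x ^+ 2))).
Proof.
move=> c0; split; first exact: L1_measurable (L1_gauss c0).
have c20 : 0 < 2 * c by rewrite mulr_gt0.
by apply: eq_L1 (L1_gauss c20) => x; rewrite [RHS]expr2 -expRD; congr expR; ring.
Qed.

(** Preimage of the normal density of mean [a] and deviation [s] under the Hartley transform; it
    tends to the kernel cas (2 pi a x) as [s] tends to 0. *)
Definition gmod s a x : R := cas (2 * pi * (a * x)) * expR (- (2 * pi ^+ 2 * s ^+ 2 * x ^+ 2)).

Lemma gmod_gt0 s : 0 < s -> 0 < 2 * pi ^+ 2 * s ^+ 2 :> R.
Proof. by move=> s0; rewrite !mulr_gt0 ?exprn_gt0 ?pi_gt0. Qed.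

Lemma L1_gmod s a : 0 < s -> L1 (gmod s a).
Proof.
move=> s0; apply: (@L1_bmul _ 2); [exact: measurable_ker|by move=> x; exact: cas_le2|].
by apply: L1_gauss; exact: gmod_gt0.
Qed.

Lemma SQ_gmod s a : 0 < s -> SQ (gmod s a).
Proof.
move=> s0; apply: (@SQ_bmul _ 2); [exact: measurable_ker|by move=> x; exact: cas_le2|].
by apply: SQ_gauss; exact: gmod_gt0.
Qed.

Lemma gauss_mass s : 0 < s -> intR (fun x : R => expR (- (2 * pi ^+ 2 * s ^+ 2 * x ^+ 2))) =
  normal_peak s.
Proof.
move=> s0; have p0 := pi_gt0 R.
have t0 : 0 < (2 * pi * s)^-1 :> R by rewrite invr_gt0 !mulr_gt0.
have := intR_gauss 0 t0.
rewrite (_ : (fun x => _) = fun x : R => expR (- (2 * pi ^+ 2 * s ^+ 2 * x ^+ 2))); last first.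
  by apply/funext => x; congr expR; move: (@pi R) p0 => P P0; field; rewrite !gt_eqF.
move=> ->; rewrite /normal_peak -sqrtrV; last first.
  by rewrite mulrn_wge0// mulr_ge0 ?sqr_ge0 ?(ltW p0)//.
by congr Num.sqrt; rewrite -mulr_natl; move: (@pi R) p0 => P P0; field; rewrite !gt_eqF.
Qed.

(** In cas A cas B = cos (A - B) + sin (A + B) the sine term is odd in the integration variable and
    drops out, leaving a Gaussian cosine transform at frequency x - a. *)
Lemma hart_gmod s a : 0 < s -> hart (gmod s a) = normal_pdf a s.
Proof.
move=> s0; have p0 := pi_gt0 R; apply/funext => x; have c0 := gmod_gt0 s0.
pose e (y : R) := expR (- (2 * pi ^+ 2 * s ^+ 2 * y ^+ 2)).
have Le : L1 e by exact: L1_gauss.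
pose u (y : R) := cos (2 * pi * (x - a) * y) * e y.
pose v (y : R) := sin (2 * pi * (x + a) * y) * e y.
have Lu : L1 u.
  apply: (@L1_bmul _ 1) => [|y|//]; last exact: cos_max.
  by apply: continuous_measurable; apply: derive_continuous => y; derive_tac; reflexivity.
have Lv : L1 v.
  apply: (@L1_bmul _ 1) => [|y|//]; last exact: sin_max.
  by apply: continuous_measurable; apply: derive_continuous => y; derive_tac; reflexivity.
have -> : hart (gmod s a) x = intR (fun y => u y + v y).
  congr intR; apply/funext => y; rewrite /gmod mulrA casE_mul /u /v mulrDl.
  by congr (cos _ * _ + sin _ * _); ring.
rewrite intRD// (intR_odd Lv); last first.
  by move=> y; rewrite /v /e mulrN sinN sqrrN mulNr.
rewrite addr0 /u /e cos_gauss// gauss_mass// normal_pdf_expE ?gt_eqF// mulrC.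
by congr (_ * expR _); move: (@pi R) p0 => P P0; field; rewrite !gt_eqF.
Qed.

Lemma L1_normal_pdf a s : L1 (normal_pdf a s : R -> R).
Proof. exact: integrable_normal_pdf. Qed.

Lemma SQ_normal_pdf a s : s != 0 -> SQ (normal_pdf a s : R -> R).
Proof.
move=> s0; split; first exact: measurable_normal_pdf.
have : L1 (fun x => normal_pdf a s x * normal_pdf a s x).
  apply: (@L1_bmul _ (normal_peak s)) => [|x|]; first exact: measurable_normal_pdf.
    by rewrite ger0_norm ?normal_pdf_ge0// normal_pdf_ub.
  exact: L1_normal_pdf.
by apply: eq_L1.
Qed.

Lemma intR_normal_pdf a s : intR (normal_pdf a s : R -> R) = 1.
Proof. by rewrite /intR /Rintegral integral_normal_pdf. Qed.

(** Away from [a] the density is O(s) times a fixed Gaussian. That Gaussian is kept because [f] is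
    only square integrable when it is paired with the density. The exponent is split as d^2 / 2 + y,
    and exp (- y) <= 1 / y pays for the factor 1 / s of the peak. *)
Lemma normal_pdf_tail a s e x : 0 < s -> s ^+ 2 <= 2^-1 -> 0 < e -> e <= `|x - a| ->
  normal_pdf a s x <= (4 / e ^+ 2) * s * expR (- ((x - a) ^+ 2 / 2)).
Proof.
move=> s0 s1 e0 ex; rewrite normal_pdf_expE ?gt_eqF//.
have p1 : normal_peak s <= s^-1.
  rewrite /normal_peak lef_pV2 ?posrE ?sqrtr_gt0 ?mulrn_wgt0 ?mulr_gt0 ?exprn_gt0 ?pi_gt0//.
  rewrite -[leLHS](ger0_norm (ltW s0)) -sqrtr_sqr ler_wsqrtr//.
  rewrite -mulr_natl; have := @pi_ge2 R; have : 0 < s ^+ 2 by rewrite exprn_gt0.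
  by nra.
pose d := x - a; pose y := (d ^+ 2 / 2) * (s ^- 2 - 1).
have d2 : e ^+ 2 <= d ^+ 2 by rewrite -(real_normK (num_real d)) ler_sqr ?nnegrE// ltW.
have e2 : 0 < e ^+ 2 by rewrite exprn_gt0.
have s2 : 0 < s ^+ 2 by rewrite exprn_gt0.
have yE : e ^+ 2 / (4 * s ^+ 2) <= y.
  rewrite /y (_ : d ^+ 2 / 2 * _ = (d ^+ 2 * (2 * (1 - s ^+ 2))) / (4 * s ^+ 2)).
    rewrite ler_pM2r ?invr_gt0 ?mulr_gt0//.
    apply: (le_trans d2); rewrite ler_peMr ?sqr_ge0//; lra.
  by field; rewrite gt_eqF.
have -> : - (d ^+ 2 / (2 * s ^+ 2)) = - (d ^+ 2 / 2) + - y.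
  by rewrite /y; field; rewrite gt_eqF.
rewrite expRD mulrA mulrAC ler_wpM2r ?expR_ge0//.
have y0 : 0 < y by apply: lt_le_trans yE; rewrite divr_gt0 ?mulr_gt0.
have ey : expR (- y) <= 4 * s ^+ 2 / e ^+ 2.
  rewrite expRN; apply: (@le_trans _ _ (e ^+ 2 / (4 * s ^+ 2))^-1).
    rewrite lef_pV2 ?posrE ?expR_gt0 ?divr_gt0 ?mulr_gt0//.
    by apply: (le_trans yE); apply: le_trans (expR_ge1Dx y); rewrite lerDr.
  by rewrite invf_div.
apply: (@le_trans _ _ (s^-1 * (4 * s ^+ 2 / e ^+ 2))).
  by apply: ler_pM; [exact: normal_peak_ge0|exact: expR_ge0|by []|by []].
by rewrite le_eqVlt; apply/orP; left; apply/eqP; field; rewrite !gt_eqF.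
Qed.

Lemma approx_identity f a : SQ f -> {for a, continuous f} ->
  intR (fun x => f x * normal_pdf a n.+1%:R^-1 x) @[n --> \oo] --> f a.
Proof.
move=> f2 ca; have mf := SQ_measurable f2.
pose w x := expR (- ((x - a) ^+ 2 / 2)).
have [Lw w2] : L1 w /\ SQ w.
  have h0 : (0 : R) < 2^-1 by [].
  have E x : expR (- (2^-1 * (x + - a) ^+ 2)) = w x by rewrite /w mulrC.
  split.
    by have [L _] := intR_shift (- a) (L1_gauss h0); apply: eq_L1 L.
  have [mg Lg] := SQ_gauss h0; split.
    by apply: continuous_measurable; apply: derive_continuous => x; rewrite /w; derive_tac; reflexivity.
  by have [L _] := intR_shift (- a) Lg; apply: eq_L1 L => x; rewrite E.
(* Integrable majorant of |f a - f x| against the tail, up to a factor of order [s]. *)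
pose q x := (`|f x| + `|f a|) * w x.
have Lq : L1 q.
  have Lfw : L1 (fun x => `|f x * w x|) by apply: L1_norm; exact: SQM.
  have := L1D Lfw (L1Z `|f a| Lw); apply: eq_L1 => x.
  by rewrite /q mulrDl normrM (ger0_norm (expR_ge0 _)).
apply/cvgrPdist_le => e e0.
have e20 : 0 < e / 2 by rewrite divr_gt0.
have := ca; move/cvgrPdist_le => /(_ _ e20) [r /= r0 rP].
pose K := 4 / r ^+ 2 * intR q.
have K0 : 0 <= K.
  rewrite mulr_ge0 ?divr_ge0 ?sqr_ge0//; apply: intR_ge0 => x.
  by rewrite mulr_ge0 ?expR_ge0// addr_ge0.
have cs : K * n.+1%:R^-1 @[n --> \oo] --> (0 : R).
  by rewrite -(mulr0 K); apply: cvgM; [exact: cvg_cst|exact: cvg_harmonic].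
near=> n.
pose s : R := n.+1%:R^-1.
have s0 : 0 < s by rewrite invr_gt0 ltr0n.
have s1 : s ^+ 2 <= 2^-1.
  rewrite /s exprVn lef_pV2 ?posrE ?exprn_gt0 ?ltr0n// -natrX ler_nat.
  have : (1 <= n)%N by near: n; exact: nbhs_infty_ge.
  by case: (n) => // k _; rewrite -mulnn.
have Lp := L1_normal_pdf a s.
have Lfp : L1 (fun x => f x * normal_pdf a s x).
  by apply: SQM => //; apply: SQ_normal_pdf; rewrite gt_eqF.
have -> : f a = intR (fun x => f a * normal_pdf a s x).
  by rewrite intRZ// intR_normal_pdf mulr1.
rewrite -intRB//; last exact: L1Z.
apply: (@le_trans _ _ (intR (fun x => e / 2 * normal_pdf a s x + 4 / r ^+ 2 * s * q x))).
  apply: norm_intR_le.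
  - by apply: L1_measurable; apply: L1B => //; exact: L1Z.
  - by apply: L1D; exact: L1Z.
  move=> x; rewrite -mulrBl normrM (ger0_norm (normal_pdf_ge0 _ _ _)).
  have [xr|xr] := ltP `|x - a| r.
    have t1 : `|f a - f x| * normal_pdf a s x <= e / 2 * normal_pdf a s x.
      by rewrite ler_wpM2r ?normal_pdf_ge0//; apply: rP; rewrite /= distrC.
    apply: (le_trans t1); rewrite lerDl; apply: mulr_ge0.
      by apply: mulr_ge0; [rewrite divr_ge0 ?sqr_ge0|exact: ltW].
    by rewrite mulr_ge0 ?expR_ge0 ?addr_ge0.
  have t1 : `|f a - f x| * normal_pdf a s x <= (`|f x| + `|f a|) * (4 / r ^+ 2 * s * w x).
    apply: ler_pM => //; first exact: normal_pdf_ge0.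
      by rewrite [leRHS]addrC ler_normB.
    exact: normal_pdf_tail.
  apply: (le_trans t1).
  have -> : 4 / r ^+ 2 * s * q x = (`|f x| + `|f a|) * (4 / r ^+ 2 * s * w x) by exact: mulrCA.
  by rewrite lerDr mulr_ge0 ?normal_pdf_ge0// ltW.
rewrite intRD; [|exact: L1Z..]; rewrite !intRZ// intR_normal_pdf mulr1.
have : K * s <= e / 2.
  rewrite (le_trans (ler_norm _))// /s; near: n.
  exact: (@cvgr0_norm_le _ _ _ _ _ _ cs _ e20).
by rewrite /K; lra.
Unshelve. all: end_near. Qed.

(** By Parseval, averaging [f] against a normal density at [a] is pairing [h] with [gmod]. As the
    deviation tends to 0, the first side tends to f(a) and the second, dominated by 2 |h|, to the
    transform of [h] at [a]. *)
Lemma hartley_inversion f h : is_hartley f h -> L1 h -> continuous f -> f = hart h.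
Proof.
move=> fh Lh cf; have [f2 h2 _ _] := fh; apply/funext => a.
have hm := SQ_measurable h2.
have E n : intR (fun x => f x * normal_pdf a n.+1%:R^-1 x) =
           intR (fun x => h x * gmod n.+1%:R^-1 a x).
  have s0 : 0 < n.+1%:R^-1 :> R by rewrite invr_gt0 ltr0n.
  have c1 := hartley_pairing fh (L1_gmod a s0) (SQ_gmod a s0).
  move: c1; rewrite hart_gmod// => c1.
  apply: (@cvg_unique _ (@norm_hausdorff _ R) _ _ _ _ _ c1).
  have L : L1 (fun x => f x * normal_pdf a n.+1%:R^-1 x).
    by apply: SQM => //; apply: SQ_normal_pdf; rewrite gt_eqF.
  apply: (@dominated_intR _ _ _ _ _ (L1_norm L) _ _).2.
  - move=> k; apply: measurable_funM; last exact: measurable_normal_pdf.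
    by apply: L1_measurable; exact: L1_tr.
  - move=> x; apply: cvgM; last exact: cvg_cst.
    apply: cvg_near_cst; near=> k; rewrite /tr patchE ifT// inE/= in_itv/= -ler_norml.
    by near: k; exact: nbhs_infty_ger.
  - move=> k x; rewrite !normrM ler_wpM2r// /tr patchE.
    by case: ifP => // _; rewrite normr0.
have := approx_identity f2 (cf a).
under eq_fun do rewrite E.
move=> c1; apply: (@cvg_unique _ (@norm_hausdorff _ R) _ _ _ _ c1).
have ms n : measurable_fun setT (fun x : R => expR (- (2 * pi ^+ 2 * n.+1%:R^-1 ^+ 2 * x ^+ 2))).
  apply: continuous_measurable; apply: derive_continuous => x; derive_tac; reflexivity.
apply: (@dominated_intR _ _ _ _ _ (L1Z 2 (L1_norm Lh)) _ _).2.
- move=> n; apply: measurable_funM => //; apply: measurable_funM => //.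
  exact: measurable_ker.
- move=> x; rewrite [X in _ --> X]mulrC; apply: cvgM; first exact: cvg_cst.
  have h1 : 2 * pi ^+ 2 * n.+1%:R^-1 ^+ 2 * x ^+ 2 @[n --> \oo] --> 2 * pi ^+ 2 * (0 * 0) * x ^+ 2.
    apply: cvgM; last exact: cvg_cst.
    by apply: cvgM; [exact: cvg_cst|exact: (cvgM cvg_harmonic cvg_harmonic)].
  have E0 : expR (- (2 * pi ^+ 2 * (0 * 0) * x ^+ 2)) = 1 :> R.
    by rewrite mul0r mulr0 mul0r oppr0 expR0.
  rewrite -[X in _ --> X]mulr1 -[X in _ * X]E0; apply: cvgM; first exact: cvg_cst.
  by apply: continuous_cvg; [exact: continuous_expR|exact: cvgN].
- move=> n x; rewrite normrM mulrC ler_wpM2r// /gmod normrM.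
  rewrite -[leRHS]mulr1; apply: ler_pM => //; first exact: cas_le2.
  rewrite ger0_norm ?expR_ge0// -[leRHS]expR0 ler_expR oppr_le0.
  by rewrite mulr_ge0 ?sqr_ge0// mulr_ge0 ?sqr_ge0// mulr_ge0 ?sqr_ge0.
Unshelve. all: end_near. Qed.

End Inversion.

(** * Weights *)

Section Weights.
Context {R : realType}.
Local Notation mu := (@lebesgue_measure R).
Implicit Types (f g h : R -> R) (x y c p : R).

Lemma L1_powR p : 1 < p -> L1 (fun x : R => (1 + `|x|) `^ (- p)).
Proof.
move=> p1; pose g (x : R) := (1 + `|x|) `^ (- p).
have g0 x : 0 <= g x by exact: powR_ge0.
have pos (x : R) : 0 <= x -> 0 < 1 + x by move=> x0; rewrite ltr_pwDl.
have cg : continuous g.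
  move=> x; apply: (@continuous_comp _ _ _ (fun x : R => 1 + `|x|) (fun y => y `^ (- p))).
    by apply: cvgD; [exact: cvg_cst|exact: norm_continuous].
  apply/differentiable_continuous/derivable1_diffP.
  by have [] := is_derive1_powR (- p) (pos _ (normr_ge0 x)).
apply: L1_ge0_lty => //; first exact: continuous_measurable.
rewrite ge0_symfun_integralT//; last by move=> x /=; rewrite /g normrN.
rewrite (_ : [set x | 0 <= x] = `[0, +oo[%classic); last first.
  by apply/seteqP; split => x /=; rewrite in_itv/= andbT.
pose F (x : R) := (1 - p)^-1 * (1 + x) `^ (1 - p).
have dF (x : R) : 0 <= x -> is_derive x (1 : R) F ((1 + x) `^ (- p)).
  move=> x0.
  have d1 : is_derive x (1 : R) (fun y : R => 1 + y) (1 : R).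
    by derive_tac; rewrite add0r.
  have := dfun_mul (dfun_cst (1 - p)^-1 x)
    (dfun_comp (is_derive1_powR (1 - p) (pos _ x0)) d1).
  move=> d2; apply: eq_derive d2 _.
  rewrite mul0r add0r mulr1 mulrA mulVf ?mul1r; last by rewrite subr_eq0 lt_eqF.
  by congr (_ `^ _); ring.
rewrite (@ge0_continuous_FTC2y R g F 0 0) //.
- by rewrite -EFinB -EFinM ltry.
- exact: continuous_subspaceT.
- rewrite /F -[X in _ --> X](mulr0 (1 - p)^-1).
  apply: cvgM; first exact: cvg_cst.
  apply/cvgr0Pnorm_le => e e0; near=> x.
  have p10 : 0 < p - 1 by rewrite subr_gt0.
  (* The threshold is where (1 + x)^(1 - p) falls to [e]. *)
  have M0 : 0 < e `^ (- (p - 1)^-1) by exact: powR_gt0.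
  have x0 : e `^ (- (p - 1)^-1) <= 1 + x.
    rewrite -lerBlDl; near: x; exact: nbhs_pinfty_ge.
  rewrite ger0_norm ?powR_ge0// -opprB powRN.
  rewrite -[leRHS]invrK lef_pV2 ?posrE ?invr_gt0 ?powR_gt0//; last exact: (lt_le_trans M0 x0).
  rewrite (_ : e^-1 = (e `^ (- (p - 1)^-1)) `^ (p - 1)).
    by apply: ge0_ler_powR => //; rewrite ?nnegrE ?(ltW p10) ?(ltW M0) ?(ltW (lt_le_trans M0 x0)).
  rewrite -powRrM mulNr mulVf ?gt_eqF// powR_inv1//; exact: ltW.
- by move=> x x0; have [] := dF x (ltW x0).
- apply: cvg_at_right_filter.
  by apply/differentiable_continuous/derivable1_diffP; have [] := dF 0 (lexx _).
- move=> x; rewrite in_itv/= andbT => x0; rewrite derive1E.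
  rewrite (@derive_val _ _ _ _ _ _ _ (dF x (ltW x0))) /g ger0_norm//; exact: ltW.
Unshelve. all: end_near. Qed.

(* The H^p norm is the L^2 norm of the transform for this weight. *)
Definition wt p x : R := (1 + x ^+ 2) `^ p.

Lemma wt_gt0 p x : 0 < wt p x.
Proof. by rewrite powR_gt0// ltr_pwDl// sqr_ge0. Qed.

Lemma wt_ge1 p x : 0 <= p -> 1 <= wt p x.
Proof.
move=> p0; rewrite -[leLHS](powRr0 (1 + x ^+ 2)) ler_powR// lerDl; exact: sqr_ge0.
Qed.

Lemma wtD p q x : wt p x * wt q x = wt (p + q) x.
Proof.
have h : 1 + x ^+ 2 != 0 by rewrite gt_eqF// ltr_pwDl// sqr_ge0.
by rewrite /wt powRD// h implybT.
Qed.

Lemma wt1 x : wt 1 x = 1 + x ^+ 2.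
Proof. by rewrite /wt powRr1// addr_ge0// sqr_ge0. Qed.

Lemma measurable_wt p : measurable_fun setT (wt p).
Proof.
apply: (@measurableT_comp _ _ _ _ _ _ (fun y : R => y `^ p)).
  exact: measurable_powR.
by apply: measurable_funD => //; exact: measurable_funX.
Qed.

Lemma L1_wt p : 2^-1 < p -> L1 (wt (- p)).
Proof.
move=> p1; have p2 : 1 < 2 * p by lra.
apply: (L1_le _ (L1Z (2 `^ p) (L1_powR p2))); first exact: measurable_wt.
move=> x; rewrite ger0_norm ?(ltW (wt_gt0 _ _))//.
have x0 := normr_ge0 x.
have d0 : 0 < 1 + x ^+ 2 by rewrite ltr_pwDl// sqr_ge0.
have q0 : 0 < 1 + `|x| by rewrite ltr_pwDl.
rewrite /wt !powRN powRrM powR_mulrn ?addr_ge0//.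
rewrite ler_pdivlMr; last by rewrite powR_gt0// exprn_gt0.
rewrite mulrC ler_pdivrMr ?powR_gt0// -powRM ?(ltW d0)//.
apply: ge0_ler_powR; rewrite ?nnegrE ?mulr_ge0 ?exprn_ge0 ?(ltW d0) ?(ltW q0)//; first lra.
rewrite -(real_normK (num_real x)) -subr_ge0 (_ : _ - _ = (1 - `|x|) ^+ 2) ?sqr_ge0//.
by ring.
Qed.

Lemma L1_inv1X2 : L1 (fun x : R => (1 + x ^+ 2)^-1).
Proof.
have h : (2^-1 : R) < 1 by lra.
apply: eq_L1 (L1_wt h) => x.
by rewrite /wt powR_inv1// addr_ge0// sqr_ge0.
Qed.

End Weights.

(** * The strip kernel *)

Section Hyperbolic.
Context {R : realType}.
Local Notation mu := (@lebesgue_measure R).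
Implicit Types (f g h : R -> R) (x y c p : R).

Definition ch x : R := (expR x + expR (- x)) / 2.
Definition sh x : R := (expR x - expR (- x)) / 2.

(** Quadratic growth is all that integrability of 1 / cosh requires; it comes from the second Taylor
    term of the exponential. *)
Lemma ch_ge x : (1 + x ^+ 2) / 4 <= ch x.
Proof.
wlog x0 : x / 0 <= x => [H|].
  have [/H//|/ltW x0] := leP 0 x.
  have := H (- x); rewrite oppr_ge0 sqrrN => /(_ x0).
  by rewrite /ch opprK (addrC (expR (- x))).
have := expR_ge1Dxn 1 x0; have := expR_ge0 (- x); rewrite /ch.
rewrite -[(1.+1)`!]/2%N; have := sqr_ge0 x; lra.
Qed.

Lemma ch_sh x : ch x ^+ 2 - sh x ^+ 2 = 1.
Proof.
have := expRxMexpNx_1 x; rewrite /ch /sh; set a := expR x; set b := expR (- x) => ab.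
by rewrite (_ : _ - _ = a * b)//; field.
Qed.

Lemma ch_ge1 x : 1 <= ch x.
Proof.
have := ch_sh x; have := sqr_ge0 (sh x).
have : 0 < ch x by rewrite divr_gt0// addr_gt0 ?expR_gt0.
nra.
Qed.

Lemma ch_gt0 x : 0 < ch x.
Proof. exact: lt_le_trans (ch_ge1 x). Qed.

Lemma sh_le_ch x : `|sh x| <= ch x.
Proof.
have := ch_ge1 x; have := ch_sh x => E c1.
rewrite -(ger0_norm (ltW (ch_gt0 x))) -ler_sqr ?nnegrE// !real_normK ?num_real//.
by lra.
Qed.

Lemma sh0 : sh 0 = 0. Proof. by rewrite /sh oppr0 expR0; field. Qed.

Lemma dfun_ch g x b : is_derive x (1 : R) g b ->
  is_derive x (1 : R) (fun y => ch (g y)) (sh (g x) * b : R).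
Proof. by move=> dg; rewrite /ch /sh; derive_tac; field. Qed.

Lemma dfun_sh g x b : is_derive x (1 : R) g b ->
  is_derive x (1 : R) (fun y => sh (g y)) (ch (g x) * b : R).
Proof. by move=> dg; rewrite /ch /sh; derive_tac; field. Qed.

End Hyperbolic.

Ltac derive_ch := eapply eq_derive;
  [repeat first [eapply dfun_ch | eapply dfun_sh | derive1] | cbv beta].

(** * Bounds and differential identities for the strip kernel *)

Section StripKernel.
Context {R : realType}.
Implicit Types (x y c p b : R).

Lemma continuous_ch : continuous (@ch R).
Proof. by apply: derive_continuous => x; apply: dfun_ch; exact: dfun_id. Qed.

Lemma L1_ich b : b != 0 -> L1 (fun x => (ch (b * x))^-1).
Proof.
move=> b0; apply: (L1_le _ (L1Z (4 * (1 + b ^- 2)) L1_inv1X2)).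
  apply: continuous_measurable; apply: derive_continuous => x.
  by derive_ch; [rewrite gt_eqF// ch_gt0|reflexivity].
move=> x; rewrite ger0_norm ?invr_ge0 ?(ltW (ch_gt0 _))//.
have d0 : 0 < 1 + x ^+ 2 by rewrite ltr_pwDl// sqr_ge0.
rewrite ler_pdivlMr// mulrC ler_pdivrMr ?ch_gt0//.
have b2 : 0 < b ^- 2 by rewrite invr_gt0 exprn_even_gt0.
apply: (@le_trans _ _ (4 * (1 + b ^- 2) * ((1 + (b * x) ^+ 2) / 4))); last first.
  by rewrite ler_wpM2l ?ch_ge// mulr_ge0// addr_ge0// ltW.
rewrite (_ : 4 * _ * _ = 1 + x ^+ 2 + b ^- 2 + (b * x) ^+ 2); last by field.
by have := sqr_ge0 (b * x); lra.
Qed.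

(* Imaginary part of tanh((y + i th) / 2), and its first two th-derivatives. *)
Definition K0 th y : R := sin th / (ch y + cos th).
Definition K1 th y : R := (cos th * ch y + 1) / (ch y + cos th) ^+ 2.
Definition K2 th y : R := sin th * (cos th * ch y + 2 - ch y ^+ 2) / (ch y + cos th) ^+ 3.

(** A lower bound on cos th above -1 keeps the denominator comparable to cosh, uniformly in th. The
    constants below blow up as c tends to -1, that is, as th tends to pi. *)
Lemma den_ge c th y : -1 < c -> c <= cos th -> (1 + c) / 2 * ch y <= ch y + cos th.
Proof. by move=> c1 cth; have := ch_ge1 y; have := cos_le1 th; nra. Qed.

Lemma den_gt0 c th y : -1 < c -> c <= cos th -> 0 < ch y + cos th.
Proof.
move=> c1 cth; apply: lt_le_trans (den_ge y c1 cth).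
by rewrite mulr_gt0 ?ch_gt0//; lra.
Qed.

Lemma ratio_le (a d k C : R) n : 0 < k -> 0 < C -> k * C <= d ->
  `|a / d ^+ n.+1| <= (k ^+ n.+1)^-1 * (`|a| / C ^+ n.+1).
Proof.
move=> k0 C0 kd; have d0 : 0 < d by apply: lt_le_trans kd; rewrite mulr_gt0.
rewrite normrM normfV (ger0_norm (exprn_ge0 _ (ltW d0))).
rewrite mulrCA ler_wpM2l// -invfM -exprMn lef_pV2 ?posrE ?exprn_gt0 ?mulr_gt0//.
by rewrite lerXn2r ?nnegrE ?(ltW d0)// mulr_ge0 ?(ltW k0) ?(ltW C0).
Qed.

Lemma K0_le c th y : -1 < c -> c <= cos th ->
  `|K0 th y| <= ((1 + c) / 2)^-1 * (ch y)^-1.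
Proof.
move=> c1 cth; have k0 : 0 < (1 + c) / 2 by lra.
have := @ratio_le (sin th) _ _ _ 0 k0 (ch_gt0 y) (den_ge y c1 cth).
rewrite !expr1 => /le_trans; apply.
rewrite ler_wpM2l ?invr_ge0 ?(ltW k0)// ler_piMl ?invr_ge0 ?(ltW (ch_gt0 _))//.
exact: sin_max.
Qed.

Lemma K1_le c th y : -1 < c -> c <= cos th ->
  `|K1 th y| <= (((1 + c) / 2) ^+ 2)^-1 * 2 * (ch y)^-1.
Proof.
move=> c1 cth; have k0 : 0 < (1 + c) / 2 by lra.
apply: (le_trans (@ratio_le _ _ _ _ 1 k0 (ch_gt0 y) (den_ge y c1 cth))).
rewrite -mulrA ler_wpM2l ?invr_ge0 ?exprn_ge0 ?(ltW k0)//.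
have C0 := ch_gt0 y; rewrite ler_pdivrMr ?exprn_gt0//.
rewrite (_ : 2 / ch y * _ = 2 * ch y); last by field; rewrite gt_eqF.
have := ch_ge1 y; have := cos_le1 th; have := cos_geN1 th => h1 h2 h3.
by rewrite ler_norml; nra.
Qed.

Lemma K2_le c th y : -1 < c -> c <= cos th ->
  `|K2 th y| <= (((1 + c) / 2) ^+ 3)^-1 * 4 * (ch y)^-1.
Proof.
move=> c1 cth; have k0 : 0 < (1 + c) / 2 by lra.
apply: (le_trans (@ratio_le _ _ _ _ 2 k0 (ch_gt0 y) (den_ge y c1 cth))).
rewrite -mulrA ler_wpM2l ?invr_ge0 ?exprn_ge0 ?(ltW k0)//.
have C0 := ch_gt0 y; rewrite ler_pdivrMr ?exprn_gt0//.
rewrite (_ : 4 / ch y * _ = 4 * ch y ^+ 2); last by field; rewrite gt_eqF.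
rewrite normrM; apply: (@le_trans _ _ (1 * (4 * ch y ^+ 2))); last by rewrite mul1r.
apply: ler_pM => //; first exact: sin_max.
have := ch_ge1 y; have := cos_le1 th; have := cos_geN1 th => h1 h2 h3.
by rewrite ler_norml; nra.
Qed.

Lemma dfun_K0_th th y : ch y + cos th != 0 ->
  is_derive th (1 : R) (K0 ^~ y) (K1 th y).
Proof.
move=> d0; rewrite /K0 /K1; derive_ch => //.
have := sin2cos2 th; move: d0; set s := sin th; set c := cos th; set C := ch y => d0 sc.
rewrite (_ : c * C + 1 = c * (C + c) + s ^+ 2); last by rewrite sc; ring.
by field.
Qed.

Lemma dfun_K1_th th y : ch y + cos th != 0 ->
  is_derive th (1 : R) (K1 ^~ y) (K2 th y).
Proof.
move=> d0; rewrite /K1 /K2; derive_ch => //; first by rewrite expf_neq0.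
move: d0; set s := sin th; set c := cos th; set C := ch y => d0.
by field.
Qed.

Lemma dfun_K0_x (b : R) th x : ch (b * x) + cos th != 0 ->
  is_derive x (1 : R) (fun x => K0 th (b * x))
    (- b * sin th * sh (b * x) / (ch (b * x) + cos th) ^+ 2).
Proof. by move=> d0; rewrite /K0; derive_ch => //; field. Qed.

(** Harmonicity of an imaginary part of a holomorphic function: two derivatives in the space
    variable are minus b^2 times two derivatives in [th]. *)
Lemma dfun_K0_xx (b : R) th x : ch (b * x) + cos th != 0 ->
  is_derive x (1 : R) (fun x => - b * sin th * sh (b * x) / (ch (b * x) + cos th) ^+ 2)
    (- b ^+ 2 * K2 th (b * x)).
Proof.
move=> d0; rewrite /K2; derive_ch => //; first by rewrite expf_neq0.
have := ch_sh (b * x); move: d0; set s := sin th; set c := cos th.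
set C := ch _; set S := sh _ => d0 CS.
rewrite (_ : c * C + 2 - C ^+ 2 = c * C + C ^+ 2 - 2 * S ^+ 2); last by lra.
by field.
Qed.

End StripKernel.

(** * Cosine transforms of the kernel as solutions of an equation in th *)

Section StripRelation.
Context {R : realType}.
Context (th b : R) (th_itv : 0 < th < pi) (b_gt0 : 0 < b).
Implicit Types (x y k : R).

(** An angle beyond [th] but below pi: [0, th] lies inside the open interval (- th1, th1), where
    two-sided derivatives exist and all bounds are uniform through [c1]. *)
Let th1 : R := (th + pi) / 2.
Let c1 : R := cos th1.

Let th1_itv : th < th1 < pi.
Proof. by case/andP: th_itv => h1 h2; rewrite /th1; apply/andP; split; lra. Qed.

Let c1_gt : -1 < c1.
Proof.
case/andP: th_itv => h1 h2; case/andP: th1_itv => h3 h4.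
rewrite -(cospi R) ltr_cos// in_itv/= ?lexx ?pi_ge0//.
by apply/andP; split; lra.
Qed.

Let c1_le y : - th1 < y < th1 -> c1 <= cos y.
Proof.
rewrite -ltr_norml => yt; case/andP: th_itv => h1 h2; case/andP: th1_itv => h3 h4.
rewrite -(cos_norm y); apply: ltW; rewrite ltr_cos// in_itv/=.
  by rewrite normr_ge0/=; lra.
by apply/andP; split; lra.
Qed.

Let den0 y x : - th1 < y < th1 -> ch (b * x) + cos y != 0.
Proof. by move=> yt; rewrite gt_eqF// (den_gt0 _ c1_gt)// c1_le. Qed.

Let cK0 y : - th1 < y < th1 -> continuous (fun x => K0 y (b * x)).
Proof. by move=> yt; eapply derive_continuous => x; apply: dfun_K0_x; exact: den0. Qed.

Let cK1 y : - th1 < y < th1 -> continuous (fun x => K1 y (b * x)).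
Proof.
move=> yt; rewrite /K1; eapply derive_continuous => x.
by derive_ch; [rewrite expf_neq0// den0|reflexivity].
Qed.

Let cK2 y : - th1 < y < th1 -> continuous (fun x => K2 y (b * x)).
Proof.
move=> yt; rewrite (_ : (fun x => _) = fun x => sin y * (cos y * ch (b * x) + 2 - ch (b * x) ^+ 2) /
  ((ch (b * x) + cos y) * (ch (b * x) + cos y) ^+ 2)).
  by eapply derive_continuous => x; derive_ch; [rewrite mulf_neq0 ?expf_neq0// den0|reflexivity].
by apply/funext => z; rewrite -exprS.
Qed.

Let mcos k : measurable_fun setT (fun x => cos (k * x)).
Proof.
by apply: continuous_measurable; eapply derive_continuous => x; derive_tac; reflexivity.
Qed.

Let L1_le_ich M (G : R -> R) : continuous G ->
  (forall x, `|G x| <= M * (ch (b * x))^-1) -> L1 G.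
Proof.
move=> cG GM; apply: L1_le (L1Z M (L1_ich _)) GM; first exact: continuous_measurable.
by rewrite gt_eqF.
Qed.

Let LK0 y : - th1 < y < th1 -> L1 (fun x => K0 y (b * x)).
Proof.
by move=> yt; apply: L1_le_ich (cK0 yt) _ => x; apply: K0_le c1_gt _; exact: c1_le.
Qed.

Let LK1 y : - th1 < y < th1 -> L1 (fun x => K1 y (b * x)).
Proof.
by move=> yt; apply: L1_le_ich (cK1 yt) _ => x; apply: K1_le c1_gt _; exact: c1_le.
Qed.

Let LK2 y : - th1 < y < th1 -> L1 (fun x => K2 y (b * x)).
Proof.
by move=> yt; apply: L1_le_ich (cK2 yt) _ => x; apply: K2_le c1_gt _; exact: c1_le.
Qed.

Let L1_cos k G : L1 G -> L1 (fun x => cos (k * x) * G x).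
Proof. by move=> LG; apply: (@L1_bmul _ 1) => // x; exact: cos_max. Qed.

Let D0 k y := intR (fun x => cos (k * x) * K0 y (b * x)).
Let D1 k y := intR (fun x => cos (k * x) * K1 y (b * x)).
Let D2 k y := intR (fun x => cos (k * x) * K2 y (b * x)).

Let dD0 k y : - th1 < y < th1 -> is_derive y (1 : R) (D0 k) (D1 k y).
Proof.
move=> yt; apply: (@is_derive_intR _ (fun y x => cos (k * x) * K0 y (b * x))
  (fun y x => cos (k * x) * K1 y (b * x)) _ _ _
  (fun x => (((1 + c1) / 2) ^+ 2)^-1 * 2 * (ch (b * x))^-1) yt).
- by move=> z zt; apply: L1_cos; exact: LK0.
- move=> z x zt; apply: eq_derive (dfun_mul (dfun_cst _ _) (dfun_K0_th (den0 x zt))) _.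
  by rewrite mul0r add0r.
- by apply: L1Z; apply: L1_ich; rewrite gt_eqF.
- move=> z x zt; rewrite normrM; apply: le_trans (K1_le (b * x) c1_gt (c1_le zt)).
  by rewrite ler_piMl// cos_max.
Qed.

Let dD1 k y : - th1 < y < th1 -> is_derive y (1 : R) (D1 k) (D2 k y).
Proof.
move=> yt; apply: (@is_derive_intR _ (fun y x => cos (k * x) * K1 y (b * x))
  (fun y x => cos (k * x) * K2 y (b * x)) _ _ _
  (fun x => (((1 + c1) / 2) ^+ 3)^-1 * 4 * (ch (b * x))^-1) yt).
- by move=> z zt; apply: L1_cos; exact: LK1.
- move=> z x zt; apply: eq_derive (dfun_mul (dfun_cst _ _) (dfun_K1_th (den0 x zt))) _.
  by rewrite mul0r add0r.
- by apply: L1Z; apply: L1_ich; rewrite gt_eqF.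
- move=> z x zt; rewrite normrM; apply: le_trans (K2_le (b * x) c1_gt (c1_le zt)).
  by rewrite ler_piMl// cos_max.
Qed.

Let cvg_ich : (ch (b * n%:R))^-1 @[n --> \oo] --> (0 : R).
Proof.
apply: (@cvg0_le _ _ _ _ _ (fun n => 4 * (1 + b ^- 2) * n.+1%:R^-1)).
  apply: nearW => n; rewrite ger0_norm ?invr_ge0 ?(ltW (ch_gt0 _))//.
  rewrite ler_pdivlMr ?ltr0n// mulrC ler_pdivrMr ?ch_gt0//.
  have b2 : 0 < b ^- 2 by rewrite invr_gt0 exprn_gt0.
  apply: (@le_trans _ _ (4 * (1 + b ^- 2) * ((1 + (b * n%:R) ^+ 2) / 4))); last first.
    by rewrite ler_wpM2l ?ch_ge// mulr_ge0// addr_ge0// ltW.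
  rewrite (_ : 4 * _ * _ = 1 + n%:R ^+ 2 + b ^- 2 + (b * n%:R) ^+ 2); last first.
    by field; rewrite gt_eqF.
  have : n%:R <= n%:R ^+ 2 :> R.
    by rewrite -natrX ler_nat -mulnn; case: (n) => // k; rewrite leq_pmulr.
  by rewrite -natr1; have := sqr_ge0 (b * n%:R : R); lra.
rewrite -(mulr0 (4 * (1 + b ^- 2))); apply: cvgM; first exact: cvg_cst.
exact: cvg_harmonic.
Qed.

(** Two integrations by parts on the harmonic kernel: the difference of the two integrands is the
    derivative of [H], which decays like 1 / cosh. *)
Let D2E k y : - th1 < y < th1 -> b ^+ 2 * D2 k y = k ^+ 2 * D0 k y.
Proof.
move=> yt.
have L0 := L1_cos k (LK0 yt); have L2 := L1_cos k (LK2 yt).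
pose H x := cos (k * x) * (- b * sin y * sh (b * x) / (ch (b * x) + cos y) ^+ 2)
   + k * sin (k * x) * K0 y (b * x).
pose H' x := k ^+ 2 * (cos (k * x) * K0 y (b * x)) - b ^+ 2 * (cos (k * x) * K2 y (b * x)).
have dH x : is_derive x (1 : R) H (H' x).
  have dx := dfun_K0_x (den0 x yt); have dxx := dfun_K0_xx (den0 x yt).
  rewrite /H /H'.
  have dc : is_derive x (1 : R) (fun x => cos (k * x)) (- sin (k * x) * k).
    by derive_tac; ring.
  have ds : is_derive x (1 : R) (fun x => k * sin (k * x)) (k * (cos (k * x) * k)).
    by derive_tac; ring.
  by apply: eq_derive (dfun_add (dfun_mul dc dxx) (dfun_mul ds dx)) _; ring.
have cc : continuous (fun x => cos (k * x)).
  by eapply derive_continuous => x; derive_tac; reflexivity.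
have cH' : continuous H'.
  move=> x; apply: cvgB; apply: cvgM; try exact: cvg_cst.
    by apply: cvgM; [exact: cc|exact: cK0].
  by apply: cvgM; [exact: cc|exact: cK2].
have LH' : L1 H' by apply: L1B; exact: L1Z.
pose M := ((1 + c1) / 2)^-1 * `|k| + (((1 + c1) / 2) ^+ 2)^-1 * b.
have k0 : 0 < (1 + c1) / 2 by have := c1_gt; lra.
have HM x : `|H x| <= M * (ch (b * x))^-1.
  have c0 := ch_gt0 (b * x); have S1 := sh_le_ch (b * x).
  rewrite /H addrC (le_trans (ler_normD _ _))// /M mulrDl lerD//.
    apply: (@le_trans _ _ (`|k| * `|K0 y (b * x)|)).
      by rewrite !normrM ler_wpM2r// ler_piMr// sin_max.
    by rewrite [leRHS]mulrAC [leRHS]mulrC ler_wpM2l//; apply: K0_le c1_gt _; exact: c1_le.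
  rewrite normrM; apply: (@le_trans _ _ (1 * `|- b * sin y * sh (b * x) / (ch (b * x) + cos y) ^+ 2|)).
    by rewrite ler_wpM2r// cos_max.
  rewrite mul1r.
  apply: (le_trans (@ratio_le _ _ _ _ _ 1 k0 c0 (den_ge _ c1_gt (c1_le yt)))).
  rewrite -[leRHS]mulrA ler_wpM2l ?invr_ge0 ?exprn_ge0 ?(ltW k0)//.
  rewrite ler_pdivrMr ?exprn_gt0//.
  rewrite (_ : b / ch (b * x) * _ = b * ch (b * x)); last by field; rewrite gt_eqF.
  rewrite (normrM (- b * sin y)) (normrM (- b)) normrN (gtr0_norm b_gt0) -mulrA ler_wpM2l ?(ltW b_gt0)//.
  rewrite -[leRHS]mul1r; apply: ler_pM => //; exact: sin_max.
have : intR H' = 0.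
  apply: (intR_derivative cH' LH' dH).
  apply: (@cvg0_le _ _ _ _ _ (fun n => M * (ch (b * n%:R))^-1 + M * (ch (b * n%:R))^-1)).
    apply: nearW => n; apply: (le_trans (ler_normB _ _)); apply: lerD; first exact: HM.
    by apply: (le_trans (HM _)); rewrite mulrN /ch opprK [X in X / 2]addrC.
  rewrite -(addr0 0) -{1 2}(mulr0 M).
  by apply: cvgD; apply: cvgM; try exact: cvg_cst; exact: cvg_ich.
rewrite intRB; [|exact: L1Z..]; rewrite !intRZ//.
by move=> /eqP; rewrite subr_eq0 => /eqP ->.
Qed.

Let yin y : 0 <= y <= th -> - th1 < y < th1.
Proof.
case/andP: th_itv => h1 h2; case/andP: th1_itv => h3 h4.
by move=> /andP[y0 yt]; apply/andP; split; lra.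
Qed.

Let cst_th (V : R -> R) : (forall y, - th1 < y < th1 -> is_derive y (1 : R) V 0) ->
  V th = V 0.
Proof.
move=> dV; have [h1 h2] := andP th_itv.
have d (y : R) : y \in `]0, th[ -> is_derive y (1 : R) V 0.
  by rewrite in_itv/= => /andP[y0 yt]; apply: dV; apply: yin; rewrite !ltW.
have cV : {within `[0, th], continuous V}.
  apply: derivable_within_continuous => y; rewrite in_itv/= => yt.
  by have [] := dV y (yin yt).
have [c _] := MVT h1 d cV.
by rewrite mul0r => /eqP; rewrite subr_eq0 => /eqP.
Qed.

Let D00 k : D0 k 0 = 0.
Proof.
rewrite /D0 -[RHS](@intR0 R); congr intR; apply/funext => x.
by rewrite /K0 sin0 mul0r mulr0.
Qed.

(** The difference of the two sides is a Wronskian of [D0] and sinh (k y / b), two solutions of the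
    same equation in y. It is therefore constant in y, and both solutions vanish at y = 0. *)
Lemma strip_relation k : k != 0 ->
  b * intR (fun x => cos (k * x) * K1 th (b * x)) * sh (k / b * th) =
  k * ch (k / b * th) * intR (fun x => cos (k * x) * K0 th (b * x)).
Proof.
move=> k0; have b0 : b != 0 by rewrite gt_eqF.
pose V y := b * D1 k y * sh (k / b * y) - k * ch (k / b * y) * D0 k y.
suff : V th = V 0.
  rewrite /V D00 mulr0 sh0 !mulr0 subr0 => /eqP.
  by rewrite subr_eq0 => /eqP.
apply: cst_th => y yt; have d0 := dD0 k yt; have d1 := dD1 k yt.
have E : D2 k y = k ^+ 2 / b ^+ 2 * D0 k y.
  by rewrite mulrAC -(D2E k yt) mulrC mulKf// expf_neq0.
by rewrite /V; derive_ch; rewrite E; field.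
Qed.

(** At zero frequency the equation is D'' = 0 and y replaces the hyperbolic sine in the
    Wronskian. *)
Lemma strip_relation0 :
  intR (fun x => K1 th (b * x)) * th = intR (fun x => K0 th (b * x)).
Proof.
have b0 : b != 0 by rewrite gt_eqF.
pose V y := D1 0 y * y - D0 0 y.
have e (G : R -> R) : (fun x => cos (0 * x) * G (b * x)) = fun x => G (b * x).
  by apply/funext => x; rewrite mul0r cos0 mul1r.
suff : V th = V 0.
  rewrite /V D00 mulr0 subr0 => /eqP; rewrite subr_eq0 => /eqP.
  by rewrite /D1 /D0 !e.
apply: cst_th => y yt; have d0 := dD0 0 yt; have d1 := dD1 0 yt.
have E : D2 0 y = 0.
  apply: (mulfI (expf_neq0 2 b0)).
  by rewrite D2E// expr0n/= mul0r mulr0.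
by rewrite /V; derive_tac; rewrite E; ring.
Qed.

End StripRelation.

(** * Unique continuation *)

Section Moments.
Context {R : realType}.
Local Notation mu := (@lebesgue_measure R).
Implicit Types (f g h rho z : R -> R) (x y c p M : R).

(** Writes the inverse as f (f^2)^(-1) with a power of a nonnegative base; at zeros of [f] both
    sides are 0 by the convention on inverses. *)
Lemma measurable_invr f : measurable_fun setT f -> measurable_fun setT (fun x => (f x)^-1).
Proof.
move=> mf; rewrite (_ : (fun x => _) = fun x => f x * (f x ^+ 2) `^ (- 1)).
  apply: measurable_funM => //.
  apply: (@measurableT_comp _ _ _ _ _ _ (fun y : R => y `^ (- 1))).
    exact: measurable_powR.
  exact: measurable_funX.
apply/funext => x; rewrite powR_inv1 ?sqr_ge0//.
by have [->|f0] := eqVneq (f x) 0; [rewrite invr0 mul0r|field].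
Qed.

Lemma L1_bmulr M (k : R -> R) f : measurable_fun setT k -> (forall x, `|k x| <= M) ->
  L1 f -> L1 (fun x => f x * k x).
Proof.
by move=> mk kM Lf; apply: eq_L1 (L1_bmul mk kM Lf) => x; rewrite mulrC.
Qed.

(* The coefficients of [1 / (1 - z t) ^+ 2 = \sum_j (j + 1) (z t) ^+ j] are
   extracted one at a time: the j-th remainder is [z ^+ j] times
   [(j + 1 - j z t) / (1 - z t) ^+ 2]. *)
Lemma resolvent_moments rho z M t0 : L1 rho -> measurable_fun setT z ->
  (forall x, `|z x| <= M) -> 0 < t0 ->
  (forall t, `|t| < t0 -> intR (fun x => rho x * (1 - z x * t) ^- 2) = 0) ->
  forall j, intR (fun x => rho x * z x ^+ j) = 0.
Proof.
move=> Lr mz zM t00 H0.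
have M0 : 0 <= M := le_trans (normr_ge0 _) (zM 0).
(* [N] is positive even if [M] is 0; then |t| < 1 / (2 N) gives |z t| <= 1/2 and keeps 1 - z t at
   least 1/2. *)
pose N := M + 1; have N0 : 0 < N by rewrite /N; lra.
have zN x : `|z x| <= N by rewrite (le_trans (zM x))// /N; lra.
pose t1 := Num.min t0 (2 * N)^-1.
have t10 : 0 < t1 by rewrite lt_min t00 invr_gt0 mulr_gt0.
pose r (j : nat) t x := (j.+1%:R - j%:R * (z x * t)) * (1 - z x * t) ^- 2.
pose k j t x := z x ^+ j * r j t x.
pose A j t := intR (fun x => rho x * k j t x).
have zt t x : `|t| < t1 -> `|z x * t| <= 2^-1.
  rewrite lt_min => /andP[_ tN]; rewrite normrM.
  apply: (@le_trans _ _ (N * (2 * N)^-1)); first by apply: ler_pM => //; exact: ltW.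
  by rewrite invfM mulrCA mulfV ?mulr1// gt_eqF.
have dpos t x : `|t| < t1 -> 2^-1 <= 1 - z x * t.
  by move=> /zt - /(_ x); rewrite ler_norml => /andP[? ?]; lra.
have mk j t : measurable_fun setT (k j t).
  have mzt : measurable_fun setT (fun x => z x * t) by exact: measurable_funM.
  apply: measurable_funM; first exact: measurable_funX.
  apply: measurable_funM; first by apply: measurable_funB => //; exact: measurable_funM.
  by apply: measurable_invr; apply: measurable_funX; exact: measurable_funB.
pose C (j : nat) := N ^+ j * ((j.+1%:R + j%:R) * 4).
have kC j t x : `|t| < t1 -> `|k j t x| <= C j.
  move=> tt; rewrite normrM normrX /C.
  apply: ler_pM; [exact: exprn_ge0|exact: normr_ge0|by rewrite lerXn2r ?nnegrE// ltW|].
  rewrite normrM; apply: ler_pM => //.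
    rewrite (le_trans (ler_normB _ _))// (ger0_norm (ler0n R j.+1)) lerD//.
    rewrite normrM (ger0_norm (ler0n R j)) ler_piMr//.
    by rewrite (le_trans (zt _ _ tt))//; lra.
  have d := dpos _ x tt.
  rewrite normfV ger0_norm ?sqr_ge0// -[leRHS]invrK lef_pV2 ?posrE ?exprn_gt0 ?invr_gt0//.
    by nra.
  by lra.
have Lk j t : `|t| < t1 -> L1 (fun x => rho x * k j t x).
  by move=> tt; apply: L1_bmulr (mk j t) _ Lr => x; exact: kC.
have AB j t : `|A j t| <= C j * intR (fun x => `|rho x|) \/ t1 <= `|t|.
  have [tt|] := ltP `|t| t1; [left|by right].
  rewrite -intRZ; last exact: L1_norm.
  apply: norm_intR_le; first exact: L1_measurable (Lk j t tt).
    by apply: L1Z; exact: L1_norm.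
  by move=> x; rewrite normrM mulrC ler_wpM2r// kC.
have rE j t x : `|t| < t1 -> k j t x - k j 0 x = t * k j.+1 t x.
  move=> tt; have d : 1 - z x * t != 0 by rewrite gt_eqF//; have := dpos t x tt; lra.
  rewrite /k /r mulr0 subr0 mulr0 subr0 expr1n invr1 mulr1 -!natr1 (exprS (z x)).
  by field.
have AE j t : `|t| < t1 -> A j t - A j 0 = t * A j.+1 t.
  move=> tt; have t00' : `|0 : R| < t1 by rewrite normr0.
  rewrite /A -intRB; [|exact: Lk|exact: Lk]; rewrite -intRZ; last exact: Lk.
  congr intR; apply/funext => x.
  by rewrite -mulrBr rE// mulrCA.
have A0 j : forall t, `|t| < t1 -> A j t = 0.
  elim: j => [|j IH] t tt.
    rewrite -[RHS](H0 t); last by move: tt; rewrite lt_min => /andP[].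
    by congr intR; apply/funext => x; rewrite /k /r expr0 !mul1r mul0r subr0 mul1r.
  have n0 s : s != 0 -> `|s| < t1 -> A j.+1 s = 0.
    move=> s0 st; apply: (mulfI s0); rewrite mulr0 -AE// !IH ?normr0// subrr.
    by [].
  (* Dividing by [t] loses the value at 0. The next remainder recovers it: A (j+1) 0 = - s A (j+2) s
     for small s > 0, and A (j+2) is bounded. *)
  have [->|t_neq0] := eqVneq t 0; last exact: n0.
  have K0 : 0 <= C j.+2 * intR (fun x => `|rho x|).
    have [h|] := AB j.+2 0; first exact: le_trans h.
    by rewrite normr0 leNgt t10.
  apply/eqP; rewrite -normr_le0; apply/ler_addgt0Pl => e e0; rewrite addr0.
  pose K := C j.+2 * intR (fun x => `|rho x|).
  pose s := Num.min (t1 / 2) (e / (K + 1)).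
  have K1 : 0 < K + 1 by rewrite ltr_wpDl.
  have s0 : 0 < s by rewrite lt_min !divr_gt0.
  have st : `|s| < t1.
    rewrite gtr0_norm//; apply: (@le_lt_trans _ _ (t1 / 2)); last lra.
    by rewrite ge_min lexx.
  have := AE j.+1 s st; rewrite n0 ?gt_eqF// sub0r => /(congr1 Num.norm).
  rewrite normrN => ->; rewrite normrM gtr0_norm//.
  have [h|] := AB j.+2 s; last by rewrite leNgt st.
  apply: (@le_trans _ _ (e / (K + 1) * K)).
    by apply: ler_pM => //; [exact: ltW|rewrite ge_min lexx orbT].
  by rewrite mulrAC ler_pdivrMr// ler_wpM2l ?ltW// ltrDl.
move=> j; have t00' : `|0 : R| < t1 by rewrite normr0.
apply: (mulfI (_ : j.+1%:R != 0)); first by rewrite pnatr_eq0.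
rewrite mulr0 -[RHS](A0 j 0 t00') -intRZ.
  by congr intR; apply/funext => x; rewrite /k /r !mulr0 !subr0 expr1n invr1 mulr1; ring.
apply: (@L1_bmulr (N ^+ j)) => //; first exact: measurable_funX.
by move=> x; rewrite normrX lerXn2r ?nnegrE// ltW.
Qed.

Lemma moments_poly rho z M (P : {poly R}) : L1 rho -> measurable_fun setT z ->
  (forall x, `|z x| <= M) -> (forall j, intR (fun x => rho x * z x ^+ j) = 0) ->
  L1 (fun x => rho x * P.[z x]) /\ intR (fun x => rho x * P.[z x]) = 0.
Proof.
move=> Lr mz zM Hz.
have M0 : 0 <= M := le_trans (normr_ge0 _) (zM 0).
have Lz j : L1 (fun x => rho x * z x ^+ j).
  apply: (@L1_bmulr (M ^+ j)) => //; first exact: measurable_funX.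
  by move=> x; rewrite normrX lerXn2r ?nnegrE.
(* The extra power of [z] lets the induction on polynomials absorb the factor X. *)
suff H j : L1 (fun x => rho x * (z x ^+ j * P.[z x])) /\
    intR (fun x => rho x * (z x ^+ j * P.[z x])) = 0.
  by have := H 0%N; under eq_fun do rewrite expr0 mul1r.
elim/poly_ind: P j => [|P c IH] j.
  rewrite (_ : (fun x => _) = fun=> 0); first by split; [exact: L1_0|exact: intR0].
  by apply/funext => x; rewrite horner0 !mulr0.
have [L1P I1P] := IH j.+1.
rewrite (_ : (fun x => _) = fun x => rho x * (z x ^+ j.+1 * P.[z x]) + c * (rho x * z x ^+ j)).
  by split; [apply: L1D => //; exact: L1Z|rewrite intRD ?intRZ ?I1P ?Hz ?mulr0 ?addr0//; exact: L1Z].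
by apply/funext => x; rewrite hornerD hornerM hornerX hornerC (exprS (z x)); ring.
Qed.

Lemma bernoulli_le (a : R) n : 0 <= a -> 1 + n%:R * a <= (1 + a) ^+ n.
Proof.
move=> a0; elim: n => [|n IH]; first by rewrite mul0r addr0 expr0.
rewrite exprS; apply: (@le_trans _ _ ((1 + a) * (1 + n%:R * a))).
  rewrite -natr1 -subr_ge0 (_ : _ - _ = n%:R * a ^+ 2); last by ring.
  by rewrite mulr_ge0// sqr_ge0.
by rewrite ler_wpM2l// addr_ge0.
Qed.

(* Integrates [rho] against the powers of a polynomial in [z] peaked at [z y0]. *)
Lemma peak rho z M y0 e d : L1 rho -> measurable_fun setT z ->
  (forall x, `|z x| <= M) -> (forall j, intR (fun x => rho x * z x ^+ j) = 0) ->
  0 < e -> 0 < d ->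
  (forall x, `|z x - z y0| < e -> 0 <= rho x) ->
  (forall x, `|x - y0| <= d -> `|z x - z y0| <= e / 2) ->
  (forall x, `|x - y0| <= d -> 0 < rho x) -> False.
Proof.
move=> Lr mz zM Hz e0 d0 rho0 zJ rJ.
have M0 : 0 <= M := le_trans (normr_ge0 _) (zM 0).
pose J := `[y0 - d, y0 + d]%classic.
have JE x : J x -> `|x - y0| <= d.
  by rewrite /J/= in_itv/= => h; rewrite ler_distl.
have LJ : L1 (rho \_ J) by apply: L1_patch => //; exact: measurable_itv.
have rJ0 x : 0 <= (rho \_ J) x.
  by rewrite patchE; case: ifPn => //; rewrite inE => /JE/rJ/ltW.
have c0 : 0 < intR (rho \_ J).
  rewrite lt_neqAle intR_ge0// andbT eq_sym; apply/eqP => /(intR_eq0_ae LJ rJ0).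
  move=> [N [mN N0 subN]].
  have JN : J `<=` N.
    move=> x Jx; apply: subN => /=; rewrite patchE ifT ?inE// => h.
    by have := rJ x (JE x Jx); rewrite h ltxx.
  have : (mu J <= mu N)%E by apply: le_measure; rewrite ?inE//; exact: measurable_itv.
  have yd : y0 - d < y0 + d by lra.
  by rewrite N0 lebesgue_measure_itv/= lte_fin yd -EFinB lee_fin leNgt subr_gt0 yd.
(* [Q] is 1 + (e^2 - (z - z y0)^2) / L: at least 1 + ep / 2 on [J], at least 1 where |z - z y0| < e,
   and at most 1 in absolute value elsewhere, because |z - z y0| <= 2 M and [L] is large enough. *)
pose L := 4 * M ^+ 2 + e ^+ 2.
have L0 : 0 < L by rewrite ltr_wpDl ?mulr_ge0 ?sqr_ge0// exprn_gt0.
pose ep := e ^+ 2 / L; have ep0 : 0 < ep by rewrite divr_gt0// exprn_gt0.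
pose Q : {poly R} := (1 + ep)%:P - L^-1 *: ('X - (z y0)%:P) ^+ 2.
have QE x : Q.[z x] = 1 + (e ^+ 2 - (z x - z y0) ^+ 2) / L.
  by rewrite /Q hornerD hornerN hornerZ horner_exp hornerXsubC hornerC /ep mulrBl addrA (mulrC L^-1).
(* Powers of [Q] grow geometrically on [J]; where [rho] may be negative they cost at most |rho|. *)
have ineq n x : (1 + ep / 2) ^+ n * (rho \_ J) x - `|rho x| <= rho x * (Q ^+ n).[z x].
  rewrite horner_exp QE.
  have z2 : (z x - z y0) ^+ 2 = `|z x - z y0| ^+ 2 by rewrite real_normK ?num_real.
  have [ze|ze] := ltP `|z x - z y0| e.
    have r0 := rho0 x ze.
    have q1 : 1 <= 1 + (e ^+ 2 - (z x - z y0) ^+ 2) / L.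
      rewrite lerDl divr_ge0 ?(ltW L0)// subr_ge0 z2 lerXn2r ?nnegrE ?(ltW ze) ?(ltW e0)//.
    rewrite patchE; case: ifPn; last first.
      move=> _; rewrite -[point]/(0 : R) mulr0 sub0r (@le_trans _ _ 0) ?oppr_le0//.
      by rewrite mulr_ge0// exprn_ge0// (le_trans ler01).
    rewrite inE => /JE/zJ zh; rewrite ger0_norm// (@le_trans _ _ ((1 + ep / 2) ^+ n * rho x))//.
      by rewrite lerBlDr lerDl.
    rewrite mulrC ler_wpM2l// lerXn2r ?nnegrE ?(le_trans ler01 q1)//.
      by rewrite addr_ge0// divr_ge0// ltW.
    rewrite lerD2l /ep mulrAC ler_wpM2r ?invr_ge0 ?(ltW L0)// z2.
    have : `|z x - z y0| ^+ 2 <= (e / 2) ^+ 2 by rewrite lerXn2r ?nnegrE// divr_ge0// ltW.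
    by have := sqr_ge0 e; nra.
  rewrite patchE ifF; last first.
    apply/negbTE; rewrite notin_setE => /JE/zJ zh; lra.
  rewrite -[point]/(0 : R) mulr0 sub0r.
  have q1 : `|1 + (e ^+ 2 - (z x - z y0) ^+ 2) / L| <= 1.
    have e2 : e ^+ 2 <= (z x - z y0) ^+ 2 by rewrite z2 lerXn2r ?nnegrE// ltW.
    have zz : (z x - z y0) ^+ 2 <= 4 * M ^+ 2.
      have h : `|z x - z y0| <= 2 * M.
        by rewrite (le_trans (ler_normB _ _))// mulr2n mulrDl mul1r lerD.
      by rewrite z2 (_ : 4 * M ^+ 2 = (2 * M) ^+ 2) ?lerXn2r ?nnegrE ?mulr_ge0//; ring.
    rewrite ler_norml; apply/andP; split.
      rewrite -lerBlDl ler_pdivlMr// /L; have := sqr_ge0 e; nra.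
    by rewrite gerDl pmulr_lle0 ?invr_gt0// subr_le0.
  rewrite lerNl (le_trans (ler_norm _))// normrN normrM ler_piMr// normrX exprn_ile1//.
have bound n : (1 + ep / 2) ^+ n * intR (rho \_ J) <= intR (fun x => `|rho x|).
  have [LP IP] := moments_poly (Q ^+ n) Lr mz zM Hz.
  have LL : L1 (fun x => (1 + ep / 2) ^+ n * (rho \_ J) x) by exact: L1Z.
  have LN := L1_norm Lr.
  by rewrite -subr_le0 -intRZ// -intRB// -[leRHS]IP; apply: le_intR => //; exact: L1B.
have I0 : 0 <= intR (fun x => `|rho x|) by apply: intR_ge0.
(* By Bernoulli's inequality any exponent above [q] makes the growth on [J] exceed the fixed
   bound. *)
pose q := intR (fun x => `|rho x|) / (ep / 2 * intR (rho \_ J)).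
have den : 0 < ep / 2 * intR (rho \_ J) by rewrite mulr_gt0// divr_gt0.
have q0 : 0 <= q by rewrite divr_ge0// ltW.
have := bound (Num.bound q).
have h1 := @bernoulli_le (ep / 2) (Num.bound q) (ltW (divr_gt0 ep0 (ltr0Sn _ _))).
have h2 := archi_boundP q0.
rewrite leNgt => /negP; apply.
apply: lt_le_trans (ler_wpM2r (ltW c0) h1).
rewrite mulrDl mul1r -mulrA.
apply: (@lt_trans _ _ ((Num.bound q)%:R * (ep / 2 * intR (rho \_ J)))); last by rewrite ltrDr.
by rewrite -ltr_pdivrMr.
Qed.

End Moments.

(** * The symbol as the quotient of the kernel transforms *)

Section StripDuality.
Context {R : realType}.
Local Notation mu := (@lebesgue_measure R).
Implicit Types (f g h k : R -> R) (x y c p : R).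

Lemma sh_neq0 x : x != 0 -> sh x != 0.
Proof.
apply: contra_neq => s0; have := ch_sh x; rewrite s0 expr0n/= subr0 => c2.
have c1 : ch x = 1.
  by apply/eqP; rewrite -(@eqrXn2 _ 2) ?expr1n ?c2 ?(ltW (ch_gt0 x)).
have : expR x = 1.
  have : ch x + sh x = expR x by rewrite /ch /sh; field.
  by rewrite c1 s0 addr0.
by rewrite -expR0 => /expR_inj.
Qed.

Lemma cothE x : coth x = ch x / sh x.
Proof.
rewrite /coth /ch /sh; set a := _ + _; set b := _ - _.
by rewrite invfM invrK mulrACA mulVf ?mulr1.
Qed.

Lemma strip_symbol (delta th xi : R) : 0 < delta -> 0 < th < pi ->
  th / delta * intR (fun x => cos (2 * pi * (xi * x)) * K1 th (th / delta * x)) =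
  Ldx_symbol delta xi * intR (fun x => cos (2 * pi * (xi * x)) * K0 th (th / delta * x)).
Proof.
move=> d0 th_itv; have [th0 _] := andP th_itv.
have b0 : 0 < th / delta by rewrite divr_gt0.
rewrite /Ldx_symbol; have [->|xi0] := eqVneq xi 0.
  have e (G : R -> R) : (fun x => cos (2 * pi * (0 * x)) * G (th / delta * x)) = fun x => G (th / delta * x).
    by apply/funext => x; rewrite mul0r mulr0 cos0 mul1r.
  by rewrite !e -(strip_relation0 th_itv b0); field; rewrite gt_eqF.
have p0 := pi_gt0 R; have k0 : 2 * pi * xi != 0 by rewrite !mulf_neq0// gt_eqF.
have e (G : R -> R) : (fun x => cos (2 * pi * (xi * x)) * G (th / delta * x)) =
    fun x => cos (2 * pi * xi * x) * G (th / delta * x).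
  by apply/funext => x; rewrite mulrA.
rewrite !e; have := strip_relation th_itv b0 k0.
(* The scale th / delta is made for this: the hyperbolic argument no longer depends on [th] and is
   that of the symbol. *)
have -> : 2 * pi * xi / (th / delta) * th = 2 * pi * delta * xi.
  by move: (@pi R) => P; field; rewrite !gt_eqF.
have s0 : sh (2 * pi * delta * xi) != 0 by rewrite sh_neq0// !mulf_neq0// gt_eqF.
rewrite cothE; set X := intR _; set Y := intR _; set S := sh _; set C := ch _ => E.
apply: (mulIf s0); rewrite E.
have gen (a c' s y : R) : s != 0 -> a * c' * y = a * (c' / s) * y * s by move=> ?; field.
exact: gen.
Qed.

(** Evenness kills the sine part, so the translation by [p] only contributes a cas factor, the same
    one for both kernels. *)
Lemma hart_shift_even (G : R -> R) p xi : L1 G -> (forall x, G (- x) = G x) ->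
  hart (fun x => G (x - p)) xi =
  cas (2 * pi * (p * xi)) * intR (fun x => cos (2 * pi * (xi * x)) * G x).
Proof.
move=> LG Ge.
pose H x := cas (2 * pi * (xi * (x + p))) * G x.
have mtrig (t : R -> R) : continuous t -> measurable_fun setT (fun x => t (2 * pi * (xi * x))).
  move=> ct; apply: (@measurableT_comp _ _ _ _ _ _ t); first exact: continuous_measurable.
  by apply: measurable_funM => //; exact: measurable_funM.
have Lc : L1 (fun x => cos (2 * pi * (xi * x)) * G x).
  apply: (@L1_bmul _ 1) => // [|x]; last exact: cos_max.
  by apply: mtrig; exact: continuous_cos.
have Ls : L1 (fun x => sin (2 * pi * (xi * x)) * G x).
  apply: (@L1_bmul _ 1) => // [|x]; last exact: sin_max.
  by apply: mtrig; exact: continuous_sin.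
have HE : H = fun x => cas (2 * pi * (p * xi)) * (cos (2 * pi * (xi * x)) * G x) +
   cas (- (2 * pi * (p * xi))) * (sin (2 * pi * (xi * x)) * G x).
  apply/funext => x; rewrite /H.
  have -> : 2 * pi * (xi * (x + p)) = 2 * pi * (p * xi) + 2 * pi * (xi * x) by ring.
  by rewrite casD; ring.
have LH : L1 H by rewrite HE; apply: L1D; exact: L1Z.
have -> : hart (fun x => G (x - p)) xi = intR (fun x => H (x - p)).
  by rewrite /H; congr intR; apply/funext => x; rewrite subrK.
have [_ ->] := intR_shift (- p) LH.
rewrite HE intRD; [|exact: L1Z..]; rewrite !intRZ// (intR_odd Ls) ?mulr0 ?addr0//.
by move=> x; rewrite Ge !mulrN sinN mulNr.
Qed.

Lemma chN x : ch (- x) = ch x.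
Proof. by rewrite /ch opprK addrC. Qed.

Lemma cosgtN1 th : 0 < th < pi -> -1 < cos th :> R.
Proof.
move=> /andP[th0 thp]; rewrite -(cospi R) ltr_cos// in_itv/= ?lexx ?pi_ge0//.
by rewrite !ltW.
Qed.

Lemma continuous_K0 b th : 0 < th < pi -> continuous (fun x => K0 th (b * x)).
Proof.
move=> /cosgtN1 c1; eapply derive_continuous => x; apply: dfun_K0_x.
by rewrite gt_eqF// (den_gt0 _ c1).
Qed.

Lemma continuous_K1 b th : 0 < th < pi -> continuous (fun x => K1 th (b * x)).
Proof.
move=> /cosgtN1 c1; rewrite /K1; eapply derive_continuous => x.
by derive_ch; [rewrite expf_neq0// gt_eqF// (den_gt0 _ c1)|reflexivity].
Qed.

Lemma L1_K0 b th : 0 < b -> 0 < th < pi -> L1 (fun x => K0 th (b * x)).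
Proof.
move=> b0 th_itv; have c1 := cosgtN1 th_itv.
apply: (L1_le _ (L1Z ((1 + cos th) / 2)^-1 (L1_ich _))) => [||x]; last exact: K0_le.
  by apply: continuous_measurable; exact: continuous_K0.
by rewrite gt_eqF.
Qed.

Lemma L1_K1 b th : 0 < b -> 0 < th < pi -> L1 (fun x => K1 th (b * x)).
Proof.
move=> b0 th_itv; have c1 := cosgtN1 th_itv.
apply: (L1_le _ (L1Z ((((1 + cos th) / 2) ^+ 2)^-1 * 2) (L1_ich _))) => [||x]; last exact: K1_le.
  by apply: continuous_measurable; exact: continuous_K1.
by rewrite gt_eqF.
Qed.

(* The pairing of [g = L f] with [K0] equals that of [f] with the image of
   [K0], because the symbol links the two cosine transforms. *)
Lemma strip_duality (delta th p : R) k : 0 < delta -> 0 < th < pi ->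
  L1 k -> L1 (fun xi => Ldx_symbol delta xi * k xi) ->
  intR (fun x => K0 th (th / delta * (x - p)) *
    hart (fun xi => Ldx_symbol delta xi * k xi) x) =
  th / delta * intR (fun x => K1 th (th / delta * (x - p)) * hart k x).
Proof.
move=> d0 th_itv Lk Lmk; have [th0 _] := andP th_itv.
have b0 : 0 < th / delta by rewrite divr_gt0.
have [L0 _] := intR_shift (- p) (L1_K0 b0 th_itv).
have [L1' _] := intR_shift (- p) (L1_K1 b0 th_itv).
rewrite (hart_swap L0 Lmk) (hart_swap L1' Lk) -intRZ; last first.
  apply: (@L1_bmulr _ (2 * intR (fun x => `|K1 th (th / delta * (x - p))|))) => //.
    exact: measurable_hart.
  by move=> x; exact: hart_le.
congr intR; apply/funext => xi.
rewrite (@hart_shift_even (fun y => K0 th (th / delta * y)))//; last 2 first.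
- exact: L1_K0.
- by move=> x; rewrite /K0 mulrN chN.
rewrite (@hart_shift_even (fun y => K1 th (th / delta * y)))//; last 2 first.
- exact: L1_K1.
- by move=> x; rewrite /K1 mulrN chN.
have := strip_symbol xi d0 th_itv; set X := intR _; set Y := intR _ => E.
transitivity (k xi * cas (2 * pi * (p * xi)) * (Ldx_symbol delta xi * Y)); first by ring.
by rewrite -E; ring.
Qed.

End StripDuality.

(** * The limit th to pi *)

Section UniqueContinuation.
Context {R : realType}.
Local Notation mu := (@lebesgue_measure R).
Implicit Types (f g h k : R -> R) (x y c p r M delta : R).

(** In exponential variables the limit kernel is rational; this is the source of the variable z and
    of its squared resolvent. *)
Lemma chm1_exp x y : ch (x - y) - 1 = (expR x - expR y) ^+ 2 / (2 * expR x * expR y).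
Proof.
rewrite /ch opprB !expRD !expRN; have := expR_gt0 x; have := expR_gt0 y.
move: (expR x) (expR y) => a b b0 a0; field; by rewrite !gt_eqF.
Qed.

Lemma chm1_ge x : x ^+ 2 / 8 <= ch x - 1.
Proof.
wlog x0 : x / 0 <= x => [H|].
  have [/H//|/ltW x0] := leP 0 x.
  by have := H (- x); rewrite oppr_ge0 sqrrN chN; exact.
pose w := x / 2; have w0 : 0 <= w by rewrite divr_ge0.
have -> : ch x - 1 = 2 * sh w ^+ 2.
  have -> : x = w - - w by rewrite /w; field.
  rewrite chm1_exp /sh mulrAC; have E := expRxMexpNx_1 w.
  by rewrite -(mulrA 2) E mulr1; field.
have h : w / 2 <= sh w.
  rewrite /sh ler_pM2r ?invr_gt0//; have := expR_ge1Dx w.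
  have : expR (- w) <= 1 by rewrite -[leRHS]expR0 ler_expR oppr_le0.
  by lra.
have w20 : 0 <= w / 2 by rewrite divr_ge0.
have s0 := le_trans w20 h.
have : (w / 2) ^+ 2 <= sh w ^+ 2 by rewrite lerXn2r ?nnegrE.
by have -> : x = 2 * w by [rewrite /w; field]; lra.
Qed.

Lemma chm1_gt0 x : x != 0 -> 0 < ch x - 1.
Proof.
move=> x0; apply: lt_le_trans (chm1_ge x).
by rewrite divr_gt0// exprn_even_gt0.
Qed.

(** Away from the centre the denominator is at least cosh - 1, hence at least (b y)^2 / 8 whatever
    [th] is. Unlike the bounds through a lower bound on cos th, these survive th tending to pi. *)
Lemma K_tail b0 b r th y : 0 < b0 -> b0 <= b -> 0 < r -> r <= `|y| ->
  let c := (b0 ^+ 2 * r ^+ 2 / (8 * (1 + r ^+ 2)))^-1 in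
  `|K0 th (b * y)| <= (c + 2 * c ^+ 2) * (1 + y ^+ 2)^-1 /\
  `|K1 th (b * y)| <= (c + 2 * c ^+ 2) * (1 + y ^+ 2)^-1.
Proof.
move=> b00 bb r0 ry; set ka := _ / _ => /=.
have r2 : 0 < r ^+ 2 by rewrite exprn_gt0.
have ka0 : 0 < ka by rewrite divr_gt0 ?mulr_gt0 ?exprn_gt0// addr_gt0.
have yr : r ^+ 2 <= y ^+ 2 by rewrite -(real_normK (num_real y)) lerXn2r ?nnegrE ?(ltW r0).
have v0 : 0 < 1 + y ^+ 2 by rewrite ltr_pwDl// sqr_ge0.
set D := ch (b * y) + cos th.
have Dge : ka * (1 + y ^+ 2) <= D.
  apply: (@le_trans _ _ ((b * y) ^+ 2 / 8)); last first.
    by rewrite (le_trans (chm1_ge _))// lerD2l cos_geN1.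
  have bb2 : b0 ^+ 2 <= b ^+ 2 by rewrite lerXn2r ?nnegrE ?(ltW b00)// (le_trans (ltW b00)).
  rewrite /ka mulrAC ler_pdivrMr ?mulr_gt0 ?addr_gt0//.
  rewrite exprMn (_ : _ / 8 * _ = b ^+ 2 * (y ^+ 2 * (1 + r ^+ 2))); last by field.
  rewrite -mulrA; apply: ler_pM => //; rewrite ?sqr_ge0//.
    by rewrite mulr_ge0// ltW.
  by nra.
have D0 : 0 < D by apply: lt_le_trans Dge; rewrite mulr_gt0.
have Di : D^-1 <= ka^-1 * (1 + y ^+ 2)^-1.
  by rewrite -invfM lef_pV2 ?posrE; [exact: Dge|exact: D0|exact: mulr_gt0].
have ki : 0 < ka^-1 by rewrite invr_gt0.
have vi : 0 < (1 + y ^+ 2)^-1 by rewrite invr_gt0.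
have vi1 : (1 + y ^+ 2)^-1 <= 1 by rewrite invf_le1// lerDl sqr_ge0.
have Di0 : 0 < D^-1 by rewrite invr_gt0.
have B0 : D^-1 <= (ka^-1 + 2 * ka^-1 ^+ 2) * (1 + y ^+ 2)^-1.
  by rewrite (le_trans Di)// ler_wpM2r ?(ltW vi)// lerDl mulr_ge0// sqr_ge0.
split.
  rewrite /K0 -/D normrM normfV (gtr0_norm D0) (le_trans _ B0)//.
  by rewrite ler_piMl ?(ltW Di0)// sin_max.
rewrite /K1 -/D normrM normfV (ger0_norm (sqr_ge0 D)).
have num : `|cos th * ch (b * y) + 1| <= D + 2.
  have := ch_ge1 (b * y); have := cos_le1 th; have := cos_geN1 th.
  by rewrite /D ler_norml => ? ? ?; apply/andP; split; nra.
apply: (@le_trans _ _ ((D + 2) / D ^+ 2)).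
  by rewrite ler_wpM2r ?invr_ge0 ?sqr_ge0.
rewrite (_ : _ / _ = D^-1 + 2 * D^-1 ^+ 2); last by field; rewrite gt_eqF.
rewrite [leRHS]mulrDl lerD// -mulrA ler_wpM2l//.
apply: (@le_trans _ _ ((ka^-1 * (1 + y ^+ 2)^-1) ^+ 2)).
  by rewrite lerXn2r ?nnegrE ?(ltW Di0)// mulr_ge0 ?(ltW ki) ?(ltW vi).
rewrite exprMn ler_wpM2l ?sqr_ge0//.
by rewrite expr2 ler_piMr ?(ltW vi).
Qed.

(** As th tends to pi, [K0] tends to 0 because sin th does, while [K1] tends to (1 - cosh) / (cosh -
    1)^2 = -1 / (cosh - 1). The pole at [p] is screened by the vanishing of [f] and [g], and
    [K_tail] dominates the rest. *)
Lemma strip_vanish delta p r M f g : 0 < delta -> 0 < r ->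
  measurable_fun setT f -> measurable_fun setT g ->
  (forall x, `|f x| <= M) -> (forall x, `|g x| <= M) ->
  (forall x, `|x - p| < r -> f x = 0) -> (forall x, `|x - p| < r -> g x = 0) ->
  (forall th, 0 < th < pi ->
     intR (fun x => K0 th (th / delta * (x - p)) * g x) =
     th / delta * intR (fun x => K1 th (th / delta * (x - p)) * f x)) ->
  let F x := f x / (ch (pi / delta * (x - p)) - 1) in
  L1 F /\ intR F = 0.
Proof.
move=> d0 r0 mf mg fM gM f0 g0 H F.
have p0 := pi_gt0 R.
have M0 : 0 <= M := le_trans (normr_ge0 _) (fM 0).
(* The factor 1/2 keeps every angle at or above pi / 2, so the scales stay above [b0]. *)
pose th n : R := pi * (1 - 2^-1 * n.+1%:R^-1).
have n1 n : 0 < (n.+1%:R^-1 : R) <= 1.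
  by rewrite invr_gt0 ltr0n invf_le1 ?ler1n ?ltr0n.
have th_itv n : 0 < th n < pi.
  have := n1 n; rewrite /th; move: (n.+1%:R^-1 : R) => t /andP[h1 h2].
  apply/andP; split; first by rewrite mulr_gt0//; lra.
  by rewrite gtr_pMr//; lra.
have cth : th n @[n --> \oo] --> (pi : R).
  rewrite /th -[X in _ --> X]mulr1; apply: cvgM; first exact: cvg_cst.
  rewrite -[X in _ --> X](subr0 1); apply: cvgB; first exact: cvg_cst.
  rewrite -(mulr0 2^-1); apply: cvgM; [exact: cvg_cst|exact: cvg_harmonic].
pose b0 := pi / (2 * delta).
have b00 : 0 < b0 by rewrite divr_gt0// mulr_gt0.
have bb n : b0 <= th n / delta.
  have := n1 n; rewrite /b0 /th; move: (n.+1%:R^-1 : R) => t /andP[h1 h2].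
  rewrite invfM mulrA ler_wpM2r ?invr_ge0 ?(ltW d0)//.
  by rewrite ler_wpM2l ?(ltW p0)//; lra.
pose c := (b0 ^+ 2 * r ^+ 2 / (8 * (1 + r ^+ 2)))^-1.
pose G x := (c + 2 * c ^+ 2) * M * (1 + (x - p) ^+ 2)^-1.
have LG : L1 G.
  by apply: L1Z; have [] := intR_shift (- p) (@L1_inv1X2 R).
have c0 : 0 <= c + 2 * c ^+ 2.
  have c00 : 0 <= c.
    rewrite invr_ge0; apply: mulr_ge0; first by apply: mulr_ge0; exact: sqr_ge0.
    rewrite invr_ge0; apply: mulr_ge0 => //; apply: addr_ge0 => //; exact: sqr_ge0.
  by apply: addr_ge0 => //; apply: mulr_ge0 => //; exact: sqr_ge0.
have G0 x : 0 <= G x.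
  apply: mulr_ge0; first exact: mulr_ge0.
  by rewrite invr_ge0; apply: addr_ge0 => //; exact: sqr_ge0.
have dom (K : R -> R -> R) h n x : (forall x, `|h x| <= M) -> (forall x, `|x - p| < r -> h x = 0) ->
    (forall y, r <= `|y| -> `|K (th n) (th n / delta * y)| <= (c + 2 * c ^+ 2) * (1 + y ^+ 2)^-1) ->
    `|K (th n) (th n / delta * (x - p)) * h x| <= G x.
  move=> hM h0 KB; have [xr|xr] := ltP `|x - p| r.
    by rewrite h0// mulr0 normr0.
  rewrite normrM /G [leRHS]mulrAC.
  by apply: ler_pM; [exact: normr_ge0|exact: normr_ge0|exact: KB|exact: hM].
have B0 n y : r <= `|y| -> `|K0 (th n) (th n / delta * y)| <= (c + 2 * c ^+ 2) * (1 + y ^+ 2)^-1.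
  by move=> ry; have [] := K_tail (th n) b00 (bb n) r0 ry.
have B1 n y : r <= `|y| -> `|K1 (th n) (th n / delta * y)| <= (c + 2 * c ^+ 2) * (1 + y ^+ 2)^-1.
  by move=> ry; have [] := K_tail (th n) b00 (bb n) r0 ry.
have csin : sin (th n) @[n --> \oo] --> (0 : R).
  by rewrite -(sinpi R); apply: continuous_cvg cth; exact: continuous_sin.
have ccos : cos (th n) @[n --> \oo] --> (-1 : R).
  by rewrite -(cospi R); apply: continuous_cvg cth; exact: continuous_cos.
have cb : th n / delta @[n --> \oo] --> pi / delta.
  by apply: cvgM => //; exact: cvg_cst.
have cch y : ch (th n / delta * y) @[n --> \oo] --> ch (pi / delta * y).
  apply: continuous_cvg; first exact: continuous_ch.
  by apply: cvgM => //; exact: cvg_cst.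
have den y : r <= `|y| -> ch (pi / delta * y) + -1 != 0.
  move=> ry; have y0 : y != 0 by rewrite -normr_gt0 (lt_le_trans r0).
  by rewrite gt_eqF// chm1_gt0// mulf_neq0// gt_eqF// divr_gt0.
have mK0 n : measurable_fun setT (fun x => K0 (th n) (th n / delta * (x - p)) * g x).
  apply: measurable_funM => //.
  apply: (@measurableT_comp _ _ _ _ _ _ (fun y => K0 (th n) (th n / delta * y))).
    by apply: continuous_measurable; exact: continuous_K0.
  exact: measurable_funB.
have mK1 n : measurable_fun setT (fun x => K1 (th n) (th n / delta * (x - p)) * f x).
  apply: measurable_funM => //.
  apply: (@measurableT_comp _ _ _ _ _ _ (fun y => K1 (th n) (th n / delta * y))).
    by apply: continuous_measurable; exact: continuous_K1.
  exact: measurable_funB.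
have [_ lim0] : L1 (fun=> 0 : R) /\
    intR (fun x => K0 (th n) (th n / delta * (x - p)) * g x) @[n --> \oo] --> intR (fun=> 0 : R).
  apply: (dominated_intR mK0 LG).
  - move=> x; have [xr|xr] := ltP `|x - p| r.
      by rewrite g0//; under eq_fun do rewrite mulr0; exact: cvg_cst.
    rewrite -[X in _ --> X](mul0r (g x)); apply: cvgM; last exact: cvg_cst.
    rewrite -(mul0r (ch (pi / delta * (x - p)) + -1)^-1); apply: cvgM => //.
    by apply: cvgV; [exact: den|exact: cvgD].
  - by move=> n x; apply: dom => //; exact: B0.
have [LF lim1] : L1 (fun x => - F x) /\
    intR (fun x => K1 (th n) (th n / delta * (x - p)) * f x) @[n --> \oo] --> intR (fun x => - F x).
  apply: (dominated_intR mK1 LG).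
  - move=> x; have [xr|xr] := ltP `|x - p| r.
      rewrite /F f0// mul0r oppr0; under eq_fun do rewrite mulr0; exact: cvg_cst.
    have dn := den _ xr; set C := ch (pi / delta * (x - p)) in dn.
    have -> : - F x = (-1 * C + 1) / ((C + -1) * (C + -1)) * f x by rewrite /F -/C; field.
    apply: cvgM; last exact: cvg_cst.
    apply: cvgM; first by apply: cvgD; [apply: cvgM => //; exact: cch|exact: cvg_cst].
    apply: cvgV; first by rewrite mulf_neq0.
    by apply: cvgM; apply: cvgD => //; exact: cch.
  - by move=> n x; apply: dom => //; exact: B1.
have LF' : L1 F by have := L1N LF; apply: eq_L1 => x; rewrite opprK.
split=> //.
have : pi / delta * intR (fun x => - F x) = 0.
  have h1 : th n / delta * intR (fun x => K1 (th n) (th n / delta * (x - p)) * f x) @[n --> \oo]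
     --> pi / delta * intR (fun x => - F x) by exact: cvgM.
  move: lim0; rewrite intR0; under eq_fun do rewrite H//.
  by move=> lim0; apply: (@cvg_unique _ (@norm_hausdorff _ R) _ _ _ _ h1 lim0).
move/eqP; rewrite mulf_eq0 gt_eqF ?divr_gt0//= intRN// oppr_eq0 => /eqP; exact.
Qed.

End UniqueContinuation.

(** * Vanishing moments and uniqueness at a fixed time *)

Section StripUniqueness.
Context {R : realType}.
Local Notation mu := (@lebesgue_measure R).
Implicit Types (f g h k : R -> R) (x y c p r M delta : R).

Lemma expRm1_ge s y : 0 < s -> s <= `|y| -> s / (1 + s) <= `|expR y - 1|.
Proof.
move=> s0 sy.
have s1 : 0 < 1 + s by rewrite addr_gt0.
have [y0|y0] := leP 0 y.
  have ey := expR_ge1Dx y; rewrite (ger0_norm y0) in sy.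
  have : s <= `|expR y - 1| by rewrite (le_trans sy)// (le_trans _ (ler_norm _))//; lra.
  by apply: le_trans; rewrite ler_pdivrMr// ler_peMr ?(ltW s0)//; lra.
rewrite (ltr0_norm y0) in sy.
have ey : expR y <= (1 + s)^-1.
  rewrite -[y]opprK expRN lef_pV2 ?posrE ?expR_gt0//.
  by rewrite (le_trans _ (expR_ge1Dx _))// lerD2l.
rewrite distrC (le_trans _ (ler_norm _))//.
have -> : s / (1 + s) = 1 - (1 + s)^-1 by field; rewrite gt_eqF.
by rewrite lerD2l lerN2.
Qed.

Lemma strip_uniqueness delta x0 r k : 0 < delta -> 0 < r ->
  L1 k -> L1 (fun xi => Ldx_symbol delta xi * k xi) ->
  (forall x, `|x - x0| < r -> hart k x = 0) ->
  (forall x, `|x - x0| < r -> hart (fun xi => Ldx_symbol delta xi * k xi) x = 0) ->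
  forall x, hart k x = 0.
Proof.
move=> d0 r0.
(* It suffices to exclude positive values: applied to - k, this excludes negative ones as well. *)
suff main : forall k, L1 k -> L1 (fun xi => Ldx_symbol delta xi * k xi) ->
    (forall x, `|x - x0| < r -> hart k x = 0) ->
    (forall x, `|x - x0| < r -> hart (fun xi => Ldx_symbol delta xi * k xi) x = 0) ->
    forall y0, ~ 0 < hart k y0.
  move=> Lk Lmk k0 mk0 x.
  have := main k Lk Lmk k0 mk0 x.
  have Emk : (fun xi => Ldx_symbol delta xi * (-1 * k xi)) =
     fun xi => -1 * (Ldx_symbol delta xi * k xi) by apply/funext => xi; ring.
  have := main (fun xi => -1 * k xi) (L1Z _ Lk).
  rewrite Emk => /(_ (L1Z _ Lmk)) H1 H2.
  have {}H1 : ~ 0 < hart (fun xi => -1 * k xi) x.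
    by apply: H1 => z zr; rewrite hartZ// (k0, mk0)// mulr0.
  move: H1; rewrite hartZ// mulN1r oppr_gt0 => H1.
  by apply/eqP; rewrite eq_le !leNgt; apply/andP; split; apply/negP.
move=> {}k Lk Lmk k0 mk0 y0 fy0.
have p0 := pi_gt0 R.
pose f := hart k; pose g := hart (fun xi => Ldx_symbol delta xi * k xi).
pose be := pi / delta; have be0 : 0 < be by rewrite divr_gt0.
have cf : continuous f by exact: hart_continuous.
have cg : continuous g by exact: hart_continuous.
pose M := 2 * intR (fun y => `|k y|) + 2 * intR (fun y => `|Ldx_symbol delta y * k y|).
have I1 : 0 <= intR (fun y => `|k y|) by exact: intR_ge0.
have I2 : 0 <= intR (fun y => `|Ldx_symbol delta y * k y|) by exact: intR_ge0.
have fM x : `|f x| <= M by rewrite (le_trans (hart_le _ _))// /M lerDl mulr_ge0.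
have gM x : `|g x| <= M by rewrite (le_trans (hart_le _ _))// /M lerDr mulr_ge0.
have V p : `|p - x0| < r / 2 -> let F x := f x / (ch (be * (x - p)) - 1) in
    L1 F /\ intR F = 0.
  move=> pr; apply: (@strip_vanish _ delta p (r / 2) M f g) => //.
  - by rewrite divr_gt0.
  - exact: continuous_measurable.
  - exact: continuous_measurable.
  - move=> x xr; apply: k0; rewrite -(subrKA p) (le_lt_trans (ler_normD _ _))//.
    by rewrite [ltRHS]splitr ltrD.
  - move=> x xr; apply: mk0; rewrite -(subrKA p) (le_lt_trans (ler_normD _ _))//.
    by rewrite [ltRHS]splitr ltrD.
  - by move=> th th_itv; exact: strip_duality.
pose E x := expR (be * (x - x0)).
(* The cutoff removes the pole of 1 / (E - 1) at [x0], where [f] and hence [rho] vanish, so that [z]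
   is bounded. The factor 1/2 in [rho] makes it f E / (E - 1)^2. *)
pose z x := if `|x - x0| < r then 0 else (E x - 1)^-1.
pose rho x := 2^-1 * (f x / (ch (be * (x - x0)) - 1)).
have br : 0 < be * r by rewrite mulr_gt0.
have Er x : r <= `|x - x0| -> be * r / (1 + be * r) <= `|E x - 1|.
  by move=> xr; apply: expRm1_ge => //; rewrite normrM (gtr0_norm be0) ler_pM2l.
have E1 x : r <= `|x - x0| -> E x - 1 != 0.
  by move/Er => h; rewrite -normr_gt0 (lt_le_trans _ h)// divr_gt0// addr_gt0.
have Ln : L1 rho.
  by apply: L1Z; have [] := V x0 _; rewrite // subrr normr0 divr_gt0.
have mz : measurable_fun setT z.
  have -> : z = (fun x => (E x - 1)^-1) \_ (~` `]x0 - r, x0 + r[%classic).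
    apply/funext => x; rewrite patchE in_setC /z mem_setE in_itv/= -ltr_distl.
    by case: ifP.
  have mD : measurable (~` `]x0 - r, x0 + r[%classic : set R).
    by apply: measurableC; exact: measurable_itv.
  apply/(measurable_restrictT _ mD).
  apply: measurable_funTS; apply: measurable_invr.
  by apply: continuous_measurable; rewrite /E; eapply derive_continuous => x; derive_tac; reflexivity.
have zM x : `|z x| <= (be * r / (1 + be * r))^-1.
  rewrite /z; case: ltP => xr; first by rewrite normr0 invr_ge0 divr_ge0 ?addr_ge0 ?(ltW br).
  have q0 : 0 < be * r / (1 + be * r) by rewrite divr_gt0// addr_gt0.
  by rewrite normfV lef_pV2 ?posrE ?normr_gt0 ?E1// Er.
have rhoE x : r <= `|x - x0| -> rho x = f x * E x / (E x - 1) ^+ 2.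
  move=> xr; have := E1 x xr; rewrite /rho -{1}(subr0 (be * _)) chm1_exp expR0 -/(E x).
  have : E x != 0 by rewrite gt_eqF// expR_gt0.
  by move: (E x) => e e0 e1; field; rewrite e0 e1.
(* The parameter is t = exp (be (p - x0)) - 1; for |t| < t0 the centre [p] stays within r / 2 of
   [x0], so that [V] applies. *)
pose t0 := 1 - expR (- (be * (r / 2))).
have br2 : 0 < be * (r / 2) by rewrite mulr_gt0// divr_gt0.
have t00 : 0 < t0 by rewrite subr_gt0 -[ltRHS]expR0 ltr_expR oppr_lt0.
have H0 t : `|t| < t0 -> intR (fun x => rho x * (1 - z x * t) ^- 2) = 0.
  rewrite ltr_norml => /andP[t1 t2].
  pose s := be * (r / 2).
  have q1 : expR (- s) < 1 + t by move: t1; rewrite /t0 -/s; lra.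
  have q2 : 1 + t < expR s.
    (* The two ends of the range are not symmetric: the upper bound on [t] follows from the lower
       one by cosh >= 1. *)
    have : 2 <= expR s + expR (- s).
      by have := ch_ge1 s; rewrite /ch; lra.
    by move: t2; rewrite /t0 -/s; lra.
  have q0 : 0 < 1 + t by apply: lt_trans q1; exact: expR_gt0.
  pose p := x0 + ln (1 + t) / be.
  have pE : be * (p - x0) = ln (1 + t) by rewrite /p addrC addKr mulrC divfK ?gt_eqF.
  have pr : `|p - x0| < r / 2.
    rewrite -(ltr_pM2l be0) -{1}(gtr0_norm be0) -normrM pE -/s ltr_norml.
    by rewrite -ltr_expR lnK ?posrE// q1/= -ltr_expR lnK ?posrE.
  have [LV IV] := V p pr.
  (* Since 1 - z t = (E - (1 + t)) / (E - 1), moving the centre from [x0] to [p] amounts to dividing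
     by (1 - z t)^2, up to the constant 2 (1 + t). *)
  have -> : (fun x => rho x * (1 - z x * t) ^- 2) =
     fun x => (2 * (1 + t))^-1 * (f x / (ch (be * (x - p)) - 1)).
    apply/funext => x; have [xr|xr] := ltP `|x - x0| r.
      by rewrite /rho /f k0// !mul0r !mulr0 mul0r.
    rewrite rhoE// /z ltNge xr/=.
    have -> : be * (x - p) = be * (x - x0) - be * (p - x0) by ring.
    rewrite chm1_exp pE lnK ?posrE// -/(E x).
    have e0 : E x != 0 by rewrite gt_eqF// expR_gt0.
    have e1 := E1 x xr.
    have e2 : E x - (1 + t) != 0.
      rewrite subr_eq0 -[1 + t]lnK ?posrE// -pE /E; apply/eqP => /expR_inj /(mulfI (lt0r_neq0 be0)) h.
      have : x = p by apply: (addIr (- x0)).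
      by move=> xp; move: xr; rewrite xp => xr; move: pr; rewrite ltNge => /negP; apply; rewrite (le_trans _ xr)//; lra.
    have e3 : 1 - (E x - 1)^-1 * t != 0.
      have -> : 1 - (E x - 1)^-1 * t = (E x - (1 + t)) / (E x - 1) by field.
      by rewrite mulf_neq0// invr_neq0.
    have q0' : 1 + t != 0 by rewrite gt_eqF.
    have -> : 1 - (E x - 1)^-1 * t = (E x - (1 + t)) / (E x - 1) by field.
    by move: (E x) e0 e1 e2 => e e0 e1 e2; field; rewrite e0 e1 e2 q0'.
  by rewrite intRZ// IV mulr0.
have Hmom := resolvent_moments Ln mz zM t00 H0.
have yr : r <= `|y0 - x0| by rewrite leNgt; apply/negP => /k0 h; move: fy0; rewrite h ltxx.
have zy0 : z y0 = (E y0 - 1)^-1 by rewrite /z ltNge yr.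
have [d1 d10 Hd1] : exists2 d, 0 < d & forall x, `|x - y0| < d -> 0 < f x.
  have /cvgrPdist_lt /(_ _ fy0) [d /= d_gt0 dP] := cf y0.
  exists d => // x xd; have := dP x; rewrite /= distrC => /(_ xd).
  by rewrite ltr_distlC subrr => /andP[].
(* Inverse of [z] off the cutoff. Its continuity at z y0 shows that a value of [z] close to z y0 is
   taken only near [y0], or inside the cutoff, where [rho] is 0. *)
pose G w := x0 + ln (1 + w^-1) / be.
have GE x : r <= `|x - x0| -> G (z x) = x.
  move=> xr; rewrite /G /z ltNge xr/= invrK (addrC 1) subrK /E expRK.
  by rewrite mulrC mulKf ?gt_eqF// addrC subrK.
have cG : {for z y0, continuous G}.
  apply: cvgD; first exact: cvg_cst.
  apply: cvgM; last exact: cvg_cst.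
  apply: continuous_cvg.
    apply: continuous_ln.
    by rewrite zy0 invrK addrC subrK expR_gt0.
  apply: cvgD; first exact: cvg_cst.
  by apply: cvgV => //; rewrite zy0 invr_neq0// E1.
have [e e0 He] : exists2 e, 0 < e & forall w, `|w - z y0| < e -> `|G w - y0| < d1.
  have /cvgrPdist_lt /(_ _ d10) [e /= e_gt0 eP] := cG.
  exists e => // w we; have := eP w; rewrite /= distrC => /(_ we).
  by rewrite GE// distrC.
have [d2 d20 Hd2] : exists2 d, 0 < d & forall x, `|x - y0| < d -> `|(E x - 1)^-1 - z y0| < e / 2.
  have cz : {for y0, continuous (fun x => (E x - 1)^-1)}.
    apply: cvgV; first exact: E1.
    apply: cvgB; last exact: cvg_cst.
    by eapply derive_continuous => x; rewrite /E; derive_tac; reflexivity.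
  have e20 : 0 < e / 2 by rewrite divr_gt0.
  have /cvgrPdist_lt /(_ _ e20) [d /= d_gt0 dP] := cz.
  exists d => // x xd; have := dP x; rewrite /= distrC => /(_ xd).
  by rewrite -zy0 distrC.
pose d := Num.min d1 d2 / 2.
have dmin : 0 < Num.min d1 d2 by rewrite lt_min d10.
have dd0 : 0 < d by rewrite divr_gt0.
have [dd1 dd2] : d < d1 /\ d < d2.
  have h : d < Num.min d1 d2 by rewrite /d ltr_pdivrMr// ltr_pMr// ltr1n.
  by move: h; rewrite lt_min => /andP[].
have fr x : 0 < f x -> r <= `|x - x0|.
  by move=> fx; rewrite leNgt; apply/negP => /k0 h; move: fx; rewrite /f h ltxx.
have rho_pos x : 0 < f x -> 0 < rho x.
  move=> fx; have xr := fr x fx; rewrite /rho mulr_gt0// ?invr_gt0// divr_gt0// chm1_gt0//.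
  have xx : x - x0 != 0 by rewrite -normr_gt0 (lt_le_trans r0).
  by rewrite mulf_neq0// gt_eqF.
apply: (@peak _ rho z (be * r / (1 + be * r))^-1 y0 e d Ln mz zM Hmom e0 dd0).
- move=> x xe; have [xr|xr] := ltP `|x - x0| r.
    by rewrite /rho /f k0// mul0r mulr0.
  by have := He _ xe; rewrite GE// => /Hd1/rho_pos/ltW.
- move=> x xd; have fx : 0 < f x by apply: Hd1; apply: le_lt_trans dd1.
  rewrite {1}/z ltNge (fr _ fx)/= ltW//; apply: Hd2; exact: le_lt_trans dd2.
- by move=> x xd; apply: rho_pos; apply: Hd1; apply: le_lt_trans dd1.
Qed.

End StripUniqueness.

(** * Sobolev spaces and solutions *)

Section HartleyDerivative.
Context {R : realType}.
Local Notation mu := (@lebesgue_measure R).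
Implicit Types (f g h k : R -> R) (x y c p r M : R) (n : nat).

(* the Hartley multiplier of the derivative *)
Definition dh h xi : R := - (2 * pi * xi) * h (- xi).

Lemma L1_dh h : L1 (fun xi => xi * h xi) -> L1 (dh h).
Proof.
move=> Lh; have [L _] := intR_opp Lh; have := L1Z (2 * pi) L.
by apply: eq_L1 => x; rewrite /dh; ring.
Qed.

Lemma SQ_dh h : SQ (fun xi => xi * h xi) -> SQ (dh h).
Proof.
move=> Sh; have := SQZ (2 * pi) (SQ_opp Sh).
by congr SQ; apply/funext => x; rewrite /dh; ring.
Qed.

(** Differentiating cas reflects its argument; the substitution y -> - y moves the reflection onto
    [h], which is the shape of [dh]. *)
Lemma is_derive_hart h x : L1 h -> L1 (fun xi => xi * h xi) ->
  is_derive x (1 : R) (hart h) (hart (dh h) x).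
Proof.
move=> Lh Lxh.
pose F' x y := cas (- (2 * pi * (x * y))) * (2 * pi * (y * h y)).
have LF' : L1 (F' x).
  apply: (@L1_bmul _ 2) => [|y|]; last by exact: L1Z.
    apply: (@measurableT_comp _ _ _ _ _ _ cas); first exact: measurable_cas.
    by apply: measurableT_comp => //; apply: measurable_funM => //; exact: measurable_funM.
  exact: cas_le2.
have -> : hart (dh h) x = intR (F' x).
  have [_ <-] := intR_opp LF'; congr intR; apply/funext => y.
  by rewrite /F' /dh mulrN (mulrN (2 * pi)) opprK; ring.
apply: (@is_derive_intR _ (fun x y => cas (2 * pi * (x * y)) * h y) F' (x - 1) (x + 1) _
  (fun y => 2 * (2 * pi * `|y * h y|))).
- by rewrite ltrBlDr ltrDl ltr01.
- by move=> y _; exact: L1_ker.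
- by move=> z y _; rewrite /F'; derive_tac; ring.
- by apply: L1Z; apply: L1Z; exact: L1_norm.
- move=> z y _; rewrite /F' normrM; apply: ler_pM => //; first exact: cas_le2.
  by rewrite normrM ger0_norm// mulr_ge0 ?pi_ge0.
Qed.

Lemma sqr_le_norm x y : `|x| <= y -> x ^+ 2 <= y ^+ 2.
Proof.
move=> xy; rewrite -(real_normK (num_real x)) lerXn2r ?nnegrE//.
exact: le_trans xy.
Qed.

(** f(a)^2 is the integral over [a, a + 1] of the derivative of - (a + 1 - x) f(x)^2, whose weight
    vanishes at the far end. *)
Lemma sqr_le_itv f f' a : (forall x : R, is_derive x (1 : R) f (f' x)) ->
  continuous f' -> SQ f -> SQ f' ->
  f a ^+ 2 <= intR ((fun x => 2 * f x ^+ 2 + f' x ^+ 2) \_ `[a, a + 1]).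
Proof.
move=> df cf' [_ Lf] [_ Lf'].
have cf := derive_continuous df.
pose H' x := f x ^+ 2 - (a + 1 - x) * (2 * f x * f' x).
have cH' : continuous H'.
  move=> x; apply: cvgB; first by apply: cvgM; exact: cf.
  apply: cvgM; first by apply: cvgB; [exact: cvg_cst|exact: cvg_id].
  by apply: cvgM; [apply: cvgM; [exact: cvg_cst|exact: cf]|exact: cf'].
have aa : a <= a + 1 by rewrite lerDl.
have <- : intR (H' \_ `[a, a + 1]) = f a ^+ 2.
  have dH (x : R) : is_derive x (1 : R) (fun x => - ((a + 1 - x) * f x ^+ 2)) (H' x).
    by have d := df x; rewrite /H'; derive_tac; ring.
  by rewrite (FTC2_intR aa cH' dH); ring.
apply: le_intR.
- exact: continuous_L1_patch.
- by apply: L1_patch; [exact: measurable_itv|apply: L1D => //; exact: L1Z].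
- move=> x; rewrite !patchE; case: ifPn => //; rewrite inE/= in_itv/= => /andP[ax xa].
  by rewrite /H'; have := sqr_ge0 (f x + f' x); have := sqr_ge0 (f x - f' x); nra.
Qed.

Lemma cvg_intR_far f (a : nat -> R) : L1 f -> (forall n, n%:R <= `|a n|) ->
  intR (f \_ `[a n, a n + 1]) @[n --> \oo] --> 0.
Proof.
move=> Lf na; rewrite -[X in _ --> X](@intR0 R).
have mp n : measurable_fun setT (f \_ `[a n, a n + 1]).
  by apply: L1_measurable; apply: L1_patch => //; exact: measurable_itv.
apply: (dominated_intR mp (L1_norm Lf) _ _).2.
- move=> x; apply: cvg_near_cst; near=> n; rewrite patchE ifF//.
  apply/negbTE; rewrite notin_setE/= in_itv/= => /andP[h1 h2].
  have : n%:R <= `|x| + 1.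
    rewrite (le_trans (na n))// ler_norml; apply/andP; split.
      have : - `|x| <= x by rewrite lerNl -normrN ler_norm.
      by lra.
    by rewrite (le_trans h1)// (le_trans (ler_norm x))// lerDl.
  by apply/negP; rewrite -ltNge; near: n; exact: nbhs_infty_gtr.
- by move=> n x; rewrite patchE; case: ifP => // _; rewrite normr0.
Unshelve. all: end_near. Qed.

(** A function that is square integrable together with its derivative vanishes at infinity. A
    general sequence [a] covers both ends of the line. *)
Lemma cvg_at_infty f f' (a : nat -> R) : (forall x : R, is_derive x (1 : R) f (f' x)) ->
  continuous f' -> SQ f -> SQ f' -> (forall n, n%:R <= `|a n|) ->
  f (a n) @[n --> \oo] --> 0.
Proof.
move=> df cf' f2 f2' na.
have c2 : f (a n) ^+ 2 @[n --> \oo] --> 0.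
  have L : L1 (fun x => 2 * f x ^+ 2 + f' x ^+ 2).
    by apply: L1D; [apply: L1Z; case: f2|case: f2'].
  apply: cvg0_le (cvg_intR_far L na); apply: nearW => n.
  by rewrite ger0_norm ?sqr_ge0//; exact: sqr_le_itv.
have : Num.sqrt (f (a n) ^+ 2) @[n --> \oo] --> Num.sqrt 0.
  by apply: continuous_cvg c2; exact: sqrt_continuous.
rewrite sqrtr0; apply: cvg0_le; apply: nearW => n.
by rewrite sqrtr_sqr.
Qed.

Lemma L1_SQ_weight : SQ (fun x : R => (1 + x ^+ 2)^-1).
Proof.
have mw : measurable_fun setT (fun x : R => (1 + x ^+ 2)^-1) := L1_measurable (@L1_inv1X2 R).
split=> //; apply: (L1_le _ (@L1_inv1X2 R)); first exact: measurable_funX.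
move=> x; have v0 : 0 < 1 + x ^+ 2 by rewrite ltr_pwDl// sqr_ge0.
rewrite ger0_norm ?sqr_ge0// expr2 ler_piMr ?invr_ge0 ?(ltW v0)//.
by rewrite invf_le1// lerDl sqr_ge0.
Qed.

Lemma ler_norm_add3 (a b c A B C : R) : `|a| <= A -> `|b| <= B -> `|c| <= C ->
  `|a + b + c| <= A + B + C.
Proof.
move=> hA hB hC; rewrite (le_trans (ler_normD _ _))// lerD//.
by rewrite (le_trans (ler_normD _ _))// lerD.
Qed.

Lemma n2_le3 q a w d (b c : R) : SQ q -> SQ a -> SQ w -> SQ d ->
  (forall x, `|q x| <= `|a x| + b * `|w x| + c * `|d x|) ->
  n2 q <= 3 * (n2 a + b ^+ 2 * n2 w + c ^+ 2 * n2 d).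
Proof.
move=> [_ Lq] [_ La] [_ Lw] [_ Ld] H.
have Lbw := L1Z (b ^+ 2) Lw; have Lcd := L1Z (c ^+ 2) Ld; have Law := L1D La Lbw.
rewrite /n2 -(intRZ _ Lw) -(intRZ _ Ld) -(intRD La Lbw) -(intRD Law Lcd).
rewrite -(intRZ _ (L1D Law Lcd)); apply: (le_intR Lq (L1Z 3 (L1D Law Lcd))) => x.
apply: (le_trans (sqr_le_norm (H x))).
rewrite -(real_normK (num_real (a x))) -(real_normK (num_real (w x))).
rewrite -(real_normK (num_real (d x))) -!exprMn.
move: (`|a x|) (b * _) (c * _) => y z t; rewrite -subr_ge0.
have -> : 3 * (y ^+ 2 + z ^+ 2 + t ^+ 2) - (y + z + t) ^+ 2 =
  (y - z) ^+ 2 + (z - t) ^+ 2 + (y - t) ^+ 2 by ring.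
by rewrite !addr_ge0 ?sqr_ge0.
Qed.

(** Integrating by parts on [-n, n] leaves the boundary term [B n], small uniformly in xi but with
    no decay in xi. The weight [w] makes it square integrable and also absorbs the factor xi of
    [dh], so the weighted difference [q] has arbitrarily small norm. *)
Lemma hartley_derive f f' h h' : is_hartley f h -> is_hartley f' h' ->
  (forall x : R, is_derive x (1 : R) f (f' x)) -> continuous f' ->
  {ae mu, forall xi, h' xi = dh h xi}.
Proof.
move=> [f2 h2 nh ch] [f2' h2' nh' ch'] df cf'.
have cf := derive_continuous df.
pose w x : R := (1 + x ^+ 2)^-1.
have w2 : SQ w := L1_SQ_weight.
have mw : measurable_fun setT w by case: w2.
have v0 x : 0 < 1 + x ^+ 2 :> R by rewrite ltr_pwDl// sqr_ge0.
have w0 x : 0 <= w x by rewrite invr_ge0 ltW.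
have w1 x : `|w x| <= 1 by rewrite ger0_norm// invf_le1// lerDl sqr_ge0.
have wx x : `|w x * (2 * pi * x)| <= 2 * pi.
  rewrite normrM (ger0_norm (w0 x)) /w mulrC ler_pdivrMr//.
  rewrite normrM (ger0_norm (_ : 0 <= 2 * pi)) ?mulr_ge0 ?pi_ge0// ler_wpM2l ?mulr_ge0 ?pi_ge0//.
  by rewrite -(real_normK (num_real x)); have := normr_ge0 x; nra.
pose B n xi := cas (2 * pi * (xi * n%:R)) * f n%:R - cas (2 * pi * (xi * - n%:R)) * f (- n%:R).
have ibp n xi : hart (tr n f') xi = B n xi - 2 * pi * xi * hart (tr n f) (- xi).
  have nn : - n%:R <= n%:R :> R by rewrite (le_trans _ (ler0n R n))// oppr_le0.
  pose P x := cas (2 * pi * (xi * x)) * f' x + 2 * pi * xi * (cas (2 * pi * (- xi * x)) * f x).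
  have cP : continuous P.
    have cc (s : R) : continuous (fun x => cas (2 * pi * (s * x))).
      by eapply derive_continuous => x; derive_tac; reflexivity.
    move=> x; apply: cvgD; first by apply: cvgM; [exact: cc|exact: cf'].
    by apply: cvgM; [exact: cvg_cst|apply: cvgM; [exact: cc|exact: cf]].
  have dP (x : R) : is_derive x (1 : R) (fun x => cas (2 * pi * (xi * x)) * f x) (P x).
    have d := df x; rewrite /P; derive_tac.
    by rewrite (mulNr xi) (mulrN (2 * pi)); ring.
  have <- : intR (P \_ `[- n%:R, n%:R]) = B n xi by exact: FTC2_intR nn cP dP.
  rewrite /hart -intRZ; last by apply: L1_ker; exact: L1_tr.
  rewrite -intRB; last 2 first.
  - exact: continuous_L1_patch.
  - by apply: L1Z; apply: L1_ker; exact: L1_tr.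
  congr intR; apply/funext => x; rewrite /P /tr !patchE; case: ifP => _; first by ring.
  by rewrite -[point]/(0 : R); ring.
pose be n := 2 * `|f n%:R| + 2 * `|f (- n%:R)|.
have Bbe n xi : `|B n xi| <= be n.
  by rewrite (le_trans (ler_normB _ _))// !normrM lerD// ler_wpM2r// cas_le2.
have cbe : be n @[n --> \oo] --> 0.
  have c1 : `|f n%:R| @[n --> \oo] --> (0 : R).
    rewrite -(@normr0 _ R); apply: cvg_norm.
    have na n : n%:R <= `|n%:R : R| by rewrite ger0_norm.
    exact: (cvg_at_infty df cf' f2 f2' na).
  have c3 : `|f (- n%:R)| @[n --> \oo] --> (0 : R).
    rewrite -(@normr0 _ R); apply: cvg_norm.
    have na n : n%:R <= `|- n%:R : R| by rewrite normrN ger0_norm.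
    exact: (cvg_at_infty df cf' f2 f2' na).
  have -> : (0 : R) = 2 * 0 + 2 * 0 by rewrite mulr0 addr0.
  by apply: cvgD; apply: cvgM => //; exact: cvg_cst.
have mdh : measurable_fun setT (dh h).
  apply: measurable_funM; first by apply: measurableT_comp => //; exact: measurable_funM.
  by apply: measurableT_comp => //; case: h2.
have mh' : measurable_fun setT h' by case: h2'.
pose q x := w x * (h' x - dh h x).
have q2 : SQ q.
  have s1 : SQ (fun x => w x * h' x) by exact: (SQ_bmul mw w1).
  have s2 : SQ (fun x => (w x * (2 * pi * x)) * h (- x)).
    apply: (SQ_bmul _ wx); last exact: SQ_opp.
    by apply: measurable_funM => //; exact: measurable_funM.
  have := SQD s1 s2; congr SQ; apply/funext => x; rewrite /q /dh; ring.
suff E0 : n2 q = 0.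
  have := n2_eq0_ae q2 E0; apply: aeS => x /eqP.
  by rewrite mulf_eq0 gt_eqF ?invr_gt0//= subr_eq0 => /eqP.
pose U n := 3 * (n2 (fun xi => h' xi - hart (tr n f') xi) + be n ^+ 2 * n2 w +
  (2 * pi) ^+ 2 * n2 (fun xi => h xi - hart (tr n f) xi)).
have cU : U n @[n --> \oo] --> 0.
  have -> : (0 : R) = 3 * (0 + 0 * 0 * n2 w + (2 * pi) ^+ 2 * 0).
    by rewrite !mul0r !mulr0 !addr0 mulr0.
  have cb : be n ^+ 2 * n2 w @[n --> \oo] --> 0 * 0 * n2 w.
    exact: (cvgM (cvgM cbe cbe) (cvg_cst _)).
  exact: (cvgM (cvg_cst _) (cvgD (cvgD ch' cb) (cvgM (cvg_cst _) ch))).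
apply: (le_cvg0 (n2_ge0 _) _ cU).
apply: filterS2 nh nh' => n nh nh'.
have So := SQ_opp nh; have [_ n2E] := intR_opp (nh.2).
rewrite /U -[n2 (fun xi => h xi - _)]n2E.
apply: (n2_le3 q2 nh' w2 So) => x.
have -> : q x = w x * (h' x - hart (tr n f') x) + B n x * w x
    + w x * (2 * pi * x) * (h (- x) - hart (tr n f) (- x)).
  by rewrite /q /dh ibp; move: (hart (tr n f) (- x)) (pi) => *; ring.
have W := w1 x; have WX := wx x; have BX := Bbe n x.
apply: ler_norm_add3; rewrite normrM.
- by rewrite ler_piMl.
- by rewrite ler_wpM2r.
- by rewrite ler_wpM2r.
Qed.

End HartleyDerivative.

(** * Weighted bounds and growth of the symbol *)

Section SobolevWeights.
Context {R : realType}.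
Local Open Scope complex_scope.
Local Notation mu := (@lebesgue_measure R).
Implicit Types (f g h k : R -> R) (fh : R -> R[i]) (x y c p M delta : R).

(** Pointwise |h| <= wt p h^2 + wt (-p) by the inequality of means, and the second weight is
    integrable exactly because p > 1/2. *)
Lemma wt_L1 p h : 2^-1 < p -> measurable_fun setT h ->
  L1 (fun x => wt p x * h x ^+ 2) -> L1 h /\ SQ h.
Proof.
move=> p1 mh Lh; have p0 : 0 <= p by lra.
split; last first.
  split => //; apply: (L1_le _ Lh); first exact: measurable_funX.
  by move=> x; rewrite ger0_norm ?sqr_ge0// ler_peMl ?sqr_ge0// wt_ge1.
apply: (L1_le _ (L1D Lh (L1_wt p1))) => // x.
have := wtD p (- p) x; rewrite subrr [X in _ = X]/wt powRr0.
have := wt_gt0 p x; have := wt_gt0 (- p) x.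
move: (wt p x) (wt (- p) x) => a b b0 a0 ab.
have := sqr_ge0 (a * `|h x| - 1); rewrite -(real_normK (num_real (h x))).
set y := `|h x| => hy.
rewrite -(ler_pM2l a0) mulrDr ab.
have : 0 <= a * y by exact: (mulr_ge0 (ltW a0) (normr_ge0 _)).
by nra.
Qed.

(** Cauchy-Schwarz in additive form. The free parameter [e] allows the first term to be fixed small
    before the second one tends to 0. *)
Lemma wt_intR_le p h e : 2^-1 < p -> 0 < e -> measurable_fun setT h ->
  L1 (fun x => wt p x * h x ^+ 2) ->
  intR (fun x => `|h x|) <= e * intR (wt (- p)) + e^-1 * intR (fun x => wt p x * h x ^+ 2).
Proof.
move=> p1 e0 mh Lh; have [L _] := wt_L1 p1 mh Lh.
rewrite -(intRZ _ (L1_wt p1)) -(intRZ _ Lh) -intRD; [|apply: L1Z..] => //; last exact: L1_wt.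
apply: le_intR; first exact: L1_norm.
  by apply: L1D; apply: L1Z => //; exact: L1_wt.
move=> x; have := wtD p (- p) x; rewrite subrr [X in _ = X]/wt powRr0.
have := wt_gt0 p x; have := wt_gt0 (- p) x.
move: (wt p x) (wt (- p) x) => a b b0 a0 ab.
have := sqr_ge0 (a * `|h x| - e); rewrite -(real_normK (num_real (h x))).
set y := `|h x| => hy.
rewrite -(ler_pM2l (mulr_gt0 a0 e0)).
rewrite (_ : a * e * (e * b + _) = e ^+ 2 * (a * b) + (a * y) ^+ 2); last by field; rewrite gt_eqF.
rewrite ab mulr1; have : 0 <= a * y by exact: (mulr_ge0 (ltW a0) (normr_ge0 _)).
by nra.
Qed.

Lemma wt_cvg (T : Type) (F : set_system T) {FF : ProperFilter F} p (h : T -> R -> R) :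
  2^-1 < p ->
  (\forall i \near F, measurable_fun setT (h i) /\ L1 (fun x => wt p x * h i x ^+ 2)) ->
  intR (fun x => wt p x * h i x ^+ 2) @[i --> F] --> 0 ->
  intR (fun x => `|h i x|) @[i --> F] --> 0.
Proof.
move=> p1 hF h0.
have C0 : 0 <= intR (wt (- p) : R -> R) by apply: intR_ge0 => x; rewrite ltW ?wt_gt0.
apply/cvgr0Pnorm_le => e e0.
pose a := e / (2 * (intR (wt (- p) : R -> R) + 1)).
have C1 : 0 < intR (wt (- p) : R -> R) + 1 by rewrite ltr_wpDl.
have a0 : 0 < a by rewrite divr_gt0// mulr_gt0.
have ae : 0 < a * (e / 2) by rewrite mulr_gt0// divr_gt0.
have := @cvgr0_norm_le _ _ _ F FF _ h0 _ ae.
apply: filterS2 hF => i [mh Lh] hi.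
rewrite ger0_norm; last by apply: intR_ge0.
apply: (le_trans (wt_intR_le p1 a0 mh Lh)).
rewrite [leRHS]splitr lerD//.
  rewrite /a mulrAC ler_pdivrMr ?mulr_gt0//.
  rewrite (_ : e / 2 * _ = e * (intR (wt (- p)) + 1)); last by field.
  by rewrite ler_wpM2l ?(ltW e0)// lerDl.
rewrite ler_pdivrMl//; apply: le_trans hi; exact: ler_norm.
Qed.

Lemma weighted_norm_L1 p fh : L2C fh -> (weighted_norm p fh < +oo)%E ->
  L1 (fun x => wt p x * hof fh x ^+ 2) /\
  intR (fun x => wt p x * hof fh x ^+ 2) <= 2 * fine (weighted_norm p fh) ^+ 2.
Proof.
move=> fh2 wy; have [/L2_SQ[mr _] /L2_SQ[mi _]] := fh2.
pose N x := wt p x * normc2 (fh x).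
have N0 x : 0 <= N x by rewrite mulr_ge0 ?normc2_ge0// ltW ?wt_gt0.
have mN : measurable_fun setT N.
  by apply: measurable_funM; [exact: measurable_wt|exact: measurable_normc2].
have wE : weighted_norm p fh = ((\int[mu]_x (N x)%:E) `^ 2^-1)%E by [].
have LN : L1 N.
  by apply: L1_ge0_lty => //; move: wy; rewrite wE; apply: lty_poweRy; rewrite invr_eq0.
have IN : 0 <= intR N by exact: intR_ge0.
have -> : fine (weighted_norm p fh) ^+ 2 = intR N.
  by rewrite wE -EFin_intR// poweR12_sqrt ?lee_fin//= sqr_sqrtr.
have le x : wt p x * hof fh x ^+ 2 <= 2 * N x.
  by rewrite /N [leRHS]mulrCA ler_wpM2l ?hof_sqr_le// ltW ?wt_gt0.
have L : L1 (fun x => wt p x * hof fh x ^+ 2).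
  apply: (L1_le _ (L1Z 2 LN)).
    apply: measurable_funM; first exact: measurable_wt.
    by apply: measurable_funX; exact: SQ_measurable (L2C_hof fh2).
  by move=> x; rewrite ger0_norm ?le// mulr_ge0 ?sqr_ge0// ltW ?wt_gt0.
split => //; rewrite -intRZ//; apply: le_intR => //; exact: L1Z.
Qed.

Lemma is_fourier_L2C f fh : is_fourier f fh -> L2C fh.
Proof. by case. Qed.

Lemma sobolev_hartley p f : sobolev p f -> is_fourier f (fourier f).
Proof. by move=> [fh ffh _]; exact: fourierP ffh. Qed.

Lemma ae_eq_normc2 f fh gh : is_fourier f fh -> is_fourier f gh ->
  {ae mu, forall x, hof fh x = hof gh x}.
Proof. by move=> h1 h2; apply: (hartley_unique (fourier_hartley h1) (fourier_hartley h2)). Qed.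

(** The norm is computed from the transform that [fourier] selects for [f i]. For a difference of
    functions one wants the difference of the selected transforms instead, which agrees with it only
    almost everywhere. *)
Lemma sobolev_cvg (T : Type) (F : set_system T) {FF : ProperFilter F} p
    (f : T -> R -> R) (fh : T -> R -> R[i]) :
  (\forall i \near F, is_fourier (f i) (fh i)) ->
  sobolev_norm p (f i) @[i --> F] --> 0%E ->
  (\forall i \near F, L1 (fun x => wt p x * hof (fh i) x ^+ 2)) /\
  intR (fun x => wt p x * hof (fh i) x ^+ 2) @[i --> F] --> 0.
Proof.
move=> ffh /fine_cvgP[fin cv].
have H : \forall i \near F, L1 (fun x => wt p x * hof (fh i) x ^+ 2) /\
    intR (fun x => wt p x * hof (fh i) x ^+ 2) <= 2 * fine (sobolev_norm p (f i)) ^+ 2.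
  apply: filterS2 ffh fin => i ffh /fin_numPlt/andP[_ fy].
  have ff := fourierP ffh.
  have [L I] := weighted_norm_L1 (is_fourier_L2C ff) fy.
  have ae := ae_eq_normc2 ff ffh.
  have m1 := SQ_measurable (L2C_hof (is_fourier_L2C ff)).
  have m2 := SQ_measurable (L2C_hof (is_fourier_L2C ffh)).
  have mm h : measurable_fun setT h -> measurable_fun setT (fun x => wt p x * h x ^+ 2).
    by move=> mh; apply: measurable_funM; [exact: measurable_wt|exact: measurable_funX].
  have ae' : {ae mu, forall x, wt p x * hof (fourier (f i)) x ^+ 2 = wt p x * hof (fh i) x ^+ 2}.
    by apply: aeS ae => x ->.
  split; first by apply: ae_eq_L1 ae' L; exact: mm.
  by rewrite -(ae_eq_intR (mm _ m1) (mm _ m2) ae').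
split; first by apply: filterS H => i [].
have cv2 : 2 * fine (sobolev_norm p (f i)) ^+ 2 @[i --> F] --> 0.
  have -> : (0 : R) = 2 * (0 * 0) by rewrite !mulr0.
  by apply: cvgM; [exact: cvg_cst|exact: (cvgM cv cv)].
apply: cvg0_le cv2; apply: filterS H => i [L I].
rewrite ger0_norm//; apply: intR_ge0 => x.
by rewrite mulr_ge0 ?sqr_ge0// ltW ?wt_gt0.
Qed.

Section Symbol.
Context (delta : R) (delta_gt0 : 0 < delta).

Lemma Ldx_symbolN xi : Ldx_symbol delta (- xi) = Ldx_symbol delta xi.
Proof.
rewrite /Ldx_symbol oppr_eq0; case: ifP => // _.
rewrite !cothE !mulrN mulNr chN (_ : sh (- _) = - sh (2 * pi * delta * xi)).
  by rewrite invrN !mulrN opprK.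
by rewrite /sh opprK; ring.
Qed.

Lemma measurable_Ldx_symbol : measurable_fun setT (Ldx_symbol delta).
Proof.
(* At 0 the product vanishes, and the indicator restores the value 1 / delta. *)
have -> : Ldx_symbol delta = fun xi => 2 * pi * xi * (ch (2 * pi * delta * xi) * (sh (2 * pi * delta * xi))^-1)
    + delta^-1 * \1_[set 0] xi.
  apply/funext => xi; rewrite /Ldx_symbol indicE.
  have [->|xi0] := eqVneq xi 0; first by rewrite !mulr0 mul0r add0r mem_set// mulr1.
  by rewrite memNset ?mulr0 ?addr0 ?cothE//=; apply/eqP.
have mlin : measurable_fun setT (fun xi : R => 2 * pi * delta * xi) by exact: measurable_funM.
apply: measurable_funD; last by apply: measurable_funM => //; exact: measurable_indic.
apply: measurable_funM; first exact: measurable_funM.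
apply: measurable_funM.
  by apply: (@measurableT_comp _ _ _ _ _ _ ch) => //; apply: continuous_measurable; exact: continuous_ch.
apply: measurable_invr; apply: (@measurableT_comp _ _ _ _ _ _ sh) => //.
by apply: continuous_measurable; eapply derive_continuous => x; apply: dfun_sh; exact: dfun_id.
Qed.

Lemma Ldx_symbol_le xi : `|Ldx_symbol delta xi| <= delta^-1 + 2 * pi * `|xi|.
Proof.
wlog x0 : xi / 0 <= xi => [H|].
  have [/H//|/ltW x0] := leP 0 xi.
  by have := H (- xi); rewrite oppr_ge0 Ldx_symbolN normrN => /(_ x0).
have di : 0 < delta^-1 by rewrite invr_gt0.
have p0 := pi_gt0 R.
rewrite /Ldx_symbol; case: eqVneq => [->|xi0].
  by rewrite normr0 mulr0 addr0 gtr0_norm.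
have xp : 0 < xi by rewrite lt_neqAle eq_sym xi0.
pose y := 2 * pi * delta * xi; have y0 : 0 < y by rewrite !mulr_gt0.
have sy : 0 < sh y.
  by rewrite /sh divr_gt0// subr_gt0 ltr_expR; lra.
(* This is y coth y <= 1 + y, which reduces to 2 y <= exp (2 y) - 1. *)
have key : y * ch y <= (1 + y) * sh y.
  have -> : ch y = sh y + expR (- y) by rewrite /ch /sh; field.
  have : y * expR (- y) <= sh y.
    have e0 := expR_gt0 y; rewrite -(ler_pM2r e0) -mulrA expRN mulVf ?gt_eqF// mulr1.
    have := expR_ge1Dx (2 * y); rewrite mulr2n mulrDl mul1r expRD /sh mulrAC.
    by rewrite expRN; have : expR y * (expR y)^-1 = 1 by [rewrite mulfV ?gt_eqF]; nra.
  by nra.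
have E : 2 * pi * xi = y / delta by rewrite /y (mulrAC _ delta xi) mulfK// gt_eqF.
rewrite cothE -/y (ger0_norm x0) E.
have c0 := ch_gt0 y.
rewrite ger0_norm; last first.
  by apply: mulr_ge0; apply: divr_ge0; exact: ltW.
rewrite (_ : y / delta * (ch y / sh y) = (y * ch y / sh y) / delta); last by ring.
rewrite (_ : delta^-1 + y / delta = (1 + y) / delta); last by ring.
by rewrite ler_wpM2r ?(ltW di)// ler_pdivrMr.
Qed.

(** Transform of the dispersive term (L_delta d_x)(d_x f), where [h] is the transform of f. *)
Definition Lh h xi : R := Ldx_symbol delta xi * dh h xi.

(* [1 + xi^2] times the transform: a function of H^s becomes one of H^(s-2) *)
Definition q2h h xi : R := (1 + xi ^+ 2) * h xi.

Lemma le_1X2 x : `|x| <= 1 + x ^+ 2.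
Proof. by rewrite -(real_normK (num_real x)); have := normr_ge0 x; nra. Qed.

Lemma v_gt0 x : 0 < 1 + x ^+ 2.
Proof. by rewrite ltr_pwDl// sqr_ge0. Qed.

Lemma q2h_bmul (a : R -> R) M h : measurable_fun setT a ->
  (forall x, `|a x| <= M * (1 + x ^+ 2)) -> L1 (q2h h) -> SQ (q2h h) ->
  L1 (fun x => a x * h x) /\ SQ (fun x => a x * h x).
Proof.
move=> ma aM L S.
pose b x := a x * (1 + x ^+ 2)^-1.
have mb : measurable_fun setT b.
  by apply: measurable_funM => //; exact: L1_measurable (@L1_inv1X2 R).
have bM x : `|b x| <= M.
  by rewrite normrM normfV (gtr0_norm (v_gt0 x)) ler_pdivrMr ?v_gt0.
have E : (fun x => a x * h x) = fun x => b x * q2h h x.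
  by apply/funext => x; rewrite /b /q2h; field; rewrite gt_eqF ?v_gt0.
by rewrite E; split; [exact: (L1_bmul mb bM)|exact: (SQ_bmul mb bM)].
Qed.

Lemma q2h_id h : L1 (q2h h) -> SQ (q2h h) -> L1 h /\ SQ h.
Proof.
move=> L S; have [] := @q2h_bmul (fun=> 1) 1 h _ _ L S => //.
  by move=> x; rewrite normr1 mul1r lerDl sqr_ge0.
by under eq_fun do rewrite mul1r.
Qed.

Lemma q2h_mulx h : L1 (q2h h) -> SQ (q2h h) ->
  L1 (fun x => x * h x) /\ SQ (fun x => x * h x).
Proof.
move=> L S; apply: (@q2h_bmul (fun x => x) 1 h _ _ L S) => //.
by move=> x; rewrite mul1r le_1X2.
Qed.

Lemma q2h_Lh h : L1 (q2h h) -> SQ (q2h h) -> L1 (Lh h) /\ SQ (Lh h).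
Proof.
move=> L S; have p0 := pi_gt0 R; have di : 0 < delta^-1 by rewrite invr_gt0.
pose a x := Ldx_symbol delta x * (2 * pi * x).
have ma : measurable_fun setT a.
  by apply: measurable_funM; [exact: measurable_Ldx_symbol|exact: measurable_funM].
have aM x : `|a x| <= (2 * pi * (delta^-1 + 2 * pi)) * (1 + x ^+ 2).
  rewrite /a normrM (normrM (2 * pi)) (ger0_norm (_ : 0 <= 2 * pi)) ?mulr_ge0 ?(ltW p0)//.
  rewrite mulrCA -(mulrA (2 * pi)) ler_wpM2l ?mulr_ge0 ?(ltW p0)//.
  apply: (@le_trans _ _ ((delta^-1 + 2 * pi * `|x|) * `|x|)).
    by rewrite ler_wpM2r// Ldx_symbol_le.
  have := le_1X2 x; rewrite -(real_normK (num_real x)).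
  have := normr_ge0 x; move: `|x| (pi) p0 (delta^-1) di => y P P0 d d0 y0 y1.
  rewrite (mulrDl d) (mulrDl d) lerD ?ler_wpM2l ?(ltW d0)//.
  by rewrite -(mulrA _ y) ler_wpM2l ?mulr_ge0 ?(ltW P0)// -expr2 lerDr.
have [La Sa] := q2h_bmul ma aM L S.
have E : Lh h = fun x => (fun y => a y * h y) (- x).
  by apply/funext => x; rewrite /Lh /dh /a Ldx_symbolN; move: (Ldx_symbol _ _) (pi) => *; ring.
by rewrite E; split; [have [] := intR_opp La|exact: (SQ_opp Sa)].
Qed.

(** The place where s > 5/2 acts: [q2h h] has finite weighted norm of order s - 2 > 1/2, hence is
    integrable. *)
Lemma q2h_wt s h : 5 / 2 < s -> measurable_fun setT h ->
  L1 (fun x => wt s x * h x ^+ 2) ->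
  [/\ L1 (q2h h), SQ (q2h h), measurable_fun setT (q2h h),
     L1 (fun x => wt (s - 2) x * q2h h x ^+ 2) &
     intR (fun x => wt (s - 2) x * q2h h x ^+ 2) = intR (fun x => wt s x * h x ^+ 2)].
Proof.
move=> s5 mh L.
have mq : measurable_fun setT (q2h h).
  by apply: measurable_funM => //; apply: measurable_funD => //; exact: measurable_funX.
have E : (fun x => wt (s - 2) x * q2h h x ^+ 2) = fun x => wt s x * h x ^+ 2.
  apply/funext => x; rewrite /q2h exprMn mulrA -[in LHS]wt1 expr2 wtD wtD.
  by congr (wt _ _ * _); ring.
have L' : L1 (fun x => wt (s - 2) x * q2h h x ^+ 2) by rewrite E.
have s2 : 2^-1 < s - 2 by lra.
have [L1q Sq] := wt_L1 s2 mq L'.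
by split => //; rewrite E.
Qed.

End Symbol.

End SobolevWeights.

(** * Transforms of solutions as functions of time *)

Section Solutions.
Context {R : realType}.
Local Open Scope complex_scope.
Local Notation mu := (@lebesgue_measure R).
Implicit Types (f g k : R -> R) (fh gh : R -> R[i]) (x y t c p M delta : R).

Lemma hofB fh gh : hof (fun x => fh x - gh x) = fun x => hof fh x - hof gh x.
Proof. by apply/funext => x; rewrite /hof ReB ImB; ring. Qed.

Lemma hofZ (m : R -> R) fh : hof (fun x => (m x)%:C * fh x) = fun x => m x * hof fh x.
Proof. by apply/funext => x; rewrite /hof ReZ ImZ; ring. Qed.

Lemma n2_wt p f : 0 <= p -> measurable_fun setT f -> L1 (fun x => wt p x * f x ^+ 2) ->
  n2 f <= intR (fun x => wt p x * f x ^+ 2).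
Proof.
move=> p0 mh L.
have le x : f x ^+ 2 <= wt p x * f x ^+ 2 by rewrite ler_peMl ?sqr_ge0// wt_ge1.
apply: le_intR => //; apply: (L1_le _ L); first exact: measurable_funX.
by move=> x; rewrite ger0_norm ?sqr_ge0.
Qed.

Lemma sobolev_L1 p f : sobolev p f -> L1 (fun x => wt p x * hof (fourier f) x ^+ 2).
Proof.
move=> [fh ffh fy]; have ff := fourierP ffh.
have [L _] := weighted_norm_L1 (is_fourier_L2C ffh) fy.
have m1 := SQ_measurable (L2C_hof (is_fourier_L2C ff)).
have mm (h : R -> R) : measurable_fun setT h -> measurable_fun setT (fun x => wt p x * h x ^+ 2).
  by move=> mh; apply: measurable_funM; [exact: measurable_wt|exact: measurable_funX].
apply: (ae_eq_L1 (mm _ m1) _ L).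
by apply: aeS (ae_eq_normc2 ffh ff) => x ->.
Qed.

Lemma is_derive_derive1 f (a : R) x : is_derive x (1 : R) f a -> derive1 f x = a.
Proof. by move=> d; rewrite derive1E derive_val. Qed.

Lemma near0_itv (T t : R) : t \in `]0, T[ -> \forall h \near (0 : R)^', t + h \in `]0, T[.
Proof.
move=> tT; apply: nbhs_dnbhs.
have c : t + h @[h --> 0] --> t.
  by rewrite -[X in _ --> X]addr0; apply: cvgD; [exact: cvg_cst|exact: cvg_id].
exact: (c _ (near_in_itvoo tT)).
Qed.

Section Solution.
Context (delta T s : R) (delta_gt0 : 0 < delta) (s_gt : 5 / 2 < s).
Context (u : R -> R -> R) (sol : ILW_solution delta T s u).

Let hs t := hof (fourier (u t)).

Lemma solution_space t : t \in `[0, T] ->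
  [/\ is_hartley (u t) (hs t), L1 (q2h (hs t)), SQ (q2h (hs t)) & u t = hart (hs t)].
Proof.
move=> tT; have [C0 _ [cu _]] := sol; have [st _] := C0 _ tT.
have ff := sobolev_hartley st; have hf := fourier_hartley ff.
have ms := SQ_measurable (L2C_hof (is_fourier_L2C ff)).
have [Lq Sq _ _ _] := q2h_wt s_gt ms (sobolev_L1 st).
have [Lh _] := q2h_id Lq Sq.
by split => //; apply: (hartley_inversion hf Lh (cu _ tT)).
Qed.

Lemma solution_cvg t : t \in `[0, T] ->
  intR (fun x => `|q2h (hs r) x - q2h (hs t) x|) @[r --> within `[0, T] (nbhs t)] --> 0.
Proof.
move=> tT; have [C0 _ _] := sol; have [st cv] := C0 _ tT.
have FF : ProperFilter (within `[0, T] (nbhs t)).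
  by apply: within_nbhs_proper; exact: subset_closure.
have ff : \forall r \near within `[0, T] (nbhs t),
    is_fourier (u r - u t) (fun x => fourier (u r) x - fourier (u t) x).
  near=> r; apply: is_fourierB; last exact: (sobolev_hartley st).
  have rT : `[0, T]%classic r by near: r; exact: withinT.
  by have [/sobolev_hartley] := C0 _ rT.
have [Ln cn] := sobolev_cvg ff cv.
have s2 : 2^-1 < s - 2 by move: s_gt; lra.
have E r x : q2h (hs r) x - q2h (hs t) x =
    q2h (hof (fun x => fourier (u r) x - fourier (u t) x)) x.
  by rewrite (hofB (fourier (u r)) (fourier (u t))) /q2h -mulrBr.
under eq_fun do under eq_fun do rewrite E.
apply: (@wt_cvg _ _ _ FF (s - 2)) => //.
  apply: filterS2 Ln ff => r Lr /is_fourier_L2C/L2C_hof/SQ_measurable mr.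
  by have [_ _ ? ? _] := q2h_wt s_gt mr Lr.
apply: cvg_trans cn; apply: near_eq_cvg.
apply: filterS2 Ln ff => r Lr /is_fourier_L2C/L2C_hof/SQ_measurable mr.
by have [_ _ _ _ ->] := q2h_wt s_gt mr Lr.
Unshelve. all: by end_near. Qed.

(** The H^(s-2) limit gives two convergences of the quotients: in L^2 for the energy identity, and
    in L^1, again by s - 2 > 1/2, for the pointwise equation. *)
Lemma solution_derivative : exists hv : R -> R -> R, forall t, t \in `]0, T[ ->
  let D (h : R) x := h^-1 * (hs (t + h) x - hs t x) in
  [/\ L1 (hv t), SQ (hv t),
     \forall h \near 0^', L1 (fun x => D h x - hv t x) /\ SQ (fun x => D h x - hv t x),
     n2 (fun x => D h x - hv t x) @[h --> 0^'] --> 0 &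
     intR (fun x => `|D h x - hv t x|) @[h --> 0^'] --> 0].
Proof.
have [_ [C1 [v C0 cv]] _] := sol.
have s2 : 2^-1 < s - 2 by move: s_gt; lra.
exists (fun t => hof (fourier (v t))) => t tT D.
have [stv _] := C0 _ tT; have fv := sobolev_hartley stv.
have fu := sobolev_hartley (C1 _ tT).
have mv := SQ_measurable (L2C_hof (is_fourier_L2C fv)).
have [Lv Sv] := wt_L1 s2 mv (sobolev_L1 stv).
have ff : \forall h \near (0 : R)^',
    is_fourier (h^-1 *: (u (t + h) - u t) - v t)
      (fun x => (h^-1)%:C * (fourier (u (t + h)) x - fourier (u t) x) - fourier (v t) x).
  apply: filterS (near0_itv tT) => h hT; have fh := sobolev_hartley (C1 _ hT).
  exact: (is_fourierB (is_fourierZ h^-1 (is_fourierB fh fu)) fv).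
have [Ln cn] := sobolev_cvg ff (cv _ tT).
have E (h : R) : hof (fun x => (h^-1)%:C * (fourier (u (t + h)) x - fourier (u t) x) - fourier (v t) x)
    = fun x => D h x - hof (fourier (v t)) x.
  rewrite (hofB (fun x => (h^-1)%:C * (fourier (u (t + h)) x - fourier (u t) x)) (fourier (v t))).
  rewrite (hofZ (fun=> h^-1) (fun x => fourier (u (t + h)) x - fourier (u t) x)).
  by rewrite (hofB (fourier (u (t + h))) (fourier (u t))).
have S : \forall h \near (0 : R)^', [/\ measurable_fun setT (fun x => D h x - hof (fourier (v t)) x),
    L1 (fun x => wt (s - 2) x * (D h x - hof (fourier (v t)) x) ^+ 2),
    L1 (fun x => D h x - hof (fourier (v t)) x) & SQ (fun x => D h x - hof (fourier (v t)) x)].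
  apply: filterS2 Ln ff => h Lh /is_fourier_L2C/L2C_hof/SQ_measurable.
  move: Lh; rewrite E => Lh mh.
  by have [? ?] := wt_L1 s2 mh Lh.
have cn' : intR (fun x => wt (s - 2) x * (D h x - hof (fourier (v t)) x) ^+ 2) @[h --> 0^'] --> 0.
  rewrite (_ : (fun h => intR _) = fun h : R => intR (fun x => wt (s - 2) x * hof (fun x =>
    (h^-1)%:C * (fourier (u (t + h)) x - fourier (u t) x) - fourier (v t) x) x ^+ 2)); first exact: cn.
  by apply/funext => h; rewrite E.
split => //.
- by apply: filterS S => h [].
- apply: cvg0_le cn'; apply: filterS S => h [mh Lh _ _].
  by rewrite ger0_norm ?n2_ge0//; apply: n2_wt => //; lra.
- by apply: (@wt_cvg _ _ _ _ (s - 2)) cn' => //; apply: filterS S => h [].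
Qed.

End Solution.
End Solutions.

(** * The equation on the transform side *)

Section SolutionFacts.
Context {R : realType}.
Local Open Scope complex_scope.
Local Notation mu := (@lebesgue_measure R).
Implicit Types (f g k : R -> R) (fh gh : R -> R[i]) (x y t c p M delta : R).

Lemma hart_quotient c f g k x : L1 f -> L1 g -> L1 k ->
  hart (fun y => c * (f y - g y) - k y) x = c * (hart f x - hart g x) - hart k x.
Proof.
move=> Lf Lg Lk; have Lfg := L1B Lf Lg.
by rewrite (hartB x (L1Z c Lfg) Lk) (hartZ c x Lfg) (hartB x Lf Lg).
Qed.

(** [is_Ldx] provides some transform of the derivative; [hartley_derive] identifies it with [dh k]
    almost everywhere. As [Lh delta k] is integrable and [g] continuous, inversion then determines
    [g] at every point. *)
Lemma Ldx_hart delta f g k : 0 < delta -> L1 (q2h k) -> SQ (q2h k) -> is_hartley f k ->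
  (forall x, is_derive x (1 : R) f (hart (dh k) x)) -> continuous g ->
  is_Ldx delta (hart (dh k)) g -> SQ (hart (dh k)) /\ g = hart (Lh delta k).
Proof.
move=> d0 Lq Sq hf df cg [fh ff fg].
have [Lx Sx] := q2h_mulx Lq Sq.
have hf' := fourier_hartley ff; have hg := fourier_hartley fg.
have cf' : continuous (hart (dh k)) by apply: hart_continuous; exact: L1_dh.
have ae := hartley_derive hf hf' df cf'.
rewrite (hofZ (Ldx_symbol delta) fh) in hg.
have [S _ _ _] := hf'; split => //.
have [LL SL] := q2h_Lh d0 Lq Sq.
have mg : measurable_fun setT (fun x => Ldx_symbol delta x * hof fh x).
  by have [_ ? _ _] := hg; exact: SQ_measurable.
have ae' : {ae mu, forall x, Lh delta k x = Ldx_symbol delta x * hof fh x}.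
  by apply: aeS ae => x ->.
rewrite (ae_eq_hart (SQ_measurable SL) mg ae').
by apply: hartley_inversion => //; exact: ae_eq_L1 ae' LL.
Qed.

(* [hs t] and [hv t] are the Hartley transforms of [u t] and of its time derivative. *)
Definition ILW_transform delta T (u hs hv : R -> R -> R) : Prop :=
  (forall t, t \in `[0, T] ->
    [/\ is_hartley (u t) (hs t), L1 (q2h (hs t)), SQ (q2h (hs t)), u t = hart (hs t) &
      intR (fun x => `|q2h (hs r) x - q2h (hs t) x|)
        @[r --> within `[0, T] (nbhs t)] --> 0]) /\
  (forall t, t \in `]0, T[ ->
    [/\ L1 (hv t), SQ (hv t),
      \forall h \near (0 : R)^', SQ (fun x => h^-1 * (hs (t + h) x - hs t x) - hv t x) &
      n2 (fun x => h^-1 * (hs (t + h) x - hs t x) - hv t x) @[h --> 0^'] --> 0] /\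
    [/\ forall x, derive1 (u^~ x) t = hart (hv t) x,
      SQ (hart (dh (hs t))) &
      forall x, hart (hv t) x = hart (Lh delta (hs t)) x
        - delta^-1 * hart (dh (hs t)) x - u t x * hart (dh (hs t)) x]).

Lemma solution_facts delta T s (u : R -> R -> R) : 0 < delta -> 5 / 2 < s ->
  ILW_solution delta T s u -> exists hs hv, ILW_transform delta T u hs hv.
Proof.
move=> d0 s5 sol.
have [hs [hv [Hs Hv]]] : exists hs hv : R -> R -> R, (forall t, t \in `[0, T] ->
    [/\ is_hartley (u t) (hs t), L1 (q2h (hs t)), SQ (q2h (hs t)), u t = hart (hs t) &
      intR (fun x => `|q2h (hs r) x - q2h (hs t) x|)
        @[r --> within `[0, T] (nbhs t)] --> 0]) /\
  (forall t, t \in `]0, T[ ->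
   let D (h : R) x := h^-1 * (hs (t + h) x - hs t x) in
  [/\ L1 (hv t), SQ (hv t),
     \forall h \near 0^', L1 (fun x => D h x - hv t x) /\ SQ (fun x => D h x - hv t x),
     n2 (fun x => D h x - hv t x) @[h --> 0^'] --> 0 &
     intR (fun x => `|D h x - hv t x|) @[h --> 0^'] --> 0]).
  exists (fun t => hof (fourier (u t))).
  have [hv Hv] := solution_derivative s5 sol; exists hv; split => // t tT.
  have [h1 h2 h3 h4] := solution_space s5 sol tT.
  by split => //; exact: (solution_cvg s5 sol tT).
exists hs, hv; split => // t tT; have [Lv Sv nv n2v iv] := Hv t tT.
have sub r : r \in `]0, T[ -> r \in `[0, T].
  by rewrite !in_itv/= => /andP[/ltW -> /ltW ->].
split; first by split => //; apply: filterS nv => h [].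
have hart_hs r x : r \in `]0, T[ -> L1 (hs r) /\ u r x = hart (hs r) x.
  move=> /sub rT; have [_ L S -> _] := Hs _ rT.
  by have [? _] := q2h_id L S.
have dt x : derive1 (u^~ x) t = hart (hv t) x.
  rewrite /derive1; apply: cvg_lim; first exact: norm_hausdorff.
  apply/subr_cvg0.
  (* By [hart_le], L^1 convergence of transforms is uniform convergence in x, so the derivative in
     the Sobolev sense is also the pointwise one. *)
  have c2 : 2 * intR (fun x => `|h^-1 * (hs (t + h) x - hs t x) - hv t x|) @[h --> (0 : R)^'] --> 0.
    by rewrite -[X in _ --> X](mulr0 2); apply: cvgM; [exact: cvg_cst|exact: iv].
  apply: cvg0_le c2; apply: filterS2 nv (near0_itv tT) => h [LD _] hT.
  have [L1h E1] := hart_hs _ x hT; have [L0 E0] := hart_hs _ x tT.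
  have := hart_le x LD; rewrite (hart_quotient h^-1 x L1h L0 Lv) -E1 -E0.
  by rewrite [t + h]addrC.
have [hf Lq Sq E _] := Hs _ (sub _ tT).
have [L S] := q2h_id Lq Sq; have [Lx Sx] := q2h_mulx Lq Sq.
have df (x : R) : is_derive x (1 : R) (u t) (hart (dh (hs t)) x).
  by rewrite E; exact: is_derive_hart.
have dE : derive1 (u t) = hart (dh (hs t)).
  by apply/funext => x; exact: is_derive_derive1.
have [_ _ [_ eqn]] := sol; have [g [cg Lg eg]] := eqn _ tT.
rewrite dE in Lg eg.
have [SS gE] := Ldx_hart d0 Lq Sq hf df cg Lg.
split => // x; have := eg x; rewrite dt gE.
move: (hart (hv t) x) (hart (Lh _ _) x) (hart (dh _) x) => a b c.
by move=> e; lra.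
Qed.

End SolutionFacts.

(** * Energy estimate and uniqueness in time *)

Section EnergyEstimate.
Context {R : realType}.
Local Notation mu := (@lebesgue_measure R).
Implicit Types (f g h k u v w : R -> R) (x y t c p M K delta : R) (n : nat).

Lemma n2_cvgB (S : Type) (F : set_system S) {FF : ProperFilter F} (A B : S -> R -> R) :
  (\forall i \near F, SQ (A i)) -> (\forall i \near F, SQ (B i)) ->
  n2 (A i) @[i --> F] --> 0 -> n2 (B i) @[i --> F] --> 0 ->
  (\forall i \near F, SQ (fun x => A i x - B i x)) /\
  n2 (fun x => A i x - B i x) @[i --> F] --> 0.
Proof.
move=> nA nB cA cB; split; first by apply: filterS2 nA nB => i; exact: SQB.
have cAB : 2 * (n2 (A i) + n2 (B i)) @[i --> F] --> 0.
  rewrite [X in _ --> X](_ : _ = 2 * (0 + 0)); last by rewrite addr0 mulr0.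
  by apply: cvgM; [exact: cvg_cst|exact: (cvgD cA cB)].
apply: cvg0_le cAB; apply: filterS2 nA nB => i Ai Bi.
have E0 f : (fun x => f x - (fun=> 0) x) = f.
  by apply/funext => x; rewrite subr0.
rewrite ger0_norm ?n2_ge0//.
by have := @n2_sub_le R (A i) (B i) (fun=> 0); rewrite !E0; exact.
Qed.

Lemma is_hartleyB f g h k : is_hartley f h -> is_hartley g k ->
  is_hartley (fun x => f x - g x) (fun x => h x - k x).
Proof.
move=> [f2 h2 nf cf] [g2 k2 ng cg].
have E n : (fun x => h x - k x - hart (tr n (fun x => f x - g x)) x) =
    fun x => (h x - hart (tr n f) x) - (k x - hart (tr n g) x).
  apply/funext => x; rewrite (trB n f g) (hartB x (L1_tr n f2) (L1_tr n g2)); ring.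
have [nS c] := n2_cvgB nf ng cf cg.
split; [exact: SQB|exact: SQB|..].
  by apply: filterS nS => n; rewrite E.
by under eq_fun do rewrite E.
Qed.

(* The trilinear term of the energy identity: integrating [u w w'] by parts
   leaves no derivative on [w]. *)
Lemma trilinear_bound u u1' u2' w K : (forall x, is_derive x (1 : R) u (u2' x)) ->
  (forall x, is_derive x (1 : R) w (u1' x - u2' x)) ->
  continuous u1' -> continuous u2' -> SQ u -> SQ u2' -> SQ u1' -> SQ w ->
  (forall x, `|u1' x| <= K) -> (forall x, `|u2' x| <= K) ->
  exists2 b : nat -> R, b n @[n --> \oo] --> 0 &
  forall n, `|intR (fun x => tr n w x * (w x * u1' x + u x * (u1' x - u2' x)))|
    <= 3 / 2 * K * intR (tr n (fun x => w x ^+ 2)) + `|b n|.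
Proof.
move=> du dw c1 c2 Su S2 S1 Sw K1 K2.
have cu : continuous u by eapply derive_continuous => x; exact: du.
have cw : continuous w by eapply derive_continuous => x; exact: dw.
have cw' : continuous (fun x => u1' x - u2' x).
  by move=> x; apply: cvgB; [exact: c1|exact: c2].
have Sw' : SQ (fun x => u1' x - u2' x) by exact: SQB.
(* The integrand w (w u1' + u w') equals (u1' - u2' / 2) w^2 + F', which gives the constant 3/2 and
   boundary terms tending to 0. *)
pose F x := u x * w x ^+ 2 / 2.
pose F' x := u2' x * w x ^+ 2 / 2 + u x * w x * (u1' x - u2' x).
have dF (x : R) : is_derive x (1 : R) F (F' x).
  rewrite /F; apply: eq_derive (dfun_mul (dfun_mul (du x) (dfun_sqr (dw x))) (dfun_cst 2^-1 x)) _.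
  by rewrite /F'; field.
have cF' : continuous F'.
  move=> x; apply: cvgD; last first.
    by apply: cvgM; [apply: cvgM; [exact: cu|exact: cw]|exact: cw'].
  apply: cvgM; last exact: cvg_cst.
  by apply: cvgM; [exact: c2|apply: cvgM; exact: cw].
exists (fun n => F n%:R - F (- n%:R)).
  have lim0 (a : nat -> R) : (forall n, n%:R <= `|a n|) -> F (a n) @[n --> \oo] --> 0.
    move=> ha; have wa := cvg_at_infty dw cw' Sw Sw' ha.
    have ua := cvg_at_infty du c2 Su S2 ha.
    have -> : (0 : R) = 0 * (0 * 0) * 2^-1 by rewrite !mul0r.
    by apply: cvgM; [exact: (cvgM ua (cvgM wa wa))|exact: cvg_cst].
  rewrite -[X in _ --> X](subr0 (0 : R)); apply: cvgB; apply: lim0 => n.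
    by rewrite ger0_norm.
  by rewrite normrN ger0_norm.
move=> n.
have L2 : L1 (tr n (fun x => w x ^+ 2)).
  by apply: eq_L1 (SQM (SQ_tr n Sw) Sw) => x; rewrite !trE; ring.
have mu12 : measurable_fun setT (fun x => u1' x - u2' x / 2).
  by apply: continuous_measurable => x; apply: cvgB; [exact: c1|apply: cvgM; [exact: c2|exact: cvg_cst]].
have K12 x : `|u1' x - u2' x / 2| <= 3 / 2 * K.
  apply: (le_trans (ler_normB _ _)); rewrite normrM (ger0_norm (_ : 0 <= 2^-1))//.
  by have := K1 x; have := K2 x; lra.
have La : L1 (fun x => (u1' x - u2' x / 2) * tr n (fun x => w x ^+ 2) x).
  exact: (L1_bmul mu12 K12).
have LF : L1 (F' \_ `[- n%:R, n%:R]) by exact: continuous_L1_patch.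
rewrite (_ : (fun x => tr n w x * _) = fun x =>
    (u1' x - u2' x / 2) * tr n (fun x => w x ^+ 2) x + (F' \_ `[- n%:R, n%:R]) x); last first.
  by apply/funext => x; rewrite -/(tr n F') !trE /F'; field.
rewrite (intRD La LF) (FTC2_intR _ cF' dF); last by rewrite ge0_cp.
apply: (le_trans (ler_normD _ _)); rewrite lerD2r -(intRZ _ L2).
apply: norm_intR_le; [exact: L1_measurable|exact: L1Z|].
move=> x; rewrite normrM; apply: ler_pM => //.
by rewrite trE ger0_norm// mulr_ge0 ?sqr_ge0.
Qed.

(** The left side is the time derivative of the squared norm, computed on the transforms. Once the
    linear terms are removed, Parseval on truncations turns it into an integral in x of [w] against
    the nonlinear difference, to which [trilinear_bound] applies. *)
Lemma energy_bound delta K u1 u2 h1 h2 v1 v2 : 0 < delta ->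
  (forall x, hart v1 x = hart (Lh delta h1) x - delta^-1 * hart (dh h1) x - u1 x * hart (dh h1) x) ->
  (forall x, hart v2 x = hart (Lh delta h2) x - delta^-1 * hart (dh h2) x - u2 x * hart (dh h2) x) ->
  is_hartley u1 h1 -> is_hartley u2 h2 -> u1 = hart h1 -> u2 = hart h2 ->
  L1 (q2h h1) -> SQ (q2h h1) -> L1 (q2h h2) -> SQ (q2h h2) ->
  L1 v1 -> SQ v1 -> L1 v2 -> SQ v2 ->
  SQ (hart (dh h1)) -> SQ (hart (dh h2)) ->
  (forall x, `|hart (dh h1) x| <= K) -> (forall x, `|hart (dh h2) x| <= K) ->
  `|2 * intR (fun x => (v1 x - v2 x) * (h1 x - h2 x))| <= 3 * K * n2 (fun x => h1 x - h2 x).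
Proof.
move=> d0 e1 e2 H1 H2 E1 E2 Lq1 Sq1 Lq2 Sq2 Lv1 Sv1 Lv2 Sv2 S1 S2 K1 K2.
have [L1h S1h] := q2h_id Lq1 Sq1; have [L2h S2h] := q2h_id Lq2 Sq2.
have [Lx1 Sx1] := q2h_mulx Lq1 Sq1; have [Lx2 Sx2] := q2h_mulx Lq2 Sq2.
have [LL1 SL1] := q2h_Lh d0 Lq1 Sq1; have [LL2 SL2] := q2h_Lh d0 Lq2 Sq2.
have Ld1 := L1_dh Lx1; have Ld2 := L1_dh Lx2; have Sd1 := SQ_dh Sx1; have Sd2 := SQ_dh Sx2.
pose w x := u1 x - u2 x; pose hw x := h1 x - h2 x.
have Hw : is_hartley w hw by exact: is_hartleyB.
(* Only the nonlinear term is left: [M1] and [M2] are integrable and their transforms are - u u_x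
   for the two solutions. *)
pose M1 x := v1 x - (Lh delta h1 x - delta^-1 * dh h1 x).
pose M2 x := v2 x - (Lh delta h2 x - delta^-1 * dh h2 x).
have LM1 : L1 M1 by apply: L1B => //; apply: L1B => //; exact: L1Z.
have LM2 : L1 M2 by apply: L1B => //; apply: L1B => //; exact: L1Z.
have SM1 : SQ M1 by apply: SQB => //; apply: SQB => //; exact: SQZ.
have SM2 : SQ M2 by apply: SQB => //; apply: SQB => //; exact: SQZ.
have hM1 x : hart M1 x = - (u1 x * hart (dh h1) x).
  rewrite (hartB x Lv1 (L1B LL1 (L1Z delta^-1 Ld1))) (hartB x LL1 (L1Z delta^-1 Ld1)).
  by rewrite (hartZ _ x Ld1) e1; ring.
have hM2 x : hart M2 x = - (u2 x * hart (dh h2) x).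
  rewrite (hartB x Lv2 (L1B LL2 (L1Z delta^-1 Ld2))) (hartB x LL2 (L1Z delta^-1 Ld2)).
  by rewrite (hartZ _ x Ld2) e2; ring.
have p1 := hartley_pairing Hw (L1B LM1 LM2) (SQB SM1 SM2).
have p2 := hartley_pairing Hw (L1B L1h L2h) (SQB S1h S2h).
have Shw : SQ hw by exact: SQB.
have [Sw _ _ _] := Hw.
have [b b0 Hb] : exists2 b : nat -> R, b n @[n --> \oo] --> 0 &
    forall n, `|intR (fun x => tr n w x * (w x * hart (dh h1) x + u2 x * (hart (dh h1) x - hart (dh h2) x)))|
    <= 3 / 2 * K * intR (tr n (fun x => w x ^+ 2)) + `|b n|.
  have d2 (x : R) : is_derive x (1 : R) u2 (hart (dh h2) x) by rewrite E2; exact: is_derive_hart.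
  have d1 (x : R) : is_derive x (1 : R) u1 (hart (dh h1) x) by rewrite E1; exact: is_derive_hart.
  have [Su1 _ _ _] := H1; have [Su2 _ _ _] := H2.
  apply: trilinear_bound => //; try exact: hart_continuous.
have I : intR (fun x => hw x * (M1 x - M2 x)) = intR (fun x => (v1 x - v2 x) * (h1 x - h2 x)).
  (* Contribution of the linear terms. The symbol is even, so [O] is hw(x) hw(-x) times an odd
     function of x. *)
  pose O x := hw x * ((Lh delta h1 x - delta^-1 * dh h1 x) - (Lh delta h2 x - delta^-1 * dh h2 x)).
  have LO : L1 O by apply: SQM => //; apply: SQB; apply: SQB => //; exact: SQZ.
  have LI : L1 (fun x => (v1 x - v2 x) * (h1 x - h2 x)) by apply: SQM => //; exact: SQB.
  have O0 : intR O = 0.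
    apply: intR_odd => // x; rewrite /O /hw /Lh /dh !Ldx_symbolN !opprK.
    by move: (Ldx_symbol delta x) (pi) (delta^-1) => *; ring.
  rewrite (_ : (fun x => hw x * _) = fun x => (v1 x - v2 x) * (h1 x - h2 x) - O x).
    by rewrite intRB// O0 subr0.
  by apply/funext => x; rewrite /O /hw /M1 /M2; ring.
have n2E : intR (fun x => hw x * (h1 x - h2 x)) = n2 hw by [].
rewrite I in p1; rewrite n2E in p2.
have p3 : 3 / 2 * K * intR (tr n (fun x => w x ^+ 2)) + `|b n| @[n --> \oo] --> 3 / 2 * K * n2 hw.
  rewrite -[X in _ --> X]addr0; apply: cvgD; last by rewrite -[X in _ --> X](@normr0 _ R); exact: cvg_norm.
  apply: cvgM; first exact: cvg_cst.
  rewrite (_ : (fun n => intR _) = fun n => intR (fun x => tr n w x * hart (fun x => h1 x - h2 x) x)) //.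
  apply/funext => n; congr intR; apply/funext => x.
  by rewrite (hartB x L1h L2h) -E1 -E2 !trE /w; ring.
have : `|intR (fun x => (v1 x - v2 x) * (h1 x - h2 x))| <= 3 / 2 * K * n2 hw.
  apply: ler_cvg_to (cvg_norm p1) p3 _; near=> n.
  pose G x := tr n w x * (w x * hart (dh h1) x + u2 x * (hart (dh h1) x - hart (dh h2) x)).
  have GE x : tr n w x * hart (fun x => M1 x - M2 x) x = -1 * G x.
    by rewrite (hartB x LM1 LM2) hM1 hM2 /G /w; ring.
  have LG : L1 G.
    have mH : measurable_fun setT (hart (fun x => M1 x - M2 x)).
      by apply: continuous_measurable; apply: hart_continuous; exact: L1B.
    have := L1Z (-1) (L1_bmul mH (fun x => hart_le x (L1B LM1 LM2)) (L1_tr n Sw)).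
    by apply: eq_L1 => x; rewrite [_ * tr n w x]mulrC GE mulrA mulrNN !mul1r.
  under eq_fun do rewrite GE.
  by rewrite (intRZ _ LG) mulN1r normrN; exact: Hb.
by rewrite normrM ger0_norm//; lra.
Unshelve. all: by end_near. Qed.

End EnergyEstimate.

(** * Gronwall's lemma and the derivative of the squared norm *)

Section Gronwall.
Context {R : realType}.
Local Notation mu := (@lebesgue_measure R).
Implicit Types (f : R -> R) (t x C T : R).

(** Before [t1] the function f exp (C t) is nondecreasing, after [t1] f exp (- C t) is
    nonincreasing; both vanish at [t1] and are nonnegative. *)
Lemma gronwall_zero f f' C T t1 :
  (forall t : R, t \in `]0, T[ -> is_derive t (1 : R) f (f' t)) ->
  (forall t, t \in `]0, T[ -> 0 <= f t) ->
  (forall t, t \in `]0, T[ -> `|f' t| <= C * f t) ->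
  t1 \in `]0, T[ -> f t1 = 0 -> forall t, t \in `]0, T[ -> f t = 0.
Proof.
move=> df f0 fC t1T f1 t tT.
have main c a b : a < b -> a \in `]0, T[ -> b \in `]0, T[ ->
    exists2 z, z \in `]0, T[ & f b * expR (c * b) - f a * expR (c * a) =
      (f' z + c * f z) * expR (c * z) * (b - a).
  move=> ab aT bT.
  have sub z : z \in `[a, b] -> z \in `]0, T[.
    move: aT bT; rewrite !in_itv/= => /andP[a0 _] /andP[_ bT] /andP[az zb].
    by rewrite (lt_le_trans a0 az) (le_lt_trans zb bT).
  have dg (z : R) : z \in `[a, b] -> is_derive z (1 : R) (fun z => f z * expR (c * z))
      ((f' z + c * f z) * expR (c * z)).
    move=> /sub/df dz.
    by apply: eq_derive (dfun_mul dz (dfun_exp (dfun_mul (dfun_cst c z) (dfun_id z)))) _; ring.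
  have dg' (z : R) : z \in `]a, b[ -> is_derive z (1 : R) (fun z => f z * expR (c * z))
      ((f' z + c * f z) * expR (c * z)).
    by move=> /subset_itv_oo_cc; exact: dg.
  have cg : {within `[a, b], continuous (fun z => f z * expR (c * z))}.
    by apply: derivable_within_continuous => z zab; have [] := dg z zab.
  have [z zab E] := MVT ab dg' cg.
  by exists z; [exact: sub (subset_itv_oo_cc zab)|].
apply/eqP; rewrite eq_le f0// andbT.
have [tt1|t1t|->] := ltgtP t t1; last by rewrite f1.
- have [z zT] := main C t t1 tt1 tT t1T; rewrite f1 mul0r sub0r => E.
  have : 0 <= - (f t * expR (C * t)).
    rewrite E mulr_ge0 ?subr_ge0 ?(ltW tt1)// mulr_ge0 ?expR_ge0//.
    by have := fC _ zT; rewrite ler_norml => /andP[]; lra.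
  by rewrite oppr_ge0 pmulr_lle0// expR_gt0.
- have [z zT] := main (- C) t1 t t1t t1T tT; rewrite f1 mul0r subr0 => E.
  have : f t * expR (- C * t) <= 0.
    rewrite E pmulr_lle0 ?subr_gt0// pmulr_lle0 ?expR_gt0//.
    by have := fC _ zT; rewrite ler_norml => /andP[]; lra.
  by rewrite pmulr_lle0// expR_gt0.
Qed.

(** Writing g (t + h) = g t + h D, the quotient of the squared norms is 2 <D, g t> + h n2 D, and n2
    D stays bounded as h tends to 0. *)
Lemma is_derive_n2 (g : R -> R -> R) (v : R -> R) (t : R) : SQ (g t) -> SQ v ->
  (\forall h \near (0 : R)^', SQ (fun x => h^-1 * (g (t + h) x - g t x) - v x)) ->
  n2 (fun x => h^-1 * (g (t + h) x - g t x) - v x) @[h --> 0^'] --> 0 ->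
  is_derive t (1 : R) (fun r => n2 (g r)) (2 * intR (fun x => v x * g t x)).
Proof.
move=> Sg Sv nD cD.
pose D (h : R) x := h^-1 * (g (t + h) x - g t x).
have nS : \forall h \near (0 : R)^', SQ (D h).
  apply: filterS nD => h Dh.
  rewrite (_ : D h = fun x => D h x - v x + v x); first exact: SQD.
  by apply/funext => x; rewrite subrK.
have c1 : intR (fun x => D h x * g t x) @[h --> (0 : R)^'] --> intR (fun x => v x * g t x).
  exact: cvg_pairing.
have c0 : h @[h --> (0 : R)^'] --> (0 : R) by apply: cvg_within.
have c2 : h * n2 (D h) @[h --> (0 : R)^'] --> 0.
  have : `|h| * (2 * (n2 (fun x => D h x - v x) + n2 v)) @[h --> (0 : R)^'] --> 0.
    rewrite [X in _ --> X](_ : _ = `|0 : R| * (2 * (0 + n2 v))); last by rewrite normr0 mul0r.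
    apply: cvgM; first exact: cvg_norm.
    by apply: cvgM; [exact: cvg_cst|apply: cvgD => //; exact: cvg_cst].
  apply: cvg0_le; apply: filterS2 nD nS => h Dv Dh.
  rewrite normrM (ger0_norm (n2_ge0 _)) ler_wpM2l//.
  have Nv : SQ (fun x => 0 - v x) by apply: SQB => //; rewrite (_ : (fun=> 0) = fun x => v x - v x);
     [exact: SQB|apply/funext => x; rewrite subrr].
  have := n2_sub_le Dv Nv.
  rewrite (_ : (fun x => D h x - 0) = D h); last by apply/funext => x; rewrite subr0.
  by rewrite [n2 (fun x => 0 - v x)](_ : _ = n2 v)// /n2; congr intR; apply/funext => x; rewrite sub0r sqrrN.
have c3 : h^-1 *: (n2 (g (h *: 1 + t)) - n2 (g t)) @[h --> (0 : R)^'] -->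
    2 * intR (fun x => v x * g t x).
  have : 2 * intR (fun x => D h x * g t x) + h * n2 (D h) @[h --> (0 : R)^'] -->
      2 * intR (fun x => v x * g t x) + 0.
    by apply: cvgD => //; apply: cvgM => //; exact: cvg_cst.
  rewrite addr0; apply: cvg_trans; apply: near_eq_cvg.
  have n0 : \forall h \near (0 : R)^', h != 0 by exact: nbhs_dnbhs_neq.
  apply: filterS2 n0 nS => h h0 Sh.
  rewrite /GRing.scale/= mulr1 [h + t]addrC.
  have LDg := SQM Sh Sg; have [_ LD] := Sh; have [_ Lg] := Sg.
  have E : n2 (g (t + h)) = n2 (g t) + (2 * h) * intR (fun x => D h x * g t x) + h ^+ 2 * n2 (D h).
    rewrite /n2 -(intRZ _ LDg) -(intRZ _ LD).
    have LA := L1D Lg (L1Z (2 * h) LDg).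
    rewrite -(intRD Lg (L1Z (2 * h) LDg)) -(intRD LA (L1Z (h ^+ 2) LD)).
    by congr intR; apply/funext => x; rewrite /D; field.
  by rewrite E; field.
apply: DeriveDef; first by apply/cvg_ex; eexists; exact: c3.
by apply: cvg_lim; [exact: norm_hausdorff|exact: c3].
Qed.

End Gronwall.

(** * Unique continuation for the difference of two solutions *)

Section Continuation.
Context {R : realType}.
Local Notation mu := (@lebesgue_measure R).
Implicit Types (f g k u v : R -> R) (t x C T delta : R).

Lemma hart_dhB (h1 h2 : R -> R) x : L1 (q2h h1) -> SQ (q2h h1) -> L1 (q2h h2) -> SQ (q2h h2) ->
  hart (dh (fun x => h1 x - h2 x)) x = hart (dh h1) x - hart (dh h2) x.
Proof.
move=> L1q S1q L2q S2q.
have [Lx1 _] := q2h_mulx L1q S1q; have [Lx2 _] := q2h_mulx L2q S2q.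
rewrite -(hartB x (L1_dh Lx1) (L1_dh Lx2)); congr (hart _ x).
by apply/funext => y; rewrite /dh mulrBr.
Qed.

Lemma q2hB (h1 h2 : R -> R) : q2h (fun x => h1 x - h2 x) = fun x => q2h h1 x - q2h h2 x.
Proof. by apply/funext => x; rewrite /q2h mulrBr. Qed.

(** Near [x0] the local terms of the two equations agree, hence so do the nonlocal ones. Uniqueness
    is applied to the space derivative of the difference; the difference is then constant, and it
    vanishes at [x0]. *)
Lemma local_uniqueness delta u1 u2 v1 v2 (h1 h2 : R -> R) x0 r : 0 < delta -> 0 < r ->
  (forall x, hart v1 x = hart (Lh delta h1) x - delta^-1 * hart (dh h1) x - u1 x * hart (dh h1) x) ->
  (forall x, hart v2 x = hart (Lh delta h2) x - delta^-1 * hart (dh h2) x - u2 x * hart (dh h2) x) ->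
  u1 = hart h1 -> u2 = hart h2 ->
  L1 (q2h h1) -> SQ (q2h h1) -> L1 (q2h h2) -> SQ (q2h h2) ->
  (forall x, `|x - x0| < r -> u1 x = u2 x) ->
  (forall x, `|x - x0| < r -> hart v1 x = hart v2 x) ->
  u1 = u2.
Proof.
move=> d0 r0 e1 e2 E1 E2 L1q S1q L2q S2q uE vE.
pose hw x := h1 x - h2 x.
have Lqw : L1 (q2h hw) by rewrite q2hB; exact: L1B.
have Sqw : SQ (q2h hw) by rewrite q2hB; exact: SQB.
have [L1h _] := q2h_id L1q S1q; have [L2h _] := q2h_id L2q S2q.
have [Lhw _] := q2h_id Lqw Sqw; have [Lxw _] := q2h_mulx Lqw Sqw.
have wE x : hart hw x = u1 x - u2 x by rewrite (hartB x L1h L2h) E1 E2.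
have dw (x : R) : is_derive x (1 : R) (hart hw) (hart (dh hw) x) by exact: is_derive_hart.
have dw0 x : `|x - x0| < r -> hart (dh hw) x = 0.
  move=> xr; rewrite -(is_derive_derive1 (dw x)).
  have E : {near x, hart hw =1 cst 0}.
    have : \forall y \near x, `|y - x0| < r.
      have c : `|y - x0| @[y --> x] --> `|x - x0|.
        by apply: cvg_norm; apply: cvgB; [exact: cvg_id|exact: cvg_cst].
      exact: (cvgr_lt _ c _ xr).
    by apply: filterS => y /uE; rewrite wE => ->; rewrite subrr.
  by rewrite derive1E (near_eq_derive _ E) derive_cst.
have LLw x : `|x - x0| < r -> hart (fun xi => Ldx_symbol delta xi * dh hw xi) x = 0.
  move=> xr; have [LL1 _] := q2h_Lh d0 L1q S1q; have [LL2 _] := q2h_Lh d0 L2q S2q.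
  rewrite (_ : (fun xi => _ * _) = fun y => Lh delta h1 y - Lh delta h2 y); last first.
    by apply/funext => y; rewrite /Lh /dh /hw; ring.
  rewrite (hartB x LL1 LL2); have := dw0 x xr.
  rewrite (hart_dhB x L1q S1q L2q S2q) => /eqP; rewrite subr_eq0 => /eqP dE.
  have := vE x xr; rewrite e1 e2 dE (uE x xr).
  by move=> H; apply/eqP; rewrite subr_eq0; apply/eqP; lra.
have [Lw _] := q2h_Lh d0 Lqw Sqw.
have dwe := strip_uniqueness d0 r0 (L1_dh Lxw) Lw dw0 LLw.
have dwz (x : R) : is_derive x (1 : R) (hart hw) 0 by rewrite -(dwe x).
apply/funext => x; apply/eqP; rewrite -subr_eq0 -wE (is_derive_0_is_cst x x0 dwz).
by rewrite wE (uE x0) subrr ?normr0.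
Qed.

Lemma hart_dh_le (h : R -> R) x : L1 (q2h h) -> SQ (q2h h) ->
  `|hart (dh h) x| <= 4 * pi * intR (fun y => `|q2h h y|).
Proof.
move=> Lq Sq; have [Lx _] := q2h_mulx Lq Sq; have p0 := pi_ge0 R.
have Ld := L1_dh Lx.
apply: (le_trans (hart_le x Ld)).
(* One factor 2 bounds cas, the other comes with pi from the multiplier of the derivative. *)
rewrite (_ : 4 * pi = 2 * (2 * pi)); last by rewrite mulrA -natrM.
rewrite -mulrA ler_wpM2l//.
have [Lo Io] := intR_opp (L1_norm Lq); rewrite -Io -(intRZ _ Lo).
apply: le_intR; [exact: L1_norm|exact: L1Z|].
move=> y; rewrite /dh /q2h !normrM normrN 2!normrM (ger0_norm p0) (ger0_norm (_ : 0 <= 2)) ?ler0n//.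
rewrite (ger0_norm (ltW (v_gt0 _))) mulrA ler_wpM2r// ler_wpM2l ?mulr_ge0//.
by rewrite sqrrN le_1X2.
Qed.

End Continuation.

(** * Propagation to all times *)

Section TimeUniqueness.
Context {R : realType}.
Local Notation mu := (@lebesgue_measure R).
Implicit Types (f g k : R -> R) (t x C T delta : R).

(** Provides the bound on u_x, uniform in space and time, that the energy estimate needs: the L^1
    norm of [q2h] is continuous on the compact [0, T]. *)
Lemma transform_bound delta T u (hs hv : R -> R -> R) : 0 < T ->
  ILW_transform delta T u hs hv ->
  exists K, forall t, t \in `[0, T] -> forall x, `|hart (dh (hs t)) x| <= K.
Proof.
move=> T0 [Hs _].
pose b t := intR (fun y => `|q2h (hs t) y|).
have cb : {within `[0, T], continuous b}.
  apply/subspace_continuousP => t tT; have [_ Lt _ _ cv] := Hs t tT.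
  have FF : ProperFilter (within `[0, T] (nbhs t)).
    by apply: within_nbhs_proper; exact: subset_closure.
  apply/subr_cvg0; apply: (cvg0_le _ cv); near=> r.
  have rT : `[0, T]%classic r by near: r; exact: withinT.
  have [_ Lr _ _ _] := Hs r rT.
  rewrite -intRB; [|exact: L1_norm..]; apply: norm_intR_le.
  - by apply: L1_measurable; apply: L1B; exact: L1_norm.
  - by apply: L1_norm; exact: L1B.
  - by move=> x; exact: ler_dist_dist.
have [c cT bc] := EVT_max (ltW T0) cb.
exists (4 * pi * b c) => t tT x; have [_ Lt St _ _] := Hs t tT.
apply: (le_trans (hart_dh_le x Lt St)).
by rewrite ler_wpM2l ?bc// mulr_ge0// pi_ge0.
Unshelve. all: by end_near. Qed.

Lemma transform_cvg delta T u (hs hv : R -> R -> R) t x : ILW_transform delta T u hs hv ->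
  t \in `[0, T] -> u r x @[r --> within `[0, T] (nbhs t)] --> u t x.
Proof.
move=> [Hs _] tT; have [_ Lt St Et cv] := Hs t tT.
have FF : ProperFilter (within `[0, T] (nbhs t)).
  by apply: within_nbhs_proper; exact: subset_closure.
have cv2 : 2 * intR (fun x => `|q2h (hs r) x - q2h (hs t) x|)
    @[r --> within `[0, T] (nbhs t)] --> 0.
  by rewrite -[X in _ --> X](mulr0 2); apply: cvgM; [exact: cvg_cst|exact: cv].
apply/subr_cvg0; apply: (cvg0_le _ cv2); near=> r.
have rT : `[0, T]%classic r by near: r; exact: withinT.
have [_ Lr Sr Er _] := Hs r rT.
have [L1r _] := q2h_id Lr Sr; have [L1t _] := q2h_id Lt St.
rewrite Er Et -(hartB x L1r L1t); apply: (le_trans (hart_le x (L1B L1r L1t))).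
rewrite ler_wpM2l//; apply: le_intR.
- by apply: L1_norm; exact: L1B.
- by apply: L1_norm; exact: L1B.
move=> y; rewrite /q2h -mulrBr normrM ler_peMl//.
by rewrite ger0_norm ?lerDl ?sqr_ge0// ltW// v_gt0.
Unshelve. all: by end_near. Qed.

Lemma closure_itvoo_cc T t : 0 < T -> t \in `[0, T] -> closure `]0, T[ t.
Proof.
move=> T0; rewrite in_itv/= => /andP[t0 tT] B /nbhs_ballP[e /= e0 eB].
(* The witness moves from [t] towards the midpoint T / 2 by a proportion [l]: l < 1 keeps it inside
   ]0, T[ and l T < e keeps it close to [t]. *)
pose l := Num.min 1 (e / T) / 2.
have l0 : 0 < l by rewrite divr_gt0// lt_min ltr01 divr_gt0.
have l1 : l < 1.
  by rewrite ltr_pdivrMr// mul1r (@le_lt_trans _ _ 1) ?ltr1n// ge_min lexx.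
have lT : l * T < e.
  rewrite -ltr_pdivlMr//; apply: (@lt_le_trans _ _ (Num.min 1 (e / T))).
    by rewrite ltr_pdivrMr// ltr_pMr ?ltr1n// lt_min ltr01 divr_gt0.
  by rewrite ge_min lexx orbT.
exists (t + l * (T / 2 - t)); split.
  by rewrite /= in_itv/=; apply/andP; split; nra.
apply: eB; rewrite /ball/= opprD addrA subrr sub0r normrN normrM (gtr0_norm l0).
apply: le_lt_trans lT; rewrite ler_wpM2l ?(ltW l0)//.
by rewrite ler_norml; apply/andP; split; lra.
Qed.

Lemma time_uniqueness delta T (u1 u2 hs1 hv1 hs2 hv2 : R -> R -> R) t1 :
  0 < delta -> 0 < T ->
  ILW_transform delta T u1 hs1 hv1 -> ILW_transform delta T u2 hs2 hv2 ->
  t1 \in `]0, T[ -> u1 t1 = u2 t1 ->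
  forall t, t \in `[0, T] -> u1 t = u2 t.
Proof.
move=> d0 T0 tr1 tr2 t1T u12.
have [K1 HK1] := transform_bound T0 tr1; have [K2 HK2] := transform_bound T0 tr2.
have [Hs1 Hv1] := tr1; have [Hs2 Hv2] := tr2.
have sub r : r \in `]0, T[ -> r \in `[0, T].
  by rewrite !in_itv/= => /andP[/ltW -> /ltW ->].
pose hw t x := hs1 t x - hs2 t x.
have Shs t : t \in `[0, T] -> SQ (hs1 t) /\ SQ (hs2 t).
  by move=> tT; have [[_ ? _ _] _ _ _ _] := Hs1 t tT; have [[_ ? _ _] _ _ _ _] := Hs2 t tT.
pose E' t := 2 * intR (fun x => (hv1 t x - hv2 t x) * hw t x).
have dE t : t \in `]0, T[ -> is_derive t (1 : R) (fun r => n2 (hw r)) (E' t).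
  move=> tT; have [[_ Sv1 n1 c1] _] := Hv1 t tT; have [[_ Sv2 m2 c2] _] := Hv2 t tT.
  have [S1 S2] := Shs _ (sub _ tT).
  pose A (h : R) x := h^-1 * (hs1 (t + h) x - hs1 t x) - hv1 t x.
  pose B (h : R) x := h^-1 * (hs2 (t + h) x - hs2 t x) - hv2 t x.
  have DE (h : R) : (fun x => h^-1 * (hw (t + h) x - hw t x) - (hv1 t x - hv2 t x)) =
      fun x => A h x - B h x.
    by apply/funext => x; rewrite /A /B /hw; ring.
  have [SD cD] := n2_cvgB n1 m2 c1 c2.
  apply: is_derive_n2; [exact: SQB|exact: SQB|..].
    by apply: filterS SD => h; rewrite DE.
  by under eq_fun do rewrite DE.
(* Equal functions have transforms equal only almost everywhere, which the norm does not see. *)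
have E0 : n2 (hw t1) = 0.
  have [H1 _ _ _ _] := Hs1 t1 (sub _ t1T); have [H2 _ _ _ _] := Hs2 t1 (sub _ t1T).
  rewrite u12 in H1; have ae := hartley_unique H1 H2.
  have [S1 S2] := Shs _ (sub _ t1T).
  have S0 : SQ (fun x => hs2 t1 x - hs2 t1 x) by exact: SQB.
  rewrite (@ae_eq_n2 R _ (fun x => hs2 t1 x - hs2 t1 x)).
  - by rewrite /n2; under eq_fun do rewrite subrr expr0n; exact: intR0.
  - by apply: SQ_measurable; exact: SQB.
  - exact: SQ_measurable.
  - by apply: aeS ae => x; rewrite /hw => ->.
have Ez t : t \in `]0, T[ -> n2 (hw t) = 0.
  move=> tT; apply: (gronwall_zero dE _ _ t1T E0 tT) => r rT; first exact: n2_ge0.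
    have rT' := sub _ rT.
    have [[Lv1 Sv1 _ _] [_ SS1 e1]] := Hv1 r rT; have [[Lv2 Sv2 _ _] [_ SS2 e2]] := Hv2 r rT.
    have [H1 Lq1 Sq1 U1 _] := Hs1 r rT'; have [H2 Lq2 Sq2 U2 _] := Hs2 r rT'.
    apply: (@energy_bound R delta (Num.max K1 K2) _ _ _ _ _ _ d0 e1 e2) => // x.
    - by rewrite le_max HK1.
    - by rewrite le_max HK2 ?orbT.
have ueq t : t \in `]0, T[ -> u1 t = u2 t.
  move=> tT; have tT' := sub _ tT.
  have [S1 S2] := Shs _ tT'; have ae := n2_eq0_ae (SQB S1 S2) (Ez _ tT).
  have [_ _ _ -> _] := Hs1 t tT'; have [_ _ _ -> _] := Hs2 t tT'.
  apply: ae_eq_hart; [exact: SQ_measurable|exact: SQ_measurable|].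
  by apply: aeS ae => x /eqP; rewrite subr_eq0 => /eqP.
(* The equation lives on the open interval; continuity in time at fixed [x] carries the equality to
   the endpoints. *)
move=> t tT; apply/funext => x.
have FF : ProperFilter (within `]0, T[ (nbhs t)).
  by apply: within_nbhs_proper; exact: closure_itvoo_cc.
have lim u hs hv : ILW_transform delta T u hs hv ->
    u r x @[r --> within `]0, T[ (nbhs t)] --> u t x.
  move=> tru; apply: cvg_trans (transform_cvg (x := x) tru tT).
  apply: cvg_app => A; rewrite /within/=; apply: (@filterS _ (nbhs t)) => r rA /sub; exact: rA.
have l1 := lim _ _ _ tr1; have l2 := lim _ _ _ tr2.
have l3 : u2 r x @[r --> within `]0, T[ (nbhs t)] --> u1 t x.
  apply: cvg_trans l1; apply: near_eq_cvg.
  near=> r; rewrite ueq//.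
  by near: r; exact: withinT.
exact: (@cvg_unique _ (@norm_hausdorff _ R) _ _ _ _ l3 l2).
Unshelve. all: by end_near. Qed.

End TimeUniqueness.

(** * The zero solution and the conclusion *)

Section Conclusion.
Context {R : realType}.
Local Open Scope complex_scope.
Local Notation mu := (@lebesgue_measure R).
Implicit Types (x t delta T s : R).

Lemma SQ0 : SQ (fun=> 0 : R).
Proof.
split; first exact: measurable_cst.
by apply: eq_L1 L1_0 => x; rewrite expr0n.
Qed.

Lemma fourier_trunc0 n xi : fourier_trunc (fun=> 0 : R) n xi = 0.
Proof.
rewrite /fourier_trunc; under [X in cintegral _ X]eq_fun do rewrite mulr0.
by rewrite /cintegral/= /Rintegral integral0.
Qed.

Lemma is_fourier_zero : is_fourier (fun=> 0 : R) (fun=> 0).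
Proof.
split; first exact: SQ_L2 SQ0; first by split; exact: SQ_L2 SQ0.
rewrite (_ : (fun n => _) = fun=> 0%E); first exact: cvg_cst.
apply/funext => n; apply: integral0_eq => xi _.
by rewrite fourier_trunc0 subrr /normc2/= expr0n addr0.
Qed.

(** Needed for any transform of 0, since the one selected by [fourier] is known to vanish only
    almost everywhere. *)
Lemma weighted_norm_zero s fh : is_fourier (fun=> 0 : R) fh -> weighted_norm s fh = 0%E.
Proof.
move=> [_ [/L2_SQ[mr Lr] /L2_SQ[mi Li]] cv].
pose N x := normc2 (fh x).
have LN : L1 N by exact: L1D.
have N0 x : 0 <= N x by exact: normc2_ge0.
have I0 : intR N = 0.
  have /fine_cvgP[_] := cv; rewrite (_ : fine \o _ = fun=> intR N).
    move=> c; apply: (@cvg_unique _ (@norm_hausdorff _ R) _ _ _ _ (cvg_cst _) c).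
  apply/funext => n /=; rewrite /intR /Rintegral; congr fine.
  by apply: eq_integral => xi _; rewrite fourier_trunc0 subr0.
have ae := intR_eq0_ae LN N0 I0.
have mW : measurable_fun setT (fun x => wt s x * N x).
  by apply: measurable_funM; [exact: measurable_wt|exact: L1_measurable].
have aeW : {ae mu, forall x, 0 = wt s x * N x}.
  by apply: aeS ae => x ->; rewrite mulr0.
have LW := ae_eq_L1 mW aeW L1_0.
have -> : weighted_norm s fh = ((\int[mu]_xi (wt s xi * N xi)%:E) `^ 2^-1)%E by [].
rewrite -(EFin_intR LW) -(ae_eq_intR (measurable_cst _) mW aeW) intR0.
by rewrite poweR_EFin powR0 ?invr_eq0.
Qed.

Lemma sobolev_norm_zero s (f : R -> R) : (forall x, f x = 0) -> sobolev_norm s f = 0%E.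
Proof.
move=> f0; rewrite (_ : f = fun=> 0); last exact/funext.
by apply: weighted_norm_zero; exact: fourierP is_fourier_zero.
Qed.

(** Makes the vanishing statement an instance of uniqueness, with 0 as second solution. *)
Lemma zero_solution delta T s : ILW_solution delta T s (fun _ _ => 0 : R).
Proof.
have S0 p : sobolev p (fun=> 0 : R).
  by exists (fun=> 0); [exact: is_fourier_zero|rewrite weighted_norm_zero//; exact: is_fourier_zero].
have C0 D p : C0_sobolev D p (fun _ _ => 0 : R).
  move=> t _; split => //.
  rewrite (_ : (fun r => sobolev_norm _ _) = fun=> 0%E); first exact: cvg_cst.
  by apply/funext => r; apply: sobolev_norm_zero => x; rewrite /= subrr.
split => //.
  split => //; exists (fun _ _ => 0) => // t _.
  rewrite (_ : (fun h => sobolev_norm _ _) = fun=> 0%E); first exact: cvg_cst.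
  apply/funext => h; apply: sobolev_norm_zero => x.
  by rewrite -[LHS]/(h^-1 * (0 - 0) - 0 : R) !subr0 mulr0.
have d0 : derive1 (fun=> 0 : R) = (fun=> 0 : R).
  by apply/funext => x; rewrite derive1_cst.
split=> [t _|t _]; first exact: cst_continuous.
exists (fun=> 0); split.
- exact: cst_continuous.
- exists (fun=> 0); rewrite ?d0; first exact: is_fourier_zero.
  rewrite (_ : (fun xi => _) = fun=> 0); first exact: is_fourier_zero.
  by apply/funext => xi /=; rewrite mulr0.
- by move=> x; rewrite d0 !(subrr, mulr0, addr0).
Qed.

Lemma ILW_uniqueness delta T s (u1 u2 : R -> R -> R) (Omega : set (R * R)) :
  0 < delta -> 0 < T -> 5 / 2 < s ->
  ILW_solution delta T s u1 -> ILW_solution delta T s u2 ->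
  open_in_strip T Omega -> Omega !=set0 ->
  (forall x t, Omega (x, t) -> u1 t x = u2 t x) ->
  forall x t, t \in `[0, T] -> u1 t x = u2 t x.
Proof.
move=> d0 T0 s5 sol1 sol2 [U oU ->] [[x0 t0] [Op /= t0T]] uO x t tT.
have [hs1 [hv1 tr1]] := solution_facts d0 s5 sol1.
have [hs2 [hv2 tr2]] := solution_facts d0 s5 sol2.
have oball (p : R * R) : U p -> exists2 e : R, 0 < e &
    forall y r, `|y - p.1| < e -> `|r - p.2| < e -> U (y, r).
  move=> pU; have /nbhs_ballP[e /= e0 eU] : nbhs p U by exact: open_nbhs_nbhs.
  by exists e => // y r ye re; apply: eU; split; rewrite /ball/= distrC.
have [e e0 eU] := oball _ Op.
(* The given point may lie at time 0 or T; it is moved to an interior time, where the equation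
   holds. *)
have [t1 [t1T /= t1e]] := closure_itvoo_cc T0 t0T (nbhsx_ballx t0 _ e0).
have Op1 : U (x0, t1).
  by apply: eU => /=; [rewrite subrr normr0|rewrite distrC].
have [r r0 rO] := oball _ Op1.
have sub q : q \in `]0, T[ -> q \in `[0, T].
  by rewrite !in_itv/= => /andP[/ltW -> /ltW ->].
have u12 : u1 t1 = u2 t1.
  have [Hs1 Hv1] := tr1; have [Hs2 Hv2] := tr2.
  have [_ [D1 _ e1]] := Hv1 t1 t1T; have [_ [D2 _ e2]] := Hv2 t1 t1T.
  have [_ L1q S1q E1 _] := Hs1 t1 (sub _ t1T); have [_ L2q S2q E2 _] := Hs2 t1 (sub _ t1T).
  apply: (local_uniqueness (x0 := x0) d0 r0 e1 e2 E1 E2 L1q S1q L2q S2q) => y yr.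
    by apply: uO; split; [apply: rO; rewrite /= ?subrr ?normr0|exact: (sub _ t1T)].
  (* At each such [y] the two solutions agree at all times near [t1], so their time derivatives at
     [t1] agree too. *)
  rewrite -D1 -D2 !derive1E; apply: near_eq_derive.
  have nr : \forall q \near t1, `|q - t1| < r.
    have c : `|q - t1| @[q --> t1] --> `|t1 - t1|.
      by apply: cvg_norm; apply: cvgB; [exact: cvg_id|exact: cvg_cst].
    have t1r : `|t1 - t1| < r by rewrite subrr normr0.
    exact: (cvgr_lt _ c _ t1r).
  apply: filterS2 nr (near_in_itvoo t1T) => q qr qT; apply: uO.
  by split; [exact: rO|exact: (sub _ qT)].
by rewrite (time_uniqueness d0 T0 tr1 tr2 t1T u12 tT).
Qed.

End Conclusion.

Theorem theorem1p7 (R : realType) (delta T s : R)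
  (delta_gt0 : 0 < delta) (T_gt0 : 0 < T) (s_gt : 5 / 2 < s)
  (u1 u2 : R -> R -> R)
  (sol1 : ILW_solution delta T s u1) (sol2 : ILW_solution delta T s u2)
  (Omega : set (R * R)) (Omega_open : open_in_strip T Omega)
  (Omega_neq0 : Omega !=set0) :
  ((forall x t, Omega (x, t) -> u1 t x = u2 t x) ->
     forall x t, t \in `[0, T] -> u1 t x = u2 t x) /\
  ((forall x t, Omega (x, t) -> u1 t x = 0) ->
     forall x t, t \in `[0, T] -> u1 t x = 0).
Proof.
split; first exact: (ILW_uniqueness delta_gt0 T_gt0 s_gt sol1 sol2 Omega_open).
exact: (ILW_uniqueness delta_gt0 T_gt0 s_gt sol1 (zero_solution delta T s) Omega_open).
Qed.
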